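(* Let $n\ge2$, let $\Gamma\subset\mathrm{SO}^+(n,1)$ be a torsion-free discrete cocompact subgroup, $M=\mathbb H^n/\Gamma$, $\pi_1(M)\cong\Gamma$. Let $\tau\in Z^1(\Gamma,\mathbb R^{n+1})$ and let $\mathcal D_\tau\subset\mathbb M^{n+1}$ be the unique $\Gamma_\tau$-invariant future complete regular domain (the universal cover of $Y_\tau=\mathcal D_\tau/\Gamma_\tau$), with cosmological time $\widetilde T$. For $a>0$ let $\widetilde S_a=\widetilde T^{-1}(a)$ and let $d_a$ be its natural path distance. Then $\widetilde S_a$ is a $\pi_1(M)$-invariant spacelike surface on which $\pi_1(M)$ acts by isometries, and: (i) as $a\to+\infty$, the $\pi_1(M)$-action on the rescaled surface $(\widetilde S_a,\frac{d_a}{a})$ converges in the Gromov sense to the action of $\pi_1(M)$ on $\mathbb H^n$; (ii) as $a\to0$, the marked length spectrum of the $\pi_1(M)$-action on $(\widetilde S_a,d_a)$ converges to the marked length spectrum of the $\pi_1(M)$-action on the singularity in the past $\Sigma$ of $\mathcal D_\tau$.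
   Context: $\mathbb M^{n+1}$ is $\mathbb R^{n+1}$ with $\langle v,w\rangle=-v_0w_0+\sum_{i\ge1}v_iw_i$, time-oriented so that timelike $v$ with $v_0>0$ is future directed; $\mathbb H^n=\{\langle x,x\rangle=-1,x_0>0\}$; $\mathrm I^+(A)$ is the chronological future of $A$. For a cocycle $\tau$ ($\tau_{\alpha\beta}=\tau_\alpha+\alpha\tau_\beta$), $\Gamma_\tau$ is the group of affine isometries $\gamma_\tau:x\mapsto\gamma x+\tau_\gamma$, $\gamma\in\Gamma$; $\pi_1(M)=\Gamma$ acts on subsets of $\mathbb M^{n+1}$ through $\gamma\mapsto\gamma_\tau$, and linearly on $\mathbb H^n$. A support plane of a convex set is a hyperplane such that the set lies in one of the closed half-spaces it bounds. A future complete regular domain is a nonempty open convex set $\Omega=\bigcap_{P\in\mathcal F}\mathrm I^+(P)$ for some family $\mathcal F$ of null support planes of $\Omega$ containing at least two non-parallel planes. For each $p\in\Omega$ there is a unique $r(p)\in\partial\Omega$ in the past of $p$ maximizing the Lorentzian distance $\sqrt{-\langle p-q,p-q\rangle}$ over $q\in\overline\Omega\cap \mathrm J^-(p)$; the cosmological time is $\widetilde T(p)=\sqrt{-\langle p-r(p),p-r(p)\rangle}$ and the singularity in the past is $\Sigma=r(\Omega)$. The level surfaces of $\widetilde T$ are $C^1$ spacelike hypersurfaces, and $d_a$ is the path distance of the induced Riemannian metric. $\Sigma$ is equipped with the distance $d_\Sigma(r,s)=\inf_c\int\sqrt{\langle\dot c,\dot c\rangle}$, the infimum being over Lipschitz paths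 $c$ in $\partial\mathcal D_\tau$ joining $r$ to $s$. Marked length spectrum of an isometric action of $\Gamma$ on a metric space $(X,d)$: the function $\ell_X(\gamma)=\inf_{x\in X}d(x,\gamma x)$ on conjugacy classes of $\Gamma\setminus\{1\}$. Convergence of spectra is pointwise convergence for each $\gamma$. Gromov convergence of isometric actions of $\Gamma$ on $X_i$ to an isometric action on $X$: for every compact $K\subset X$, every $\varepsilon>0$ and every finite $P\subset\Gamma$, for all large $i$ there exist a compact $K_i\subset X_i$ and a relation $R\subset K\times K_i$, surjecting onto both factors, such that $|d(x,y)-d_i(x',y')|<\varepsilon$ whenever $xRx'$, $yRy'$, and such that if $x,\alpha x\in K$, $\alpha\in P$ and $xRx'$ then $\alpha x'\in K_i$ and $\alpha x\,R\,\alpha x'$. *)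

(* Defs.v *)
From HB Require Import structures.
From mathcomp Require Import all_boot all_order all_algebra generic_quotient.
From mathcomp Require Import all_classical all_reals all_analysis.

Set Implicit Arguments.
Unset Strict Implicit.
Unset Printing Implicit Defensive.

Import Order.TTheory GRing.Theory Num.Theory.
Import numFieldNormedType.Exports.

Local Open Scope classical_set_scope.
Local Open Scope ring_scope.

Section Minkowski.
Context {R : realType} {n : nat}.

(* Points and vectors are columns, so that matrices act on the left; the entry
   of index [ord0] is the time coordinate. *)
Local Notation V := 'cV[R]_n.+1.
Implicit Types (x y v w p q : V) (A P Q Omega : set V).

Definition mink v w : R :=
  - (v ord0 0 * w ord0 0)
  + \sum_(i < n) v (lift ord0 i) 0 * w (lift ord0 i) 0.

Definition future_timelike v := mink v v < 0 /\ 0 < v ord0 0.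

(* The zero vector is included, so that p lies in its own causal past. *)
Definition future_causal v := mink v v <= 0 /\ 0 <= v ord0 0.

Definition chron_future A : set V :=
  [set p | exists2 q, A q & future_timelike (p - q)].

Definition causal_past p : set V := [set q | future_causal (p - q)].

Definition hyp : set V := [set x | mink x x = -1 /\ 0 < x ord0 0].

(* Since [mink] is nondegenerate, every hyperplane has this form; [v] is
   determined by the hyperplane up to a nonzero factor. *)
Definition hyperplane v (c : R) : set V := [set x | mink v x = c].

Definition null_plane P :=
  exists v c, [/\ v <> 0, mink v v = 0 & P = hyperplane v c].

Definition support_plane A P :=
  exists v c, [/\ v <> 0, P = hyperplane v c &
    (forall x, A x -> mink v x <= c) \/ (forall x, A x -> c <= mink v x)].

Definition parallel P Q := exists v, Q = [set x + v | x in P].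

Definition future_complete_regular_domain Omega :=
  [/\ Omega !=set0, open Omega, convex_set Omega &
    exists F : set (set V),
      [/\ forall P, F P -> null_plane P /\ support_plane Omega P,
          exists P Q, [/\ F P, F Q & ~ parallel P Q] &
          Omega = \bigcap_(P in F) chron_future P]].

Definition boundary A : set V := closure A `\` A°.

(* Meant for q in the causal past of p: [Num.sqrt] vanishes on negative
   numbers. *)
Definition lorentz_dist p q : R := Num.sqrt (- mink (p - q) (p - q)).

Definition is_retraction Omega p q :=
  [/\ boundary Omega q, causal_past p q &
    forall q', closure Omega q' -> causal_past p q' ->
      lorentz_dist p q' <= lorentz_dist p q].

Definition retraction Omega p : V := xget 0 (is_retraction Omega p).

Definition cosmological_time Omega p : R :=
  lorentz_dist p (retraction Omega p).

Definition past_singularity Omega : set V := retraction Omega @` Omega.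

Definition level_surface Omega (a : R) : set V :=
  [set p | Omega p /\ cosmological_time Omega p = a].

(* Locally S is the zero set of a C^1 function with nonvanishing differential,
   and the form is positive definite on the tangent space, i.e. on the kernel
   of this differential. *)
Definition C1_spacelike_hypersurface A :=
  forall p, A p -> exists (U : set V) (f : V -> R),
    [/\ open U /\ U p,
        forall x, U x -> differentiable f x /\
          forall v, {for x, continuous (fun z => 'd f z v)},
        forall x, U x -> exists v, 'd f x v <> 0,
        A `&` U = [set x | U x /\ f x = 0] &
        forall x, (A `&` U) x ->
          forall v, v <> 0 -> 'd f x v = 0 -> 0 < mink v v].

(* Paths are parametrized by [0, 1]; values of c outside are irrelevant. *)
Implicit Type c : R -> V.

Definition C1_on (s t : R) c :=
  exists f : R -> V, [/\ forall u, derivable f u 1, continuous (derive1 f) &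
    {in `[s, t], c =1 f}].

Definition piecewise_C1 c :=
  exists2 s : seq R, itv_partition 0 1 s &
    forall i, (i < size s)%N ->
      C1_on (nth 0 (0 :: s) i) (nth 0 (0 :: s) i.+1) c.

Definition lipschitz_path c := exists k : R, k.-lipschitz_(`[0, 1]) c.

(* [Num.sqrt] vanishes on negative numbers, but for the paths used below, in a
   spacelike hypersurface or in the boundary of a regular domain, the velocity
   is nowhere timelike. *)
Definition path_length c : \bar R :=
  (\int[@lebesgue_measure R]_(t in `[0%R, 1%R])
     (Num.sqrt (mink (derive1 c t) (derive1 c t)))%:E)%E.

Definition path_dist (admissible : set (R -> V)) A x y : \bar R :=
  ereal_inf [set path_length c | c in
    [set c | [/\ admissible c, {in `[0, 1], forall t, A (c t)},
                 c 0 = x & c 1 = y]]].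

(* Path distance of the induced Riemannian metric. *)
Definition riemannian_dist A : V -> V -> \bar R := path_dist piecewise_C1 A.

Definition singularity_dist Omega : V -> V -> \bar R :=
  path_dist lipschitz_path (boundary Omega).

End Minkowski.

Section Groups.
Context {R : realType} {n : nat}.
Local Notation V := 'cV[R]_n.+1.
Local Notation Mat := 'M[R]_n.+1.
Implicit Types (Gamma : set Mat) (tau : Mat -> V).

(* SO^+(n,1): determinant 1, preserving the form and the time orientation. *)
Definition SO_plus : set Mat :=
  [set g | [/\ \det g = 1,
               forall v w : V, mink (g *m v) (g *m w) = mink v w &
               forall v : V, future_timelike v -> future_timelike (g *m v)]].

Definition is_subgroup_of Gamma (G : set Mat) :=
  [/\ Gamma `<=` G, Gamma 1, forall g h, Gamma g -> Gamma h -> Gamma (g * h) &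
      forall g, Gamma g -> Gamma g^-1].

Definition torsion_free Gamma :=
  forall g k, Gamma g -> (0 < k)%N -> g ^+ k = 1 -> g = 1.

Definition discrete Gamma := Gamma `<=` isolated Gamma.

Definition orbit_of Gamma (x : V) : set V := [set g *m x | g in Gamma].

(* Having equal orbits is an equivalence for any set of matrices; when Gamma is
   a group it amounts to lying in a common orbit. *)
Definition same_orbit Gamma : rel (@hyp R n) :=
  fun x y => `[< orbit_of Gamma (\val x) = orbit_of Gamma (\val y) >].

Lemma same_orbit_refl Gamma : reflexive (same_orbit Gamma).
Proof. by move=> x; apply/asboolP. Qed.

Lemma same_orbit_sym Gamma : symmetric (same_orbit Gamma).
Proof. by move=> x y; apply/asboolP/asboolP. Qed.

Lemma same_orbit_trans Gamma : transitive (same_orbit Gamma).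
Proof. by move=> y x z /asboolP xy /asboolP yz; apply/asboolP; rewrite xy. Qed.

Canonical same_orbit_equiv Gamma := EquivRel (same_orbit Gamma)
  (@same_orbit_refl Gamma) (@same_orbit_sym Gamma) (@same_orbit_trans Gamma).

(* H^n / Gamma with the quotient topology. *)
Definition hyp_quotient Gamma : Type :=
  {eq_quot same_orbit_equiv Gamma}%qT.

HB.instance Definition _ Gamma :=
  Topological.copy (hyp_quotient Gamma) (quotient_topology (hyp_quotient Gamma)).
HB.instance Definition _ Gamma := Quotient.on (hyp_quotient Gamma).

Definition cocompact Gamma := compact [set: hyp_quotient Gamma].

(* Only the values of tau on Gamma matter. *)
Definition cocycle Gamma tau :=
  forall a b, Gamma a -> Gamma b -> tau (a * b) = tau a + a *m tau b.

Definition linear_action (g : Mat) (x : V) : V := g *m x.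

Definition affine_action tau (g : Mat) (x : V) : V := g *m x + tau g.

Definition invariant_under {T : Type} Gamma (act : Mat -> T -> T) (X : set T) :=
  forall g, Gamma g -> act g @` X = X.

Definition acts_by_isometries {T : Type} Gamma (act : Mat -> T -> T)
    (X : set T) (d : T -> T -> \bar R) :=
  invariant_under Gamma act X /\
  forall g, Gamma g -> {in X &, forall x y, d (act g x) (act g y) = d x y}.

End Groups.

(* Metric notions for a set X with a distance d defined on an ambient type. *)
Section MetricSpaces.
Context {R : realType}.
Local Open Scope ereal_scope.

Definition dist_open {T : Type} (X : set T) (d : T -> T -> \bar R)
    (U : set T) :=
  U `<=` X /\ forall x, U x -> exists2 e : R, (0 < e)%R &
    forall y, X y -> d x y < e%:E -> U y.

Definition dist_compact {T : Type} (X : set T) (d : T -> T -> \bar R)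
    (K : set T) :=
  K `<=` X /\ forall (I : choiceType) (D : set I) (f : I -> set T),
    (forall i, D i -> dist_open X d (f i)) -> K `<=` cover D f ->
    finite_subset_cover D f K.

(* Given on elements; for an isometric action it is constant on conjugacy
   classes. *)
Definition length_spectrum {G T : Type} (act : G -> T -> T)
    (X : set T) (d : T -> T -> \bar R) (g : G) : \bar R :=
  ereal_inf [set d x (act g x) | x in X].

(* Gromov convergence along F of the actions on (X_ i, d_ i) to the action on
   (X, d). *)
Definition gromov_converges {G T' T I : Type} (Gamma : set G)
    (F : set_system I)
    (act' : G -> T' -> T') (X_ : I -> set T') (d_ : I -> T' -> T' -> \bar R)
    (act : G -> T -> T) (X : set T) (d : T -> T -> \bar R) :=
  forall (K : set T) (e : R) (P : set G),
    dist_compact X d K -> (0 < e)%R -> finite_set P -> P `<=` Gamma ->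
    \forall i \near F,
      exists (K' : set T') (rel : T -> T' -> Prop),
        [/\ dist_compact (X_ i) (d_ i) K',
            forall x x', rel x x' -> K x /\ K' x',
            (forall x, K x -> exists x', rel x x') /\
            (forall x', K' x' -> exists x, rel x x'),
            forall x y x' y', rel x x' -> rel y y' ->
              `|d x y - d_ i x' y'| < e%:E &
            forall g x x', P g -> K x -> K (act g x) -> rel x x' ->
              K' (act' g x') /\ rel (act g x) (act' g x')].

End MetricSpaces.

(* Main.v *)
(* The retraction r and the Gauss map N = (p - r(p)) / T(p) express a point of a
   level surface S_a as p = r(p) + a N(p), and both maps are monotone in the
   sense that for two points of S_a the increments of r and of N have
   nonnegative product.  Hence |dp|^2 >= |dr|^2 and |dp|^2 >= a^2 |dN|^2: the
   Gauss map contracts d_a / a to the hyperbolic distance, and the retraction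
   contracts d_a to the distance of the singularity.

   Conversely, distances on the spacelike surfaces S_a and H^n are bounded
   above by Minkowski lengths of polygons with vertices on the surface, because
   the vertical projection of a spacelike segment to the surface is shorter
   than the segment.  For (i), cocompactness bounds r over the preimage under N
   of a bounded set, uniformly in a, so that the polygon joining the points over
   the vertices of a hyperbolic polygon has, after division by a, almost the
   same length.  For (ii), a path in the boundary of the domain is replaced by a
   polygon, whose vertices are moved vertically by at most a into S_a.

   Path lengths and polygons are compared through Lipschitz paths: the length
   integral is the limit of the chord sums of the uniform subdivisions. *)

Require Import Defs.
From HB Require Import structures.
From mathcomp Require Import all_boot all_order all_algebra generic_quotient.
From mathcomp Require Import all_classical all_reals all_analysis.
From mathcomp Require Import measurable_realfun.
From mathcomp Require Import ring lra.

Set Implicit Arguments.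
Unset Strict Implicit.
Unset Printing Implicit Defensive.

Import Order.TTheory GRing.Theory Num.Theory.
Import numFieldNormedType.Exports.

Local Open Scope classical_set_scope.
Local Open Scope ring_scope.

(** Monotonicity comes from maximality: r(p) is the point of the closed domain in the past of p
    farthest from p, so the hyperplane through r(p) orthogonal to N(p) supports the domain; two such
    inequalities, each tested at the other retraction, give the sign of the cross term. They also
    make T concave with supergradient -<., N>, which stands in for second-order regularity of the
    surfaces. The bound on r is about directions of escape. A direction outside the future cone has
    a positive product with some element of the orbit of a timelike support normal, hence is
    blocked; along directions near the future cone the product with N(p) tends to minus infinity,
    which a fixed point of the domain forbids. In (ii) the limit is an infimum, so one nearly
    minimal path, chosen before a, gives the upper bound. In (i) the estimate must be uniform over
    pairs in K, and compactness of K x K provides this. The speed of a Lipschitz path exists only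
    almost everywhere and nothing is assumed about its measurability; this is why lengths are
    handled through chord sums. *)

(** * Almost everywhere differentiability of Lipschitz functions *)

Section Rademacher.
Context {R : realType}.
Local Notation mu := (@lebesgue_measure R).
Implicit Types (f g : R -> R).

(** Both measures are infima over countable covers by half-open intervals, on which the inequality
    is the hypothesis; hence every set is allowed, measurable or not. *)
Lemma stieltjes_le (g : cumulative R R) (k : R) : 0 < k ->
  (forall s t, s <= t -> g t - g s <= k * (t - s)) ->
  forall A, (lebesgue_stieltjes_measure g A <= k%:E * mu A)%E.
Proof.
move=> k0 gk A.
have le_wl (I : set (ocitv_type R)) : measurable I -> (wlength g I <= k%:E * wlength idfun I)%E.
  move=> [[a b] _ <-] /=.
  rewrite !wlength_itv /= !lte_fin; case: ifPn => ab; last by rewrite mule0.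
  by rewrite -!EFinB -EFinM lee_fin gk// ltW.
rewrite -lee_pdivrMl//.
rewrite /lebesgue_measure /lebesgue_stieltjes_measure /measure_extension /mu_ext /=.
apply: le_ereal_inf_tmp => _ [B [mB AB] <-]; rewrite lee_pdivrMl//.
rewrite -nneseriesZl; last by move=> i _; exact: wlength_ge0.
apply: (@le_trans _ _ (\sum_(0 <= i <oo) wlength g (B i))%E).
  by apply: ereal_inf_lbound; exists B.
by apply: lee_nneseries => // i _; exact: le_wl.
Qed.

(** Adding a linear term makes [f] nondecreasing, hence the distribution function of a measure
    dominated by Lebesgue measure. Radon-Nikodym writes it as an integral, which is differentiable
    almost everywhere. *)
Lemma lipschitz_ae_derivable f (k : R) :
  (forall s t, `|f t - f s| <= k * `|t - s|) ->
  {ae mu, forall t, 0 < t < 1 -> derivable f t 1}.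
Proof.
move=> fk.
have k0 : 0 <= k.
  by have := fk 0 1; rewrite subr0 normr1 mulr1; apply: le_trans.
pose g t := f t + k * t.
have gnd : nondecreasing g.
  move=> s t st; rewrite /g; have := fk s t.
  by rewrite (ger0_norm (_ : 0 <= t - s)) ?subr_ge0// ler_norml => /andP[+ _]; lra.
(* The increments of [g] have slope at most 2k; the extra 1 keeps the constant positive when k =
   0. *)
have gle s t : s <= t -> g t - g s <= (2 * k + 1) * (t - s).
  move=> st; rewrite /g; have := fk s t.
  rewrite (ger0_norm (_ : 0 <= t - s)) ?subr_ge0// ler_norml => /andP[_ +].
  have : 0 <= t - s by rewrite subr_ge0.
  by lra.
have gc : continuous g.
  move=> x; apply/cvgrPdist_lt => e e0.
  near=> y.
  have xy : `|x - y| < e / (2 * k + 1).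
    by near: y; apply: cvgr_dist_lt => //; rewrite divr_gt0//; lra.
  move: xy; rewrite ltr_pdivlMr; last by lra.
  apply: le_lt_trans; rewrite mulrC.
  case: (leP x y) => xy.
    rewrite distrC (distrC x) !ger0_norm ?subr_ge0 ?gnd//; last exact: gle.
  by rewrite !ger0_norm ?subr_ge0 ?gnd ?(ltW xy)//; apply: gle; exact: ltW.
have grc : right_continuous g by exact: right_continuousW.
pose G : cumulative R R := HB.pack g (isCumulative.Build R _ R g gnd grc).
have k1 : 0 < 2 * k + 1 by lra.
have LSle := @stieltjes_le G (2 * k + 1) k1 gle.
pose LS := lebesgue_stieltjes_measure G.
(* A bounded neighbourhood of [0, 1], on which the Stieltjes measure is finite. *)
pose I : set (g_sigma_algebraType R.-ocitv.-measurable) := `](-1)%R, 2%R]%classic.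
have mI : measurable I by exact: measurable_itv.
have LSitv (s t : R) : s <= t -> LS `]s, t]%classic = (g t - g s)%:E.
  move=> st; rewrite /LS /lebesgue_stieltjes_measure /measure_extension.
  rewrite measurable_mu_extE/=; last exact: is_ocitv.
  by rewrite wlength_itv_bnd.
have LSI : (LS I < +oo)%E by rewrite LSitv ?ltry//; lra.
pose nu : {finite_measure set _ -> \bar R} := mfrestr mI LSI.
have numu : nu `<< mu.
  apply/null_content_dominatesP => A mA mA0 /=.
  rewrite /mfrestr /mrestr; apply/eqP; rewrite eq_le measure_ge0 andbT.
  apply: (le_trans (LSle _)).
  rewrite (_ : mu _ = 0%E) ?mule0//.
  by apply/eqP; rewrite eq_le measure_ge0 andbT -mA0 le_measure// inE//; exact: measurableI.
have [h [h0 hfin hint hnu]] := radon_nikodym_sigma_finite numu.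
pose h' := fine \o h.
have hE : EFin \o h' = h by apply/funext => x /=; rewrite fineK.
have intA A : measurable A -> mu.-integrable A (EFin \o h').
  by move=> mA; rewrite hE; exact: integrableS hint.
have := @FTC1 R h' (BRight (-1)%R) (fun y => intA _ (measurable_itv _))
  (open_integrable_locally openT (intA _ measurableT)).
apply: (@filterS _ _ (ae_filter_ringOfSetsType mu)) => x /= dF /andP[x0 x1].
have {dF} [dF _] := dF ltac:(by rewrite /Order.lt /=; lra).
have gder : derivable g x 1.
  have : derivable ((fun y => (\int[mu]_(t in [set` Interval (BRight (-1)) (BRight y)]) h' t)%R) + cst (g (-1))) x 1.
    apply: derivableD => //.
  apply: near_eq_derivable; near=> y => /=.
  have y1 : -1 < y by near: y; apply: lt_nbhsr; lra.
  have y2 : y < 2 by near: y; apply: lt_nbhsl; lra.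
  rewrite !fctE /=. rewrite /Rintegral [X in fine X](_ : _ = (g y - g (-1))%:E) /=; last first.
    transitivity (nu `]-1, y]%classic).
      rewrite hnu; last exact: measurable_itv.
      by apply: eq_integral => z _; rewrite /= fineK.
    rewrite /= /mfrestr /mrestr -LSitv ?(ltW y1)//; congr (LS _).
    apply/setIidl => z; rewrite /I /= !in_itv /= => /andP[-> zy]; exact: le_trans (ltW y2).
  by rewrite subrK.
have -> : f = g - (fun t => k * t).
  by apply/funext => t; rewrite /g !fctE addrK.
apply: derivableB => //.
Unshelve. all: by end_near. Qed.
End Rademacher.

(** * Lorentzian algebra and its comparison with the sup norm *)

Section MinkowskiAlgebra.
Context {R : realType} {n : nat}.
Local Notation V := 'cV[R]_n.+1.
Implicit Types (u v w x y : V) (a b k : R).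

Local Notation time v := (v ord0 0).

Definition sdot v w : R := \sum_(i < n) v (lift ord0 i) 0 * w (lift ord0 i) 0.

Definition e0 : V := delta_mx ord0 0.

Lemma minkE v w : mink v w = - (time v * time w) + sdot v w.
Proof. by []. Qed.

Lemma sdotC v w : sdot v w = sdot w v.
Proof. by apply: eq_bigr => i _; rewrite mulrC. Qed.

Lemma sdotDl u v w : sdot (u + v) w = sdot u w + sdot v w.
Proof. by rewrite -big_split; apply: eq_bigr => i _; rewrite mxE mulrDl. Qed.

Lemma sdotZl a v w : sdot (a *: v) w = a * sdot v w.
Proof. by rewrite big_distrr; apply: eq_bigr => i _ /=; rewrite mxE mulrA. Qed.

Lemma sdotNl v w : sdot (- v) w = - sdot v w.
Proof. by rewrite -scaleN1r sdotZl mulN1r. Qed.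

Lemma sdotDr u v w : sdot u (v + w) = sdot u v + sdot u w.
Proof. by rewrite !(sdotC u) sdotDl. Qed.

Lemma sdotNr v w : sdot v (- w) = - sdot v w.
Proof. by rewrite !(sdotC v) sdotNl. Qed.

Lemma sdotZr a v w : sdot v (a *: w) = a * sdot v w.
Proof. by rewrite !(sdotC v) sdotZl. Qed.

Lemma sdot_ge0 v : 0 <= sdot v v.
Proof. by apply: sumr_ge0 => i _; rewrite -expr2 sqr_ge0. Qed.

Lemma sdot_eq0 v : sdot v v = 0 -> forall i, v (lift ord0 i) 0 = 0.
Proof.
move=> /eqP; rewrite psumr_eq0; last by move=> i _; rewrite -expr2 sqr_ge0.
by move=> /allP h i; apply/eqP; have := h i (mem_index_enum i); rewrite mulf_eq0 orbb.
Qed.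

Lemma sdot_CauchySchwarz v w : sdot v w ^+ 2 <= sdot v v * sdot w w.
Proof.
have [/sdot_eq0 w0|w0] := eqVneq (sdot w w) 0.
  suff -> : sdot v w = 0 by rewrite expr0n mulr_ge0// sdot_ge0.
  by apply: big1 => i _; rewrite w0 mulr0.
have wgt : 0 < sdot w w by rewrite lt_def w0 sdot_ge0.
have := sdot_ge0 (sdot w w *: v - sdot v w *: w).
rewrite !(sdotDl, sdotDr, sdotNl, sdotNr, sdotZl, sdotZr) (sdotC w v) => h.
have : 0 <= sdot w w * (sdot v v * sdot w w - sdot v w ^+ 2) by move: h; lra.
by rewrite pmulr_rge0// subr_ge0.
Qed.

Lemma minkC v w : mink v w = mink w v.
Proof. by rewrite !minkE sdotC mulrC. Qed.

Lemma minkDl u v w : mink (u + v) w = mink u w + mink v w.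
Proof. by rewrite !minkE sdotDl mxE; ring. Qed.

Lemma minkZl a v w : mink (a *: v) w = a * mink v w.
Proof. by rewrite !minkE sdotZl mxE; ring. Qed.

Lemma minkNl v w : mink (- v) w = - mink v w.
Proof. by rewrite -scaleN1r minkZl mulN1r. Qed.

Lemma minkDr u v w : mink u (v + w) = mink u v + mink u w.
Proof. by rewrite !(minkC u) minkDl. Qed.

Lemma minkZr a v w : mink v (a *: w) = a * mink v w.
Proof. by rewrite !(minkC v) minkZl. Qed.

Lemma minkNr v w : mink v (- w) = - mink v w.
Proof. by rewrite !(minkC v) minkNl. Qed.

Lemma mink0l v : mink 0 v = 0.
Proof. by rewrite -(scale0r 0) minkZl mul0r. Qed.

Lemma mink0r v : mink v 0 = 0.
Proof. by rewrite minkC mink0l. Qed.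

Definition mink_lin := (minkDl, minkDr, minkNl, minkNr, minkZl, minkZr).

Lemma time_e0 : time e0 = 1.
Proof. by rewrite mxE !eqxx. Qed.

Lemma sdot_e0 v : sdot v e0 = 0.
Proof. by apply: big1 => i _; rewrite mxE /= mulr0. Qed.

Lemma mink_e0 v : mink v e0 = - time v.
Proof. by rewrite minkE sdot_e0 time_e0 mulr1 addr0. Qed.

Lemma mink_e0e0 : mink e0 e0 = -1.
Proof. by rewrite mink_e0 time_e0. Qed.

Lemma ft_e0 : future_timelike e0.
Proof. by split; rewrite ?mink_e0e0 ?time_e0// ltrN10. Qed.

Lemma ft_fc v : future_timelike v -> future_causal v.
Proof. by move=> [/ltW ? /ltW]. Qed.

Lemma hyp_ft v : hyp v -> future_timelike v.
Proof. by move=> [h ?]; split=> //; rewrite h ltrN10. Qed.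

Lemma fc0 : future_causal (0 : V).
Proof. by split; rewrite ?mink0l ?mxE. Qed.

Lemma time_eq0 v : mink v v <= 0 -> time v = 0 -> v = 0.
Proof.
rewrite minkE => h v0; move: h; rewrite v0 mul0r oppr0 add0r => h.
have /sdot_eq0 s : sdot v v = 0 by apply/eqP; rewrite eq_le h sdot_ge0.
by apply/colP => i; rewrite !mxE; case: (unliftP ord0 i) => [j|] ->.
Qed.

Lemma le_of_sqr a b : 0 <= b -> a ^+ 2 <= b ^+ 2 -> a <= b.
Proof.
move=> b0 ab; apply: (le_trans (ler_norm a)).
by rewrite -(ger0_norm b0) -ler_sqr ?nnegrE// !real_normK ?num_real.
Qed.

Lemma sdot_le v w : 0 <= time v -> 0 <= time w ->
  mink v v <= 0 -> mink w w <= 0 -> sdot v w <= time v * time w.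
Proof.
move=> v0 w0; rewrite !minkE => hv hw; apply: le_of_sqr; first exact: mulr_ge0.
apply: le_trans (sdot_CauchySchwarz v w) _; rewrite exprMn.
by apply: ler_pM; rewrite ?sdot_ge0// expr2; lra.
Qed.

Lemma fc_mink_le0 v w : future_causal v -> future_causal w -> mink v w <= 0.
Proof. by move=> [? ?] [? ?]; rewrite minkE; have := @sdot_le v w; lra. Qed.

Lemma lt_of_sqr a b : 0 <= b -> a ^+ 2 < b ^+ 2 -> a < b.
Proof.
move=> b0; apply: contraTT; rewrite -!leNgt => ba.
by rewrite ler_sqr// nnegrE (le_trans b0).
Qed.

Lemma ft_fc_mink_lt0 v w :
  future_timelike v -> future_causal w -> w <> 0 -> mink v w < 0.
Proof.
move=> [vv v0] [ww w0] wn0.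
have wt : 0 < time w.
  by rewrite lt_neqAle w0 andbT eq_sym; apply/eqP => /(time_eq0 ww).
have : sdot v w ^+ 2 < (time v * time w) ^+ 2.
  apply: le_lt_trans (sdot_CauchySchwarz v w) _; rewrite exprMn.
  move: vv ww; rewrite !minkE => vv ww.
  apply: (@le_lt_trans _ _ (sdot v v * time w ^+ 2)).
    by apply: ler_wpM2l; rewrite ?sdot_ge0// expr2; lra.
  by rewrite ltr_pM2r ?exprn_gt0// expr2; lra.
move/lt_of_sqr => /(_ (mulr_ge0 (ltW v0) w0)); rewrite minkE; lra.
Qed.

Lemma fcD v w : future_causal v -> future_causal w -> future_causal (v + w).
Proof.
move=> hv hw; have := fc_mink_le0 hv hw; case: hv hw => [? ?] [? ?] ?.
split; last by rewrite mxE addr_ge0.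
by rewrite !mink_lin (minkC w v); lra.
Qed.

Lemma fcZ a v : 0 <= a -> future_causal v -> future_causal (a *: v).
Proof.
move=> a0 [? ?]; split; last by rewrite mxE mulr_ge0.
by rewrite !mink_lin !mulr_ge0_le0.
Qed.

Lemma ftZ a v : 0 < a -> future_timelike v -> future_timelike (a *: v).
Proof.
move=> a0 [? ?]; split; last by rewrite mxE mulr_gt0.
by rewrite !mink_lin mulrA pmulr_rlt0// mulr_gt0.
Qed.

Lemma ftD v w : future_timelike v -> future_causal w -> future_timelike (v + w).
Proof.
move=> hv hw; have := fc_mink_le0 (ft_fc hv) hw; case: hv hw => [? ?] [? ?] ?.
split; last by rewrite mxE ltr_wpDr.
by rewrite !mink_lin (minkC w v); lra.
Qed.

Lemma fc_or v : mink v v <= 0 -> future_causal v \/ future_causal (- v).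
Proof.
move=> h; have [v0|v0] := leP 0 (time v); [left|right]; split=> //.
  by rewrite !mink_lin opprK.
by rewrite mxE oppr_ge0 ltW.
Qed.

Lemma ft_orth_eq0 v w : future_timelike v -> mink v w = 0 -> mink w w <= 0 -> w = 0.
Proof.
move=> hv vw /fc_or [] hw; apply: contrapT => w0.
  by have := ft_fc_mink_lt0 hv hw w0; rewrite vw ltxx.
have := ft_fc_mink_lt0 hv hw; rewrite minkNr vw oppr0 ltxx => h.
by suff: false by []; apply: h => /eqP; rewrite oppr_eq0 => /eqP.
Qed.

Lemma ft_orth_ge0 v w : future_timelike v -> mink v w = 0 -> 0 <= mink w w.
Proof.
move=> hv vw; rewrite leNgt; apply/negP => h.
by move: (h); rewrite (ft_orth_eq0 hv vw (ltW h)) mink0l ltxx.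
Qed.

(** The component of [w] orthogonal to the timelike [v] has nonnegative square; multiplying by the
    negative [mink v v] reverses the inequality. *)
Lemma ft_revCS v w : future_timelike v ->
  mink v v * mink w w <= mink v w ^+ 2.
Proof.
move=> hv; have vv := hv.1.
have vv0 : mink v v != 0 by rewrite lt_eqF.
set c := mink v w / mink v v; have cE : c * mink v v = mink v w by rewrite divfK.
have := @ft_orth_ge0 v (w - c *: v) hv.
rewrite !mink_lin (minkC w v) cE subrr => /(_ erefl) h.
have {}h : 0 <= mink w w - c * mink v w by move: h; lra.
have := mulr_le0_ge0 (ltW vv) h.
have : mink v v * (c * mink v w) = mink v w ^+ 2 by rewrite mulrA (mulrC (mink v v)) cE.
by rewrite mulrBr => ->; rewrite subr_le0.
Qed.

Lemma hyp_mink_le x y : hyp x -> hyp y -> mink x y <= -1.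
Proof.
move=> hx hy; have := ft_revCS y (hyp_ft hx).
have := fc_mink_le0 (ft_fc (hyp_ft hx)) (ft_fc (hyp_ft hy)).
rewrite hx.1 hy.1 mulrNN mulr1 => h0 h1.
have : 1 <= - mink x y; last by lra.
by apply: le_of_sqr; rewrite ?sqrrN ?expr1n// oppr_ge0.
Qed.

Lemma hyp_orth_CS x v w : hyp x -> mink x v = 0 -> mink x w = 0 ->
  mink v w ^+ 2 <= mink v v * mink w w.
Proof.
move=> /hyp_ft hx xv xw.
have q a b : 0 <= mink (a *: v + b *: w) (a *: v + b *: w).
  by apply: (ft_orth_ge0 hx); rewrite !mink_lin xv xw; ring.
have := q 1 0; rewrite scale1r scale0r addr0 => vv0.
have := q 0 1; rewrite scale1r scale0r add0r => ww0.
have [w0|w0] := eqVneq (mink w w) 0.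
  have -> : w = 0 by apply: (ft_orth_eq0 hx xw); rewrite w0.
  by rewrite !mink0r expr0n mulr0.
have wgt : 0 < mink w w by rewrite lt_def w0.
have := q (mink w w) (- mink v w).
rewrite !mink_lin (minkC w v) => h.
have : 0 <= mink w w * (mink v v * mink w w - mink v w ^+ 2) by move: h; lra.
by rewrite pmulr_rge0// subr_ge0.
Qed.

Lemma normalize v : future_timelike v ->
  hyp ((Num.sqrt (- mink v v))^-1 *: v).
Proof.
move=> hv; have l0 : 0 < Num.sqrt (- mink v v) by rewrite sqrtr_gt0 oppr_gt0 hv.1.
split; last by rewrite mxE mulr_gt0 ?invr_gt0 ?hv.2.
rewrite !mink_lin mulrA -expr2 exprVn sqr_sqrtr; last by rewrite oppr_ge0 ltW ?hv.1.
by rewrite invrN mulNr mulVf// lt_eqF ?hv.1.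
Qed.

(** On the complement of [x] the form is positive definite and bounds the Euclidean norm up to a
    factor set by the time coordinate of [x]; the last term pays for the component of [w] along
    [x]. *)
Lemma sdot_le_orth x w : hyp x ->
  sdot w w <= 2 * time x ^+ 2 * mink w w + (4 * time x ^+ 2 + 2) * mink w x ^+ 2.
Proof.
move=> [xx x0]; have cs := sdot_CauchySchwarz w x.
move: xx cs; rewrite !minkE.
set k := time x in x0 *; set t := time w; set W := sdot w w; set b := sdot w x.
move=> xx cs; have sx : sdot x x = k ^+ 2 - 1 by rewrite expr2; lra.
rewrite sx in cs.
(* With s = - tk + b, the value of [mink w x], the right side exceeds (b + 2 k^2 s)^2 by k^2 W -
   b^2, nonnegative by Cauchy-Schwarz. *)
have h : 0 <= k ^+ 2 * (W + 4 * b * (- (t * k) + b) + 4 * k ^+ 2 * (- (t * k) + b) ^+ 2).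
  apply: le_trans (sqr_ge0 (b + 2 * k ^+ 2 * (- (t * k) + b))) _.
  have W0 : 0 <= W by exact: sdot_ge0.
  by rewrite -subr_ge0; nra.
have k2 : 0 < k ^+ 2 by rewrite exprn_gt0.
move: h; rewrite pmulr_rge0// => h; rewrite -expr2; nra.
Qed.

Lemma time_le_norm v i : `|v i 0| <= `|v|.
Proof.
rewrite [leRHS]/Num.norm /= mx_normrE.
by apply: le_trans (le_bigmax _ _ (i, 0)).
Qed.

Lemma norm_le_coord v k : 0 <= k -> (forall i, `|v i 0| <= k) -> `|v| <= k.
Proof.
move=> k0 h; rewrite [leLHS]/Num.norm /= mx_normrE.
by apply: bigmax_le => // -[i j] _ /=; rewrite (ord1 j).
Qed.

Lemma sqr_norm_le v : `|v| ^+ 2 <= time v ^+ 2 + sdot v v.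
Proof.
have s0 : 0 <= time v ^+ 2 + sdot v v by rewrite addr_ge0 ?sqr_ge0 ?sdot_ge0.
rewrite -(sqr_sqrtr s0) ler_sqr ?nnegrE ?sqrtr_ge0//.
apply: norm_le_coord; first exact: sqrtr_ge0.
move=> i; rewrite -sqrtr_sqr ler_sqrt//.
case: (unliftP ord0 i) => [j|] ->; last by rewrite lerDl sdot_ge0.
rewrite /sdot (bigD1 j)//= expr2 addrCA lerDl addr_ge0 ?sqr_ge0//.
by apply: sumr_ge0 => l _; rewrite -expr2 sqr_ge0.
Qed.

(** Two points of the hyperboloid satisfy <y - x, x> = - <y - x, y - x> / 2, so the component along
    [x] in [sdot_le_orth] is expressed by the same Minkowski square; this is the origin of the
    squared term. *)
Lemma hyp_norm_le x y : hyp x -> hyp y ->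
  `|y - x| ^+ 2 <= (4 * time x ^+ 2 + 2) *
    (mink (y - x) (y - x) + mink (y - x) (y - x) ^+ 2).
Proof.
move=> hx hy; apply: le_trans (sqr_norm_le _) _.
have := sdot_le_orth (y - x) hx.
have -> : mink (y - x) x = - (mink (y - x) (y - x) / 2).
  by rewrite !mink_lin hx.1 hy.1 (minkC x y); field.
have : 0 <= mink (y - x) (y - x).
  by have := hyp_mink_le hx hy; rewrite !mink_lin hx.1 hy.1 (minkC y x); lra.
have : mink (y - x) (y - x) = - (time (y - x)) ^+ 2 + sdot (y - x) (y - x).
  by rewrite minkE expr2.
set m := mink _ _; set t := time _; set W := sdot _ _; set k := time _ => mE m0 h.
have k2 := sqr_ge0 k; have m2 := sqr_ge0 m.
rewrite sqrrN expr_div_n in h; nra.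
Qed.

Lemma mink_le v w : `|mink v w| <= n.+1%:R * (`|v| * `|w|).
Proof.
rewrite -natr1 mulrDl mul1r addrC minkE; apply: le_trans (ler_normD _ _) _.
apply: lerD; first by rewrite normrN normrM ler_pM// time_le_norm.
apply: le_trans (ler_norm_sum _ _ _) _.
rewrite mulr_natl -[X in _ *+ X]card_ord -sumr_const; apply: ler_sum => i _.
by rewrite normrM ler_pM// time_le_norm.
Qed.

Lemma cvg_coord {T : Type} (F : set_system T) {FF : Filter F} (f : T -> V) v i :
  f @ F --> v -> f x i 0 @[x --> F] --> v i 0.
Proof. by move=> fv; exact: (cvg_comp f (fun v : V => v i 0) fv (@coord_continuous R n.+1 1 i 0 v)). Qed.

Lemma cvg_sdot {T : Type} (F : set_system T) {FF : Filter F} (f g : T -> V) v w :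
  f @ F --> v -> g @ F --> w -> sdot (f x) (g x) @[x --> F] --> sdot v w.
Proof.
move=> fv gw; rewrite /sdot; elim: (index_enum _) => [|i s IHs].
  by under eq_fun do rewrite big_nil; rewrite big_nil; exact: cvg_cst.
under eq_fun do rewrite big_cons; rewrite big_cons.
by apply: cvgD => //; apply: cvgM; apply: cvg_coord.
Qed.

Lemma cvg_mink {T : Type} (F : set_system T) {FF : Filter F} (f g : T -> V) v w :
  f @ F --> v -> g @ F --> w -> mink (f x) (g x) @[x --> F] --> mink v w.
Proof.
move=> fv gw; apply: cvgD; last exact: cvg_sdot.
by apply: cvgN; apply: cvgM; apply: cvg_coord.
Qed.

Lemma cvg_col {T : Type} (F : set_system T) {FF : Filter F} (f : T -> V) v :
  (forall i, f x i 0 @[x --> F] --> v i 0) -> f @ F --> v.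
Proof.
move=> h; apply/cvgrPdist_lt => e e0.
have : \forall x \near F, forall i, `|v i 0 - f x i 0| < e / 2.
  by apply: filter_forall => i; have /cvgrPdist_lt := h i; apply; rewrite divr_gt0.
apply: filterS => x hx; apply: (@le_lt_trans _ _ (e / 2)); last by lra.
by apply: norm_le_coord => [|i]; [rewrite divr_ge0// ltW|rewrite !mxE ltW].
Qed.

(** [bounded_closed_compact] speaks of rows; transposition carries it over to columns. *)
Lemma col_bounded_closed_compact (A : set V) k :
  closed A -> (forall v, A v -> `|v| <= k) -> compact A.
Proof.
move=> cA bA.
have tc m p : continuous (fun M : 'M[R]_(m, p) => M^T).
  move=> M A' /nbhs_ballP[e e0 eA]; apply/nbhs_ballP; exists e => //= N [e1 MN].
  by apply: eA; split=> // i j; rewrite !mxE; exact: MN.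
have -> : A = trmx @` (trmx @^-1` A).
  apply/seteqP; split=> [v Av|_ [w Aw <-]]; last exact: Aw.
  by exists v^T; rewrite /= trmxK.
apply: continuous_compact; first by apply: continuous_subspaceT => M; exact: tc.
apply: bounded_closed_compact.
  exists `|k|; split=> [|M kM v /= /bA h]; first exact: num_real.
  apply: le_trans (ltW kM); apply: le_trans (ler_norm k); apply: le_trans h.
  rewrite /Num.norm /= !mx_normrE; apply: bigmax_le => [|[i j] _].
    by apply: bigmax_ge_id.
  by apply: le_trans (le_bigmax _ _ (j, i)); rewrite mxE.
by apply: closed_comp => // M _; exact: tc.
Qed.
End MinkowskiAlgebra.

(** * Integrals of nonnegative functions without measurability *)

Section LowerIntegral.
Context d {T : measurableType d} {R : realType}.
Variable mu : {measure set T -> \bar R}.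
Local Open Scope ereal_scope.
Implicit Types (f g : T -> \bar R) (A N : set T).

(* No measurability is needed: the integral of a nonnegative function is the
   supremum of the integrals of the simple functions below it. *)
Lemma ge0_le_integral_nonmeasurable A f g : (forall x, A x -> 0 <= f x) ->
  (forall x, A x -> f x <= g x) ->
  \int[mu]_(x in A) f x <= \int[mu]_(x in A) g x.
Proof.
move=> f0 fg; rewrite !ge0_integralE//; last first.
  by move=> x Ax; apply: le_trans (fg x Ax); exact: f0.
apply: ereal_sup_le => _ [h hf <-]; exists h => // x.
apply: le_trans (hf x) _; rewrite !patchE; case: ifPn => //.
by rewrite inE => /fg.
Qed.

(** [f] lies between the two functions that agree with [g] off [N] and are 0, respectively infinite,
    on [N]; both are measurable with the integral of [g]. Meant for [f] the speed of a path. *)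
Lemma ae_eq_integral_nonmeasurable A N f g : measurable A -> measurable N ->
  mu N = 0 -> (forall x, A x -> 0 <= f x) -> (forall x, A x -> 0 <= g x) ->
  measurable_fun A g -> (forall x, A x -> ~ N x -> f x = g x) ->
  \int[mu]_(x in A) f x = \int[mu]_(x in A) g x.
Proof.
move=> mA mN N0 f0 g0 mg fg.
pose h c x := if x \in N then c else g x.
have mh c : measurable_fun A (h c).
  apply: measurable_fun_if => //.
    apply: (measurable_fun_bool true).
    have NE : (fun x => x \in N) @^-1` [set true] = N.
      by apply/seteqP; split=> x /=; [exact: set_mem|exact: mem_set].
    by rewrite NE; exact: measurableI.
  exact: measurable_funS mg.
have hg c : 0 <= c -> \int[mu]_(x in A) h c x = \int[mu]_(x in A) g x.
  move=> c0; apply: ge0_ae_eq_integral => //.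
    by move=> x Ax; rewrite /h; case: ifP => // _; exact: g0.
  exists N; split=> // x /=; apply: contra_notP => Nx Ax.
  by rewrite /h memNset.
apply/eqP; rewrite eq_le -{1}(hg +oo) -1?(hg 0)//; apply/andP; split.
  apply: ge0_le_integral_nonmeasurable => // x Ax.
  rewrite /h; case: ifPn; first by rewrite leey.
  by rewrite notin_setE => Nx; rewrite fg.
apply: ge0_le_integral_nonmeasurable => x Ax; rewrite /h.
  by case: ifP => // _; exact: g0.
by case: ifPn => [_|]; [exact: f0|rewrite notin_setE => Nx; rewrite fg].
Qed.
End LowerIntegral.

Lemma derivable_epsP {R : realType} {W : normedModType R} (c : R -> W) (t : R) (w : W) :
  (derivable c t 1 /\ derive1 c t = w) <->
  (forall e, 0 < e -> exists2 d, 0 < d &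
    forall h, `|h| < d -> `|c (h + t) - c t - h *: w| <= e * `|h|).
Proof.
have dE : (fun h => h^-1 *: (c (h + t) - c t)) =
    fun h => h^-1 *: ((c \o shift t) (h *: 1) - c t).
  by apply/funext => h /=; rewrite [h *: 1]mulr1.
have cE : (h^-1 *: (c (h + t) - c t) @[h --> 0^'] --> w) <->
    (derivable c t 1 /\ derive1 c t = w).
  rewrite dE; split=> [h|[h <-]]; last by rewrite derive1E; exact: h.
  split; first by apply/cvg_ex; exists w.
  by rewrite derive1E; apply/cvg_lim.
rewrite -cE; split=> [/cvgrPdist_lt cd e e0|cd].
  have := cd e e0.
  rewrite /prop_near1 /nbhs /= /dnbhs /within /= => /nbhs_ballP[d /= d0 hd].
  exists d => // h.
  have [->|hn0] := eqVneq h 0.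
    by move=> _; rewrite scale0r add0r subrr subr0 !normr0 mulr0.
  move=> hlt; have := hd h; rewrite /ball /= sub0r normrN => /(_ hlt hn0) /ltW.
  move=> /(ler_wpM2r (normr_ge0 h)) /(le_trans _); apply.
  by rewrite mulrC -normrZ scalerBr scalerA divff// scale1r distrC.
apply/cvgrPdist_le => e e0; have [d d0 hd] := cd e e0.
rewrite /prop_near1 /nbhs /= /dnbhs /within /=; apply/nbhs_ballP; exists d => //= h.
rewrite /ball /= sub0r normrN => hlt hn0.
rewrite -(ler_pM2r (_ : 0 < `|h|)) ?normr_gt0//; apply: le_trans (hd h hlt).
by rewrite mulrC -normrZ scalerBr scalerA divff// scale1r distrC.
Qed.

(** * Path length as a limit of chord sums *)

Section ChordSums.
Context {R : realType} {n : nat}.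
Local Notation V := 'cV[R]_n.+1.
Local Notation mu := (@lebesgue_measure R).
Implicit Types (p q v w : V) (c : R -> V).

Definition chord p q : R := Num.sqrt (mink (q - p) (q - p)).

Definition chord_sum c m : R :=
  \sum_(i < m) chord (c (i%:R / m%:R)) (c (i.+1%:R / m%:R)).

(** Difference quotient over the cell containing [t] of the uniform subdivision into [m] cells. *)
Let quot c m (t : R) : V := let i := Num.truncn (m%:R * t) in
  m%:R *: (c (i.+1%:R / m%:R) - c (i%:R / m%:R)).

Let step c m (t : R) : R := Num.sqrt (mink (quot c m t) (quot c m t)).

(** The end points of the cell straddle [t], so differentiability at [t] alone is enough: the two
    errors are weighted by distances to [t] that add up to the cell length 1/m. *)
Lemma quot_cvg c t : 0 < t -> derivable c t 1 -> quot c m t @[m --> \oo] --> derive1 c t.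
Proof.
move=> t0 dc; have /derivable_epsP cd := conj dc (erefl (derive1 c t)).
apply/cvgrPdist_lt => e e0.
have [d d0 hd] := cd (e / 2) (divr_gt0 e0 (ltr0Sn _ _)).
near=> m.
have m0 : 0 < m%:R :> R by rewrite ltr0n; near: m; exists 1%N.
have md : m%:R^-1 < d.
  rewrite invf_plt ?posrE//; near: m; exact: nbhs_infty_gtr.
rewrite /quot; set i := Num.truncn _.
have /andP[i1 i2] : i%:R <= m%:R * t < i.+1%:R by apply: truncn_itv; rewrite mulr_ge0 ?ltW.
have a1 : i%:R / m%:R <= t by rewrite ler_pdivrMr// mulrC.
have a2 : t < i.+1%:R / m%:R by rewrite ltr_pdivlMr// mulrC.
set a := i%:R / _ in a1 *; set b := i.+1%:R / _ in a2 *.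
have ba : b - a = m%:R^-1 by rewrite /a /b -natr1 mulrDl mul1r addrAC subrr add0r.
have ha := hd (a - t) ltac:(rewrite ltr_norml; lra).
have hb := hd (b - t) ltac:(rewrite ltr_norml; lra).
rewrite !subrK in ha hb.
have -> : derive1 c t - m%:R *: (c b - c a) =
   m%:R *: ((c a - c t - (a - t) *: derive1 c t) - (c b - c t - (b - t) *: derive1 c t)).
  have mE : derive1 c t = m%:R *: ((b - a) *: derive1 c t).
    by rewrite ba scalerA divff ?scale1r// gt_eqF.
  rewrite {1}mE -scalerBr; congr (_ *: _).
  by apply/matrixP => j k; rewrite !mxE; ring.
rewrite normrZ gtr0_norm//.
apply: (@le_lt_trans _ _ (m%:R * (e / 2 * m%:R^-1))); last first.
  by rewrite mulrCA divff ?gt_eqF// mulr1; lra.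
rewrite ler_pM2l//; apply: le_trans (ler_normB _ _) _.
apply: (le_trans (lerD ha hb)).
rewrite ler0_norm ?ger0_norm; [|lra..].
by rewrite -ba; nra.
Unshelve. all: by end_near. Qed.

Lemma lipschitz_pathP c : lipschitz_path c -> exists2 k : R, 0 <= k &
  forall s t, 0 <= s <= 1 -> 0 <= t <= 1 -> `|c s - c t| <= k * `|s - t|.
Proof.
move=> [k hk]; exists `|k| => // s t hs ht.
have /= := hk (s, t); rewrite !in_itv /= => /(_ (conj hs ht)) /le_trans; apply.
by apply: ler_wpM2r => //; exact: ler_norm.
Qed.

(** The Lipschitz bound is available on [0, 1] only, so the coordinates are extended to the line by
    clamping the parameter. *)
Lemma lipschitz_path_ae_derivable c : lipschitz_path c ->
  {ae mu, forall t, 0 < t < 1 -> derivable c t 1}.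
Proof.
move=> /lipschitz_pathP[k k0 ck].
pose clamp (t : R) := Order.max 0 (Order.min 1 t).
have clamp01 t : 0 <= clamp t <= 1.
  by rewrite /clamp le_max lexx /= ge_max ler01 ge_min lexx.
have clampL s t : `|clamp s - clamp t| <= `|s - t|.
  rewrite /clamp /Order.max /Order.min.
  by repeat case: ifPn; rewrite -?leNgt => *; rewrite ler_norml;
    have := ler_norm (s - t); have := ler_norm (t - s); rewrite (distrC t s); lra.
have : {ae mu, forall t, forall i, 0 < t < 1 -> derivable (fun t => c (clamp t) i 0) t 1}.
  apply: (@filter_forall _ _ _ _ (ae_filter_ringOfSetsType mu)) => i.
  apply: (@lipschitz_ae_derivable R (fun t => c (clamp t) i 0) k) => s t.
  apply: (@le_trans _ _ `|c (clamp t) - c (clamp s)|).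
    by apply: le_trans (time_le_norm _ i); rewrite !mxE.
  by apply: le_trans (ck _ _ _ _) _ => //; apply: ler_wpM2l.
apply: (@filterS _ _ (ae_filter_ringOfSetsType mu)) => t dc t01.
have {}dc i : derivable (fun t => c t i 0) t 1.
  apply: near_eq_derivable (dc i t01); near=> s; rewrite /clamp.
  have s0 : 0 < s by near: s; apply: lt_nbhsr; case/andP: t01.
  have s1 : s < 1 by near: s; apply: lt_nbhsl; case/andP: t01.
  by rewrite min_r ?(ltW s1)// max_r ?(ltW s0).
apply/cvg_ex; exists (\col_i 'D_1 (fun t => c t i 0) t).
apply: cvg_col => i; rewrite mxE.
have -> : (fun x : R => (x^-1 *: ((c \o shift t) (x *: 1) - c t)) i 0) =
          (fun x => x^-1 *: (((fun t => c t i 0) \o shift t) (x *: 1) - c t i 0)).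
  by apply/funext => x; rewrite !mxE.
exact: dc i.
Unshelve. all: by end_near. Qed.

(** [step] rewritten with indicators, for which measurability and the integral are immediate. The
    cells are half-open, so the value at 1 is 0, whereas the truncation in [step] would there point
    beyond the end of the path. *)
Let stepf c m (t : R) : R := \sum_(i < m)
  (m%:R * chord (c (i%:R / m%:R)) (c (i.+1%:R / m%:R))) *
  \1_(`[i%:R / m%:R, i.+1%:R / m%:R[%classic : set R) t.

Lemma chord_ge0 p q : 0 <= chord p q. Proof. exact: sqrtr_ge0. Qed.

Lemma stepfE c m t : (0 < m)%N -> 0 <= t < 1 -> stepf c m t = step c m t.
Proof.
move=> m0 /andP[t0 t1]; have mR : 0 < m%:R :> R by rewrite ltr0n.
have mt0 : 0 <= m%:R * t by rewrite mulr_ge0// ltW.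
have im : (Num.truncn (m%:R * t) < m)%N.
  by rewrite truncn_lt_nat// -[ltRHS]mulr1 ltr_pM2l.
rewrite /stepf (bigD1 (Ordinal im))//= big1 => [|j ji].
  rewrite addr0 indicE mem_set; last first.
    by rewrite /= in_itv /= ler_pdivrMr// ltr_pdivlMr// (mulrC t) truncn_itv.
  rewrite mulr1 /step /quot /chord minkZl minkZr mulrA -expr2 sqrtrM ?sqr_ge0//.
  by rewrite sqrtr_sqr ger0_norm// ltW.
rewrite indicE memNset ?mulr0//= in_itv /= ler_pdivrMr// ltr_pdivlMr// (mulrC t).
rewrite -truncn_eq//; apply/negP; apply: contraNN ji => /eqP h.
by apply/eqP/val_inj => /=; rewrite h.
Qed.

Lemma stepf1 c m : stepf c m 1 = 0.
Proof.
apply: big1 => i _; rewrite indicE memNset ?mulr0//= in_itv /=.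
apply/negP; rewrite negb_and -!leNgt; apply/orP; right.
have m0 : 0 < m%:R :> R by rewrite ltr0n (leq_trans _ (ltn_ord i)).
by rewrite ler_pdivrMr// mul1r ler_nat.
Qed.

Lemma integral_stepf c m : (\int[mu]_(t in `[0%R, 1%R]) (stepf c m t)%:E = (chord_sum c m)%:E)%E.
Proof.
under eq_integral do rewrite /stepf -sumEFin.
rewrite ge0_integral_sum//; first last.
- move=> i t _; rewrite lee_fin; apply: mulr_ge0; first by rewrite mulr_ge0 ?chord_ge0.
  by rewrite indicE.
- by move=> i; apply/measurable_EFinP; apply: measurable_funM => //; exact: measurable_indic.
rewrite /chord_sum -sumEFin; apply: eq_bigr => i _.
have m0 : 0 < m%:R :> R by rewrite ltr0n (leq_trans _ (ltn_ord i)).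
rewrite (@integralZl_indic _ _ _ mu _ (measurable_itv _)
  (fun=> (`[(i%:R : R) / m%:R, i.+1%:R / m%:R[%classic : set R)))//; last first.
  by move=> h; have := mulr_ge0 (ltW m0) (chord_ge0 (c (i%:R / m%:R)) (c (i.+1%:R / m%:R))); rewrite leNgt h.
rewrite integral_indic// setIidl; last first.
  move=> t /=; rewrite !in_itv /= => /andP[h1 h2]; apply/andP; split.
    by apply: le_trans h1; rewrite divr_ge0// ltW.
  by apply: (le_trans (ltW h2)); rewrite ler_pdivrMr// mul1r ler_nat.
rewrite /= lebesgue_measure_itv /= lte_fin ltr_pM2r ?invr_gt0// ltr_nat ltnSn.
rewrite -EFinB -EFinM; congr (_%:E).
by rewrite -mulrBl -natrB// subSnn mul1r mulrAC divff ?gt_eqF// mul1r.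
Qed.

(** Dominated convergence, the Lipschitz constant bounding all step functions. Their limit superior
    [g] is measurable and agrees almost everywhere with the speed, to which the integral is then
    transferred. *)
Theorem chord_sum_cvg c : lipschitz_path c ->
  (chord_sum c m)%:E @[m --> \oo] --> path_length c.
Proof.
move=> cl; have [N [mN N0 hN]] := lipschitz_path_ae_derivable cl.
have [k k0 ck] := lipschitz_pathP cl.
(* From |<v, v>| <= (n+1) |v|^2 and quotients of norm at most k. *)
pose C : R := Num.sqrt (n.+1%:R * k ^+ 2).
have stepC m t : 0 <= t <= 1 -> `|stepf c m t| <= C.
  move=> /andP[t0]; rewrite le_eqVlt => /predU1P[->|t1].
    by rewrite stepf1 normr0 sqrtr_ge0.
  have [->|m0] := posnP m; first by rewrite /stepf big_ord0 normr0 sqrtr_ge0.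
  rewrite stepfE ?t0// /step ger0_norm ?sqrtr_ge0// ler_sqrt; last by rewrite mulr_ge0// sqr_ge0.
  apply: (le_trans (ler_norm _)); apply: (le_trans (mink_le _ _)).
  rewrite ler_pM2l// -expr2 ler_sqr ?nnegrE// normrZ ger0_norm//.
  have mR : 0 < m%:R :> R by rewrite ltr0n.
  rewrite mulrC -ler_pdivlMr//.
  have im : (Num.truncn (m%:R * t) < m)%N.
    by rewrite truncn_lt_nat ?mulr_ge0 ?(ltW mR)// -[ltRHS]mulr1 ltr_pM2l.
  apply: le_trans (ck _ _ _ _) _.
  - by rewrite divr_ge0 ?(ltW mR)//= ler_pdivrMr// mul1r ler_nat.
  - by rewrite divr_ge0 ?(ltW mR)//= ler_pdivrMr// mul1r ler_nat ltnW.
  - by rewrite -mulrBl -natrB// subSnn mul1r ger0_norm// invr_ge0 ltW.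
have stepf0 m t : 0 <= stepf c m t.
  by apply: sumr_ge0 => i _; rewrite mulr_ge0 ?mulr_ge0 ?chord_ge0// indicE.
pose D01 : set (measurableTypeR R) := `[0%R, 1%R]%classic.
have D1 : mu D01 = 1%E.
  have := @lebesgue_measure_itv R `[0, 1]; rewrite /= lte_fin ltr01 => ->.
  by rewrite -EFinB subr0.
have mstep m : measurable_fun D01 (fun t => (stepf c m t)%:E).
  apply/measurable_EFinP; apply: measurable_sum => i.
  by apply: measurable_funM => //; exact: measurable_indic.
pose g t := limn_esup (fun m => (stepf c m t)%:E).
pose f t := Num.sqrt (mink (derive1 c t) (derive1 c t)).
have stepl t : 0 < t < 1 -> ~ N t -> (stepf c m t)%:E @[m --> \oo] --> (f t)%:E.
  move=> t01 Nt; have dc : derivable c t 1.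
    by apply: contrapT => nd; apply/Nt/hN => /= /(_ t01).
  have h : step c m t @[m --> \oo] --> f t.
    apply: continuous_cvg; first exact: sqrt_continuous.
    by apply: cvg_mink; apply: quot_cvg => //; case/andP: t01.
  apply: cvg_EFin; first exact: nearW.
  apply: cvg_trans h; apply: near_eq_cvg; near=> m => /=.
  rewrite stepfE//; first by near: m; exists 1%N.
  by case/andP: t01 => /ltW -> ->.
pose N' := N `|` [set 0] `|` [set 1].
have mN' : measurable N' by do 2 apply: measurableU => //.
have N'0 : mu N' = 0%E.
  do 2 (rewrite measureU0//; try exact: measurableU; try exact: lebesgue_measure_set1).
have fg t : 0 <= t <= 1 -> ~ N' t -> (f t)%:E = g t.
  move=> t01 N't; have t1 : 0 < t < 1.
    case/andP: t01; rewrite !le_eqVlt => /predU1P[h|->].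
      by exfalso; apply: N't; left; right; rewrite -h.
    by case/predU1P => [h|->//]; exfalso; apply: N't; right.
  rewrite /g; have h := stepl t t1 (fun h => N't (or_introl (or_introl h))).
  by rewrite is_cvg_limn_esupE; [apply/esym/cvg_lim|apply/cvg_ex; exists (f t)%:E].
have mg : measurable_fun D01 g by apply: measurable_fun_limn_esup.
rewrite /path_length (@ae_eq_integral_nonmeasurable _ _ _ mu _ N' _ g)//; last first.
  move=> t _; rewrite /g limn_esup_lim.
  apply: lime_ge; first exact: is_cvg_esups.
  apply: nearW => m; apply: le_ereal_sup_tmp; exists (stepf c m t)%:E; last by rewrite lee_fin.
  by exists m => /=.
have [] := @dominated_convergence _ _ _ mu D01 (measurable_itv _)
  (fun m t => (stepf c m t)%:E) g (cst C%:E) mstep mg.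
- exists N'; split=> // t /=; apply: contra_notP => N't; rewrite /D01 /= in_itv /= => t01.
  rewrite -fg//; apply: stepl => //; last by move=> h; apply: N't; do 2 left.
  case/andP: t01; rewrite !le_eqVlt => /predU1P[h|->].
    by exfalso; apply: N't; left; right; rewrite -h.
  by case/predU1P => [h|->//]; exfalso; apply: N't; right.
- apply/integrableP; split=> //=; rewrite (_ : (fun=> _) = cst `|C|%:E)//.
  by rewrite (_ : integral _ _ _ = `|C|%:E) ?ltry// -[RHS]mule1 -D1; exact: (integral_cst mu (measurable_itv `[0%R, 1%R]) `|C|%:E).
- exists set0; split=> // t /=; apply: contra_notP => _ m; rewrite /D01 /= in_itv /= => t01.
  by rewrite /= lee_fin stepC.
move=> _ _ /=; rewrite [X in X @ _ --> _ -> _](_ : _ = fun m => (chord_sum c m)%:E)//.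
by apply/funext => m; exact: integral_stepf.
Unshelve. all: by end_near. Qed.
End ChordSums.

(** * Piecewise C^1 paths and polygons *)

Section Paths.
Context {R : realType} {n : nat}.
Local Notation V := 'cV[R]_n.+1.
Implicit Types (x y z : V) (c : R -> V) (A : set V).

(** Recursive form of the subdivision in [piecewise_C1], suited to induction on the list when paths
    are concatenated or reparametrized. *)
Fixpoint pieces (a : R) (s : seq R) c : Prop :=
  if s is b :: s' then [/\ a < b, C1_on a b c & pieces b s' c] else True.

Lemma piecewise_C1P c :
  piecewise_C1 c <-> exists2 s, pieces 0 s c & last 0 s = 1.
Proof.
have E a s : (path <%O a s /\ forall i, (i < size s)%N ->
    C1_on (nth 0 (a :: s) i) (nth 0 (a :: s) i.+1) c) <-> pieces a s c.
  elim: s a => [|b s IHs] a //=; split.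
    move=> [/andP[ab bs] h]; split=> //; first exact: (h 0%N).
    by apply/IHs; split=> // i si; exact: (h i.+1).
  move=> [ab h /IHs[bs hs]]; split; first by rewrite ab.
  by case=> [|i] si //; exact: hs.
split=> [[s [ps /eqP ls] hs]|[s /E[ps hs] ls]]; exists s => //.
  by apply/E.
by split=> //; rewrite ls.
Qed.

Lemma pieces_le a s c : pieces a s c -> a <= last a s.
Proof.
elim: s a => [|b s IHs] a //= [ab _ /IHs]; exact/le_trans/ltW.
Qed.

Lemma pieces_cat a s s' c :
  pieces a s c -> pieces (last a s) s' c -> pieces a (s ++ s') c.
Proof. by elim: s a => [|b s IHs] a //= [? ? ?] ?; split=> //; exact: IHs. Qed.

Lemma pieces_ext a s c c' : (forall t, a <= t <= last a s -> c t = c' t) ->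
  pieces a s c -> pieces a s c'.
Proof.
elim: s a => [|b s IHs] a //= h [ab [f [f1 f2 f3]] hs].
have bl := pieces_le hs.
split=> //.
  exists f; split=> // t; rewrite in_itv /= => /andP[at_ tb]; rewrite -h.
    by apply: f3; rewrite in_itv /= at_.
  by rewrite at_ (le_trans tb).
by apply: IHs => // t /andP[bt tl]; apply: h; rewrite tl (le_trans (ltW ab)).
Qed.

Lemma derivable_affine (f : R -> V) (k b t : R) : 0 < k -> derivable f (k * t + b) 1 ->
  derivable (fun u => f (k * u + b)) t 1 /\
  derive1 (fun u => f (k * u + b)) t = k *: derive1 f (k * t + b).
Proof.
move=> k0 df; apply/derivable_epsP => e e0.
have /derivable_epsP h := conj df (erefl (derive1 f (k * t + b))).
have [d d0 hd] := h (e / k) (divr_gt0 e0 k0).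
exists (d / k); first exact: divr_gt0.
move=> u; rewrite ltr_pdivlMr// mulrC => ud.
have := hd (k * u); rewrite normrM (gtr0_norm k0) => /(_ ud).
have -> : k * (u + t) + b = k * u + (k * t + b) by ring.
rewrite scalerA (mulrC u) => /le_trans; apply.
by rewrite mulrA divfK ?gt_eqF.
Qed.

Lemma C1_on_affine (s t k b : R) c : 0 < k ->
  C1_on (k * s + b) (k * t + b) c -> C1_on s t (fun u => c (k * u + b)).
Proof.
move=> k0 [f [f1 f2 f3]]; exists (fun u => f (k * u + b)); split.
- by move=> u; have [] := derivable_affine k0 (f1 (k * u + b)).
- have -> : derive1 (fun u => f (k * u + b)) = fun u => k *: derive1 f (k * u + b).
    by apply/funext => u; have [] := derivable_affine k0 (f1 (k * u + b)).
  move=> u; apply: cvgZr; apply: (@continuous_comp _ _ _ (fun u => k * u + b)); last exact: f2.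
  by apply: cvgD; [apply: cvgMr; exact: cvg_id|exact: cvg_cst].
- move=> u; rewrite in_itv /= => /andP[su ut]; apply: f3.
  by rewrite in_itv /= !lerD2r !ler_pM2l// su.
Qed.

Lemma pieces_affine (k b : R) a s c : 0 < k -> pieces (k * a + b) [seq k * u + b | u <- s] c ->
  pieces a s (fun u => c (k * u + b)).
Proof.
move=> k0; elim: s a => [|d s IHs] a //= [ad h hs]; split.
- by move: ad; rewrite ltrD2r ltr_pM2l.
- exact: C1_on_affine.
- exact: IHs.
Qed.

Lemma derivable_coord (f : R -> V) (t : R) i : derivable f t 1 ->
  is_derive t 1 (fun u => f u i 0) ((derive1 f t) i 0).
Proof.
move=> df; have /derivable_epsP h := conj df (erefl (derive1 f t)).
have : derivable (fun u => f u i 0) t 1 /\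
    derive1 (fun u => f u i 0) t = (derive1 f t) i 0.
  apply/derivable_epsP => e e0; have [d d0 hd] := h e e0.
  exists d => // u /hd; apply: le_trans.
  by apply: le_trans (time_le_norm _ i); rewrite !mxE.
by move=> [? <-]; apply: DeriveDef => //; rewrite derive1E.
Qed.

Lemma C1_on_lipschitz (s t : R) c : s <= t -> C1_on s t c -> exists2 k : R, 0 <= k &
  forall u v : R, s <= u <= t -> s <= v <= t -> `|c u - c v| <= k * `|u - v|.
Proof.
move=> st [f [f1 f2 f3]].
have [m _ hm] := @EVT_max R (fun u => `|derive1 f u|) s t st
  (continuous_subspaceT (fun u => cvg_norm (f2 u))).
exists `|derive1 f m| => // u v.
wlog uv : u v / u <= v => [H|] us vs.
  have [/H|/ltW /H] := leP u v; first exact.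
  by rewrite distrC (distrC u) => ->.
rewrite !f3 ?in_itv //= distrC (distrC u); apply: norm_le_coord => [|i].
  by rewrite mulr_ge0.
rewrite !mxE.
have [x||x xuv ->] := @MVT_segment R (fun w => f w i 0) (fun w => (derive1 f w) i 0) u v uv.
- by move=> _; exact: derivable_coord.
- apply: continuous_subspaceT => x; have := @derivable_coord f x i (f1 x).
  by move=> /@ex_derive /derivable1_diffP /differentiable_continuous.
rewrite normrM; apply: ler_wpM2r => //.
apply: le_trans (time_le_norm _ i) _; apply: hm; move: xuv us vs; rewrite !in_itv /=; lra.
Qed.

Lemma pieces_lipschitz a s c : pieces a s c -> exists2 k : R, 0 <= k &
  forall u v : R, a <= u <= last a s -> a <= v <= last a s -> `|c u - c v| <= k * `|u - v|.
Proof.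
elim: s a => [|b s IHs] a /=.
  exists 0 => // u v hu hv.
  have -> : u = a by apply/eqP; rewrite eq_le andbC.
  have -> : v = a by apply/eqP; rewrite eq_le andbC.
  by rewrite subrr normr0 mul0r.
move=> [ab /(C1_on_lipschitz (ltW ab))[k1 k10 h1] hs].
have [k2 k20 h2] := IHs _ hs; have bl := pieces_le hs.
exists (k1 + k2) => [|u v]; first exact: addr_ge0.
wlog uv : u v / u <= v => [H|] /andP[au ul] /andP[av vl].
  have [/H|/ltW /H] := leP u v; first by apply; apply/andP.
  by rewrite distrC (distrC u) => ->//; apply/andP.
rewrite (distrC u) (ger0_norm (_ : 0 <= v - u)) ?subr_ge0//.
have [vb|bv] := leP v b.
  apply: (le_trans (h1 u v _ _)); rewrite ?au ?av ?vb//= ?(le_trans uv)//.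
  by rewrite distrC ger0_norm ?subr_ge0// ler_wpM2r ?subr_ge0// lerDl.
have [ub|bu] := leP u b; last first.
  apply: (le_trans (h2 u v _ _)); rewrite ?(ltW bu) ?(ltW bv)//=.
  by rewrite distrC ger0_norm ?subr_ge0// ler_wpM2r ?subr_ge0// lerDr.
rewrite -(subrKA (c b)); apply: le_trans (ler_normD _ _) _.
have := h1 u b; rewrite au ub lexx (ltW ab) (distrC u) => /(_ isT isT).
rewrite (ger0_norm (_ : 0 <= b - u)) ?subr_ge0// => i1.
have := h2 b v; rewrite lexx bl (ltW bv) vl (distrC b) => /(_ isT isT).
rewrite (ger0_norm (_ : 0 <= v - b)) ?subr_ge0 ?(ltW bv)// => i2.
by nra.
Qed.

Lemma piecewise_C1_lipschitz c : piecewise_C1 c -> lipschitz_path c.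
Proof.
move=> /piecewise_C1P[s /pieces_lipschitz[k k0 hk] ls]; exists k => -[u v] /=.
by rewrite !in_itv /= => -[hu hv]; apply: hk; rewrite ls.
Qed.

Definition concat c1 c2 : R -> V :=
  fun t => if t <= 1 / 2 then c1 (2 * t) else c2 (2 * t - 1).

Lemma concat_piecewise_C1 c1 c2 : c1 1 = c2 0 ->
  piecewise_C1 c1 -> piecewise_C1 c2 -> piecewise_C1 (concat c1 c2).
Proof.
move=> c12 /piecewise_C1P[s1 h1 l1] /piecewise_C1P[s2 h2 l2]; apply/piecewise_C1P.
have lm (a k b : R) s : last (k * a + b) [seq k * u + b | u <- s] = k * last a s + b.
  exact: last_map.
pose t1 := [seq 2^-1 * u + 0 | u <- s1]; pose t2 := [seq 2^-1 * u + 2^-1 | u <- s2].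
have lt1 : last 0 t1 = 2^-1.
  by have := lm 0 2^-1 0 s1; rewrite mulr0 add0r l1 mulr1 addr0.
have lt2 : last 2^-1 t2 = 1.
  by have := lm 0 2^-1 2^-1 s2; rewrite mulr0 add0r l2 mulr1 => ->; field.
exists (t1 ++ t2); last by rewrite last_cat lt1.
apply: pieces_cat; rewrite ?lt1.
  apply: (@pieces_ext _ _ (fun u => c1 (2 * u + 0))).
    by rewrite lt1 => t /andP[_ t2']; rewrite /concat addr0 ifT// div1r.
  apply: pieces_affine => //; rewrite mulr0 addr0 -map_comp map_id_in// => u _ /=.
  by field.
apply: (@pieces_ext _ _ (fun u => c2 (2 * u - 1))).
  rewrite lt2 => t /andP[]; rewrite le_eqVlt => /predU1P[<- _|t2' _]; rewrite /concat.
    by rewrite div1r lexx mulfV// subrr c12.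
  by rewrite ifF//; apply/negbTE; rewrite -ltNge div1r.
apply: pieces_affine => //; rewrite mulfV// subrr -map_comp map_id_in// => u _ /=.
by field.
Qed.

Lemma path_length_ge0 c : (0 <= path_length c)%E.
Proof. by apply: integral_ge0 => t _; rewrite lee_fin sqrtr_ge0. Qed.

Lemma chord_sum_concat c1 c2 m : c1 1 = c2 0 ->
  chord_sum (concat c1 c2) (m + m) = chord_sum c1 m + chord_sum c2 m.
Proof.
move=> c12; have [->|m0] := posnP m; first by rewrite /chord_sum !big_ord0 addr0.
have mR : m%:R != 0 :> R by rewrite pnatr_eq0 -lt0n.
have mR0 : 0 < m%:R :> R by rewrite ltr0n.
have mm : (m + m)%:R = 2 * m%:R :> R by rewrite natrD; ring.
have v1 (i : nat) : (i <= m)%N -> concat c1 c2 (i%:R / (m + m)%:R) = c1 (i%:R / m%:R).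
  move=> im; have iR : (i%:R : R) <= m%:R by rewrite ler_nat.
  rewrite /concat mm ifT; first by congr c1; field.
  by rewrite ler_pdivrMr ?mulr_gt0// mulrA divfK ?mul1r.
have v2 (i : nat) : concat c1 c2 ((m + i)%:R / (m + m)%:R) = c2 (i%:R / m%:R).
  case: i => [|i].
    by rewrite addn0 v1// divff// c12 mul0r.
  rewrite /concat mm ifF; first by congr c2; rewrite natrD; field.
  apply/negbTE; rewrite -ltNge ltr_pdivlMr ?mulr_gt0// mulrA divfK// mul1r.
  by rewrite ltr_nat addnS ltnS leq_addr.
rewrite /chord_sum big_split_ord /=; congr (_ + _); apply: eq_bigr => i _ /=.
  by rewrite !v1// ltnW.
by rewrite -addnS !v2.
Qed.

(** A subdivision into 2m equal cells splits into subdivisions of both halves into m cells, so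
    additivity passes to the limit from chord sums, without a change of variables in the
    integral. *)
Lemma path_length_concat c1 c2 : c1 1 = c2 0 ->
  piecewise_C1 c1 -> piecewise_C1 c2 ->
  path_length (concat c1 c2) = (path_length c1 + path_length c2)%E.
Proof.
move=> c12 h1 h2.
have L1 := chord_sum_cvg (piecewise_C1_lipschitz h1).
have L2 := chord_sum_cvg (piecewise_C1_lipschitz h2).
have L := chord_sum_cvg (piecewise_C1_lipschitz (concat_piecewise_C1 c12 h1 h2)).
have mm : (fun m => m + m)%N @ \oo --> \oo.
  by move=> P [N _ NP]; exists N => // m /= Nm; apply: NP => /=; rewrite (leq_trans Nm) ?leq_addr.
have Lm := cvg_comp _ _ mm L.
have L12 := cvgeD (ge0_adde_def (path_length_ge0 c1) (path_length_ge0 c2)) L1 L2.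
have {}Lm : ((chord_sum c1 m)%:E + (chord_sum c2 m)%:E)%E @[m --> \oo] --> path_length (concat c1 c2).
  have -> : (fun m => ((chord_sum c1 m)%:E + (chord_sum c2 m)%:E)%E) =
      (fun k => (chord_sum (concat c1 c2) k)%:E) \o (fun m => m + m)%N.
    by apply/funext => m /=; rewrite chord_sum_concat.
  exact: Lm.
apply: (cvg_unique _ Lm); first exact: ereal_hausdorff.
exact: L12.
Qed.

Lemma riemannian_dist_triangle A x y z :
  (riemannian_dist A x z <= riemannian_dist A x y + riemannian_dist A y z)%E.
Proof.
have d0 u v : (0 <= riemannian_dist A u v)%E.
  by apply: le_ereal_inf_tmp => _ [c _ <-]; exact: path_length_ge0.
have [h|] := boolP (riemannian_dist A x y == +oo)%E.
  by rewrite (eqP h) addye ?leey// gt_eqF// (lt_le_trans _ (d0 _ _)).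
have [h _|] := boolP (riemannian_dist A y z == +oo)%E.
  by rewrite (eqP h) addey ?leey// gt_eqF// (lt_le_trans _ (d0 _ _)).
move=> yz xy; apply/lee_addgt0Pr => e e0.
have fxy : riemannian_dist A x y \is a fin_num by rewrite ge0_fin_numE ?d0// ltey.
have fyz : riemannian_dist A y z \is a fin_num by rewrite ge0_fin_numE ?d0// ltey.
have e2 : 0 < e / 2 by rewrite divr_gt0.
have [_ [c1 [a1 A1 x1 y1] <-] l1] := lb_ereal_inf_adherent e2 fxy.
have [_ [c2 [a2 A2 x2 y2] <-] l2] := lb_ereal_inf_adherent e2 fyz.
have c12 : c1 1 = c2 0 by rewrite y1 x2.
apply: (@le_trans _ _ (path_length (concat c1 c2))).
  apply: ereal_inf_lbound; exists (concat c1 c2) => //; split.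
  - exact: concat_piecewise_C1.
  - move=> t; rewrite in_itv /= => /andP[t0 t1]; rewrite /concat; case: ifPn => [h|].
      by apply: A1; rewrite in_itv /=; lra.
    by rewrite -ltNge => h; apply: A2; rewrite in_itv /=; lra.
  - by rewrite /concat mulr0 ifT// divr_ge0.
  - by rewrite /concat ifF ?mulr1 ?addrK//; lra.
rewrite path_length_concat//; apply: (le_trans (leeD (ltW l1) (ltW l2))).
rewrite addeACA; apply: leeD => //.
by rewrite -EFinD lee_fin; lra.
Qed.

Lemma path_chain A c x y (l : R) : lipschitz_path c ->
  {in `[0, 1], forall t, A (c t)} -> c 0 = x -> c 1 = y ->
  (path_length c < l%:E)%E ->
  exists m (p : nat -> V), [/\ p 0%N = x, p m = y, forall i, (i <= m)%N -> A (p i) &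
    \sum_(i < m) chord (p i) (p i.+1) < l].
Proof.
move=> cl cA c0 c1 cL; have L := chord_sum_cvg cl.
have /L : nbhs (path_length c) [set z | (z < l%:E)%E].
  by apply: open_nbhs_nbhs; split; [exact: open_ereal_lt_ereal|].
(* The successor excludes the empty subdivision, whose last vertex would be [c 0] because division
   by 0 gives 0. *)
move=> [N _ hN]; exists N.+1, (fun i => c (i%:R / N.+1%:R)); split.
- by rewrite mul0r.
- by rewrite divff ?pnatr_eq0.
- by move=> i iN; apply: cA; rewrite in_itv /= divr_ge0//= ler_pdivrMr// mul1r ler_nat.
- by have := hN N.+1 (leqnSn N); rewrite /= lte_fin.
Qed.

Lemma riemannian_dist_chain A x y (l : R) : (riemannian_dist A x y < l%:E)%E ->
  exists m (p : nat -> V), [/\ p 0%N = x, p m = y, forall i, (i <= m)%N -> A (p i) &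
    \sum_(i < m) chord (p i) (p i.+1) < l].
Proof.
move=> /ereal_inf_lt[_ [c [h cA c0 c1] <-] cl].
exact: path_chain (piecewise_C1_lipschitz h) cA c0 c1 cl.
Qed.
End Paths.

(** * Entire convex spacelike graphs *)

Section EntireSurfaces.
Context {R : realType} {n : nat}.
Local Notation V := 'cV[R]_n.+1.
Implicit Types (p q v w x y : V) (S : set V) (N : V -> V).

(** Common interface of the hyperboloid and the level surfaces: an entire convex graph with
    continuous future unit normal. The support inequality puts the surface on the future side of
    each of its tangent planes. *)
Record entire_surface S N : Prop := EntireSurface {
  normal_hyp : forall p, S p -> hyp (N p);
  normal_support : forall p q, S p -> S q -> mink (q - p) (N p) <= 0;
  vertical_meet : forall x, exists s, S (x + s *: e0);
  normal_continuous : forall p, S p -> forall e, 0 < e -> exists2 d, 0 < d &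
    forall q, S q -> `|q - p| < d -> `|N q - N p| <= e }.

Lemma hyp_entire : entire_surface (@hyp R n) id.
Proof.
split=> //.
- move=> p q hp hq; rewrite minkDl minkNl hp.1 opprK.
  by have := hyp_mink_le hq hp; lra.
- move=> x; have s0 := sdot_ge0 x.
  exists (Num.sqrt (1 + sdot x x) - x ord0 0).
  have tE : (x + (Num.sqrt (1 + sdot x x) - x ord0 0) *: e0) ord0 0 = Num.sqrt (1 + sdot x x).
    by rewrite !mxE !eqxx mulr1 addrC subrK.
  split; last by rewrite tE sqrtr_gt0; lra.
  rewrite minkE tE -expr2 sqr_sqrtr; last by lra.
  by rewrite !(sdotDl, sdotDr, sdotZl, sdotZr) (sdotC e0) !sdot_e0; lra.
- by move=> p _ e e0'; exists e => // q _ /ltW.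
Qed.

Section Surface.
Variables (S : set V) (N : V -> V).
Hypothesis SN : entire_surface S N.

(** If [q - p] were timelike, the support inequality at the later of the two points would fail. *)
Lemma entire_spacelike p q : S p -> S q -> 0 <= mink (q - p) (q - p).
Proof.
move=> Sp Sq; rewrite leNgt; apply/negP => h.
have hp := normal_support SN Sp Sq; have hq := normal_support SN Sq Sp.
have lt0 u z : mink u u < 0 -> future_causal u -> S z -> mink u (N z) < 0.
  move=> u0 fu Sz; rewrite minkC; apply: ft_fc_mink_lt0 => //.
    exact/hyp_ft/(normal_hyp SN).
  by move=> uE; move: u0; rewrite uE mink0l ltxx.
case: (fc_or (ltW h)) => fc.
  have := lt0 _ _ h fc Sq.
  by rewrite -(opprB p q) minkNl; lra.
rewrite opprB in fc.
have hu : mink (p - q) (p - q) < 0 by rewrite -(opprB q) minkNl minkNr opprK.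
by have := lt0 _ _ hu fc Sp; rewrite -(opprB q) minkNl; lra.
Qed.

Lemma vertical_unique x s t : S (x + s *: e0) -> S (x + t *: e0) -> s = t.
Proof.
have le a b : S (x + a *: e0) -> S (x + b *: e0) -> a <= b.
  move=> Sa Sb; have := normal_support SN Sa Sb.
  rewrite opprD addrACA subrr add0r -scalerBl minkZl minkC mink_e0 mulrN oppr_le0.
  by rewrite pmulr_lge0 ?subr_ge0// (normal_hyp SN Sa).2.
by move=> Ss St; apply/eqP; rewrite eq_le !le.
Qed.

Section Segment.
Variables (p w : V).

Let height (t : R) : R := projT1 (cid (vertical_meet SN (p + t *: w))).
Let c (t : R) : V := p + t *: w + height t *: e0.

Let cS t : S (c t).
Proof. exact: projT2 (cid (vertical_meet SN (p + t *: w))). Qed.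

(** The value for which [w + slope t *: e0] is orthogonal to the normal, hence tangent: the future
    derivative of [height]. *)
Let slope t : R := mink w (N (c t)) / N (c t) ord0 0.
Let G : R := `|w ord0 0| + Num.sqrt (sdot w w).

Let slope_le t : `|slope t| <= G.
Proof.
have [NN N0] := normal_hyp SN (cS t).
rewrite /slope normrM normfV (gtr0_norm N0) ler_pdivrMr// minkE.
apply: le_trans (ler_normD _ _) _; rewrite normrN normrM (gtr0_norm N0) mulrDl lerD2l.
apply: le_of_sqr; first by rewrite mulr_ge0 ?sqrtr_ge0// ltW.
rewrite real_normK ?num_real// exprMn sqr_sqrtr ?sdot_ge0//.
apply: le_trans (sdot_CauchySchwarz _ _) _; apply: ler_wpM2l; first exact: sdot_ge0.
by move: NN; rewrite minkE expr2; lra.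
Qed.

(** The support inequalities at both points enclose the increment, as for a convex function; with
    the continuity of the normal this makes the projected path C^1. *)
Let height_slope t h : h * slope t <= height (t + h) - height t <= h * slope (t + h).
Proof.
have [_ N0] := normal_hyp SN (cS t); have [_ N1] := normal_hyp SN (cS (t + h)).
have cE : c (t + h) - c t = h *: w + (height (t + h) - height t) *: e0.
  by rewrite /c; apply/matrixP => i j; rewrite !mxE; ring.
have := normal_support SN (cS t) (cS (t + h)).
have := normal_support SN (cS (t + h)) (cS t).
rewrite -(opprB (c (t + h))) minkNl cE !mink_lin !(minkC e0) !mink_e0 /slope => h1 h0.
by rewrite !mulrA ler_pdivrMr// ler_pdivlMr//; apply/andP; split; lra.
Qed.

Let height_lipschitz t h : `|height (t + h) - height t| <= G * `|h|.
Proof.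
have /andP[h1 h2] := height_slope t h.
have b u : `|h * slope u| <= G * `|h|.
  by rewrite normrM mulrC; apply: ler_wpM2r => //; exact: slope_le.
have := b t; have := b (t + h); rewrite !ler_norml => /andP[_ i1] /andP[i2 _].
by apply/andP; split; [exact: le_trans i2 h1|exact: le_trans h2 i1].
Qed.

Let c_continuous : continuous c.
Proof.
move=> t; apply/cvgrPdist_le => e e0'.
have k0 : 0 < `|w| + G * `|e0 : V| + 1.
  by rewrite ltr_wpDl// addr_ge0// mulr_ge0// addr_ge0// sqrtr_ge0.
near=> u; rewrite distrC.
have -> : c u - c t = (u - t) *: w + (height (t + (u - t)) - height t) *: e0.
  by rewrite addrCA subrr addr0; apply/matrixP => i j; rewrite !mxE; ring.
apply: le_trans (ler_normD _ _) _; rewrite !normrZ.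
apply: (@le_trans _ _ ((`|w| + G * `|e0 : V| + 1) * `|u - t|)).
  have := height_lipschitz t (u - t) => /(ler_wpM2r (normr_ge0 (e0 : V))).
  have := normr_ge0 (u - t); lra.
rewrite mulrC -ler_pdivlMr// distrC.
by near: u; apply: cvgr_dist_le => //; rewrite divr_gt0.
Unshelve. all: by end_near. Qed.

Let slope_continuous : continuous slope.
Proof.
move=> t; have Nc : N (c u) @[u --> t] --> N (c t).
  apply/cvgrPdist_le => e e0'; have [d d0 hd] := normal_continuous SN (cS t) e0'.
  near=> u; rewrite distrC; apply: hd => //; rewrite distrC.
  by near: u; have /cvgrPdist_lt := @c_continuous t; apply.
apply: cvgM; first by apply: cvg_mink => //; exact: cvg_cst.
apply: cvgV; last exact: cvg_coord.
by rewrite gt_eqF// (normal_hyp SN (cS t)).2.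
Unshelve. all: by end_near. Qed.

Let c_derivable t : derivable c t 1 /\ derive1 c t = w + slope t *: e0.
Proof.
apply/derivable_epsP => e e0'.
have k0 : 0 < `|e0 : V| + 1 by rewrite ltr_wpDl.
have /cvgrPdist_lt /(_ (e / (`|e0 : V| + 1)) (divr_gt0 e0' k0)) := @slope_continuous t.
move=> /nbhs_ballP[d /= d0 hd]; exists d => // h hlt.
have -> : c (h + t) - c t - h *: (w + slope t *: e0) =
    (height (t + h) - height t - h * slope t) *: e0.
  by rewrite (addrC h); apply/matrixP => i j; rewrite !mxE; ring.
rewrite normrZ.
have sl : `|slope (t + h) - slope t| < e / (`|e0 : V| + 1).
  by rewrite distrC; apply: hd; rewrite /ball /= opprD addNKr normrN.
have /andP[h1 h2] := height_slope t h.
have : `|height (t + h) - height t - h * slope t| <= `|h| * (e / (`|e0 : V| + 1)).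
  apply: (@le_trans _ _ `|h * (slope (t + h) - slope t)|).
    rewrite ger0_norm ?subr_ge0//; apply: le_trans (ler_norm _); rewrite mulrBr; lra.
  by rewrite normrM; apply: ler_wpM2l => //; exact: ltW.
move=> /(ler_wpM2r (normr_ge0 (e0 : V))) /le_trans; apply.
rewrite mulrAC mulrC (mulrC `|h|) mulrA; apply: ler_wpM2r => //.
by rewrite mulrAC ler_pdivrMr// ler_pM2l// lerDl.
Qed.

Let c_C1 : piecewise_C1 c.
Proof.
apply/piecewise_C1P; exists [:: 1] => //=; split=> //; exists c; split=> //.
- by move=> t; have [] := c_derivable t.
- have -> : derive1 c = fun t => w + slope t *: e0.
    by apply/funext => t; have [] := c_derivable t.
  move=> t; apply: cvgD; first exact: cvg_cst.
  by apply: cvgZl; exact: slope_continuous.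
Qed.

Let chord_c t u : t <= u ->
  let h := (c u - c t) ord0 0 in let a := (u - t) * Num.sqrt (sdot w w) in
  [/\ 0 <= a, `|h| <= a & chord (c t) (c u) = Num.sqrt (a ^+ 2 - h ^+ 2)].
Proof.
move=> tu h a; have a0 : 0 <= a by rewrite mulr_ge0 ?subr_ge0// sqrtr_ge0.
have mE : mink (c u - c t) (c u - c t) = a ^+ 2 - h ^+ 2.
  rewrite minkE -/h /a exprMn sqr_sqrtr ?sdot_ge0//.
  have -> : sdot (c u - c t) (c u - c t) = (u - t) ^+ 2 * sdot w w.
    have -> : c u - c t = (u - t) *: w + (height u - height t) *: e0.
      by rewrite /c; apply/matrixP => i j; rewrite !mxE; ring.
    by rewrite !(sdotDl, sdotDr, sdotZl, sdotZr) (sdotC e0) !sdot_e0; ring.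
  by ring.
split=> //; last by rewrite /chord mE.
apply: le_of_sqr => //; rewrite real_normK ?num_real//.
by rewrite -subr_ge0 -mE; exact: entire_spacelike.
Qed.

(** Reversed triangle inequality in the Lorentzian plane, for spacelike vectors whose horizontal
    parts point the same way; it reduces to (ak - bh)^2 >= 0. *)
Lemma sqrt_superadd (a b h k : R) : `|h| <= a -> `|k| <= b ->
  Num.sqrt (a ^+ 2 - h ^+ 2) + Num.sqrt (b ^+ 2 - k ^+ 2) <=
  Num.sqrt ((a + b) ^+ 2 - (h + k) ^+ 2).
Proof.
rewrite !ler_norml => /andP[h1 h2] /andP[k1 k2].
have x0 : 0 <= a ^+ 2 - h ^+ 2 by nra.
have y0 : 0 <= b ^+ 2 - k ^+ 2 by nra.
have z0 : 0 <= (a + b) ^+ 2 - (h + k) ^+ 2 by nra.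
apply: le_of_sqr; first exact: sqrtr_ge0.
rewrite sqrrD !sqr_sqrtr// -sqrtrM//.
have : Num.sqrt ((a ^+ 2 - h ^+ 2) * (b ^+ 2 - k ^+ 2)) <= a * b - h * k.
  rewrite -[leRHS]ger0_norm; last by nra.
  rewrite -sqrtr_sqr ler_sqrt ?sqr_ge0// -subr_ge0.
  by have := sqr_ge0 (a * k - b * h); lra.
by rewrite -mulr_natr; lra.
Qed.

Let chord_superadd (t u v : R) : t <= u -> u <= v ->
  chord (c t) (c u) + chord (c u) (c v) <= chord (c t) (c v).
Proof.
move=> tu uv; have [_ h1 ->] := chord_c tu; have [_ h2 ->] := chord_c uv.
have [_ _ ->] := chord_c (le_trans tu uv).
apply: le_trans (sqrt_superadd h1 h2) _.
have -> : (u - t) * Num.sqrt (sdot w w) + (v - u) * Num.sqrt (sdot w w) =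
  (v - t) * Num.sqrt (sdot w w) by ring.
suff -> : (c v - c t) ord0 0 = (c u - c t) ord0 0 + (c v - c u) ord0 0 by [].
by rewrite !mxE; ring.
Qed.

(** The projected path stays in a vertical plane, where the reversed triangle inequality bounds
    every chord sum by the chord of the end points. *)
Lemma segment_length : (path_length c <= (chord (c 0) (c 1))%:E)%E.
Proof.
have L := chord_sum_cvg (piecewise_C1_lipschitz c_C1).
apply: (cvge_to_le L).
exists 1%N => // m /= m0; rewrite lee_fin /chord_sum.
have mR : 0 < m%:R :> R by rewrite ltr0n.
suff h i : \sum_(j < i) chord (c (j%:R / m%:R)) (c (j.+1%:R / m%:R)) <= chord (c 0) (c (i%:R / m%:R)).
  by apply: le_trans (h m) _; rewrite divff// gt_eqF.
elim: i => [|i IHi]; first by rewrite big_ord0 chord_ge0.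
rewrite big_ord_recr /=; apply: le_trans (lerD IHi (lexx _)) _.
apply: chord_superadd; first by rewrite divr_ge0// ltW.
by rewrite ler_pM2r ?invr_gt0// ler_nat.
Qed.

Lemma segment_dist : S p -> S (p + w) ->
  (riemannian_dist S p (p + w)%R <= (chord p (p + w)%R)%:E)%E.
Proof.
move=> Sp Spw.
have h0 : height 0 = 0.
  by apply: (@vertical_unique (p + 0 *: w)); rewrite ?[0 *: e0]scale0r ?scale0r ?addr0//;
    have := cS 0; rewrite /c scale0r addr0.
have h1 : height 1 = 0.
  by apply: (@vertical_unique (p + 1 *: w)); rewrite ?[0 *: e0]scale0r ?scale1r ?addr0//;
    have := cS 1; rewrite /c scale1r.
have c0 : c 0 = p by rewrite /c h0 !scale0r !addr0.
have c1 : c 1 = p + w by rewrite /c h1 scale0r scale1r addr0.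
apply: le_trans (_ : path_length c <= _)%E; last first.
  by apply: le_trans segment_length _; rewrite c0 c1.
apply: ereal_inf_lbound; exists c => //; split=> //.
Qed.
End Segment.

Lemma riemannian_dist_le_chord p q : S p -> S q ->
  (riemannian_dist S p q <= (chord p q)%:E)%E.
Proof.
by move=> Sp; rewrite -{1 2 3}(subrK p q) addrC; exact: segment_dist.
Qed.

Lemma riemannian_dist_le_chain m (r : nat -> V) :
  (forall i, (i <= m)%N -> S (r i)) ->
  (riemannian_dist S (r 0%N) (r m) <= (\sum_(i < m) chord (r i) (r i.+1))%:E)%E.
Proof.
elim: m => [|m IHm] Sr.
  rewrite big_ord0; apply: le_trans (riemannian_dist_le_chord (Sr 0%N _) (Sr 0%N _)) _ => //.
  by rewrite /chord subrr mink0l sqrtr0.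
rewrite big_ord_recr /= EFinD; apply: le_trans (riemannian_dist_triangle _ _ (r m) _) _.
apply: leeD; first by apply: IHm => i im; apply: Sr; rewrite (leq_trans im).
by apply: riemannian_dist_le_chord; apply: Sr.
Qed.
End Surface.
End EntireSurfaces.

(** * Regular domains as intersections of null half-spaces *)

Section RegularDomains.
Context {R : realType} {n : nat}.
Local Notation V := 'cV[R]_n.+1.
Implicit Types (p q r v w x y z : V) (D : set V) (G : set (V * R)).

(** The null planes enter through their future normals: the chronological future of a null plane is
    an open half-space. The pair with negative product encodes two non-parallel planes. *)
Record null_domain D G : Prop := NullDomain {
  normal_null : forall v c, G (v, c) -> mink v v = 0 /\ 0 < v ord0 0;
  null_domainE : forall x, D x <-> (forall v c, G (v, c) -> mink v x < c);
  null_pair : exists v1 c1 v2 c2, [/\ G (v1, c1), G (v2, c2) & mink v1 v2 < 0];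
  null_domain_nonempty : D !=set0;
  null_domain_open : open D }.

Lemma null_time_neq0 v : v <> 0 -> mink v v = 0 -> v ord0 0 != 0.
Proof. by move=> v0 vv; apply/eqP => /time_eq0 h; apply: v0; apply: h; rewrite vv. Qed.

Lemma null_fc v : mink v v = 0 -> 0 < v ord0 0 -> future_causal v.
Proof. by move=> vv v0; split; rewrite ?vv// ltW. Qed.

Lemma hyperplaneN v (c : R) : hyperplane (- v) (- c) = hyperplane v c.
Proof.
by apply/seteqP; split=> x; rewrite /hyperplane /= minkNl; [exact: oppr_inj|move=> ->].
Qed.

Lemma null_planeP (P : set V) : null_plane P ->
  exists v c, [/\ mink v v = 0, 0 < v ord0 0 & P = hyperplane v c].
Proof.
move=> [v [c [v0 vv PE]]]; have := null_time_neq0 v0 vv; rewrite neq_lt => /orP[t0|t0].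
  exists (- v), (- c); rewrite !mink_lin opprK mxE oppr_gt0; split=> //.
  by rewrite hyperplaneN.
by exists v, c.
Qed.

Lemma chron_future_null v (c : R) x : mink v v = 0 -> 0 < v ord0 0 ->
  chron_future (hyperplane v c) x <-> mink v x < c.
Proof.
move=> vv v0; split=> [[q] /= qc xq|h].
  have : mink (x - q) v < 0.
    apply: ft_fc_mink_lt0 => //; first by split; rewrite ?vv // ltW.
    by move=> vE; move: v0; rewrite vE mxE ltxx.
  by rewrite minkC minkDr minkNr qc subr_lt0.
exists (x - ((c - mink v x) / v ord0 0) *: e0).
  by rewrite /hyperplane /= !mink_lin mink_e0; field; rewrite gt_eqF.
by rewrite opprB addrC subrK; apply: ftZ ft_e0; rewrite divr_gt0// subr_gt0.
Qed.

Lemma null_parallel v w (c d : R) : mink v v = 0 -> 0 < v ord0 0 ->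
  mink w w = 0 -> 0 < w ord0 0 -> mink v w = 0 ->
  parallel (hyperplane v c) (hyperplane w d).
Proof.
move=> vv v0 ww w0 vw; pose l := w ord0 0 / v ord0 0.
have l0 : 0 < l by rewrite divr_gt0.
have wE : w = l *: v.
  apply/eqP; rewrite -subr_eq0; apply/eqP; apply: time_eq0.
    by rewrite !mink_lin (minkC w v) vv ww vw; lra.
  by rewrite !mxE /l divfK ?subrr// gt_eqF.
exists ((- (d / l - c) / v ord0 0) *: e0); apply/seteqP; split=> x /=; rewrite /hyperplane /=.
  rewrite wE minkZl => xd; exists (x - (- (d / l - c) / v ord0 0) *: e0); last by rewrite subrK.
  rewrite /= !mink_lin mink_e0 -xd; field.
  by rewrite !gt_eqF.
move=> [y /= <- <-]; rewrite wE !mink_lin mink_e0; field.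
by rewrite !gt_eqF.
Qed.

Lemma regular_null_domain D : future_complete_regular_domain D ->
  exists G, null_domain D G.
Proof.
move=> [D0 oD _ [F [hF [P [Q [FP FQ nPQ]]] DE]]].
exists [set vc | [/\ mink vc.1 vc.1 = 0, 0 < vc.1 ord0 0 & F (hyperplane vc.1 vc.2)]].
split=> //.
- by move=> v c [].
- move=> x; rewrite DE; split=> h.
    by move=> v c /= [vv v0 Fv]; apply/(chron_future_null _ _ vv v0); exact: (h _ Fv).
  move=> P' FP'; have [v [c [vv v0 PE]]] := null_planeP (hF _ FP').1.
  by rewrite PE; apply/(chron_future_null _ _ vv v0); apply: h; split; rewrite //= -PE.
- have [v [c [vv v0 PE]]] := null_planeP (hF _ FP).1.
  have [w [d [ww w0 QE]]] := null_planeP (hF _ FQ).1.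
  exists v, c, w, d; rewrite /= -PE -QE; split=> //.
  have := fc_mink_le0 (null_fc vv v0) (null_fc ww w0).
  rewrite le_eqVlt => /predU1P[vw|//]; exfalso; apply: nPQ; rewrite PE QE.
  exact: null_parallel.
Qed.

Lemma mink_continuous v : continuous (mink v).
Proof. by move=> x; exact: (@cvg_mink _ _ _ (nbhs x) _ (cst v) id v x (cvg_cst _) cvg_id). Qed.

Lemma closed_mink_le v (c : R) : closed [set x | mink v x <= c].
Proof.
by apply: (@closed_comp _ _ (mink v) [set y | y <= c] _ (@closed_le R c)) => x _; exact: mink_continuous.
Qed.

Lemma closed_mink_ge v (c : R) : closed [set x | c <= mink v x].
Proof.
by apply: (@closed_comp _ _ (mink v) [set y | c <= y] _ (@closed_ge R c)) => x _; exact: mink_continuous.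
Qed.

Lemma closed_future_causal p : closed [set q | future_causal (p - q)].
Proof.
have c1 : continuous (fun q : V => p - q).
  by move=> q; apply: (@continuousB _ _ _ (cst p) id) => //; exact: cst_continuous.
have -> : [set q | future_causal (p - q)] =
  (fun q => mink (p - q) (p - q)) @^-1` [set y | y <= 0] `&`
  (fun q => (p - q) ord0 0) @^-1` [set y | 0 <= y] by [].
apply: closedI; apply: closed_comp; try exact: closed_le; try exact: closed_ge.
  by move=> q _; exact: (cvg_mink (c1 q) (c1 q)).
by move=> q _; exact: (cvg_coord (c1 q)).
Qed.

Lemma norm_e0 : `|e0 : V| <= 1.
Proof.
by apply: norm_le_coord => // i; rewrite mxE; case: (_ && _); rewrite ?normr1 ?normr0.
Qed.

Lemma fc_norm_le w : future_causal w -> `|w| <= w ord0 0.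
Proof.
move=> [ww w0]; move: ww; rewrite minkE => ww.
apply: norm_le_coord => // i; apply: le_of_sqr => //; rewrite real_normK ?num_real//.
case: (unliftP ord0 i) => [j|] ->//.
apply: (@le_trans _ _ (sdot w w)); last by rewrite expr2; lra.
rewrite /sdot (bigD1 j)//= expr2 lerDl.
by apply: sumr_ge0 => l _; rewrite -expr2 sqr_ge0.
Qed.

Lemma ft_norm_le z : future_timelike z -> exists2 k, 0 < k &
  forall w, future_causal w -> k * `|w| <= - mink z w.
Proof.
move=> [zz z0]; have s0 := sdot_ge0 z.
(* The slack in Cauchy-Schwarz: for timelike [z] the time coordinate exceeds the spatial norm. *)
exists (z ord0 0 - Num.sqrt (sdot z z)).
  rewrite subr_gt0 -(ger0_norm (ltW z0)) -sqrtr_sqr ltr_sqrt ?exprn_gt0//.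
  by move: zz; rewrite minkE expr2; lra.
move=> w fw; have nw := fc_norm_le fw; have [ww w0] := fw.
move: ww; rewrite minkE => ww.
have sw : sdot z w <= Num.sqrt (sdot z z) * w ord0 0.
  apply: le_of_sqr; first by rewrite mulr_ge0 ?sqrtr_ge0.
  rewrite exprMn sqr_sqrtr//; apply: le_trans (sdot_CauchySchwarz _ _) _.
  by apply: ler_wpM2l => //; rewrite expr2; lra.
have k0 : 0 <= z ord0 0 - Num.sqrt (sdot z z).
  rewrite subr_ge0 -(ger0_norm (ltW z0)) -sqrtr_sqr ler_sqrt ?sqr_ge0//.
  by move: zz; rewrite minkE expr2; lra.
have := ler_wpM2l k0 nw; rewrite minkE; lra.
Qed.

Section Domain.
Variables (D : set V) (G : set (V * R)).
Hypothesis DG : null_domain D G.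

(** A small shift along [e0] makes all the large inequalities strict at once. *)
Lemma closure_domainE x : closure D x <-> forall v c, G (v, c) -> mink v x <= c.
Proof.
split=> [clx v c Gv|h].
  apply: (@closed_mink_le v c).
  by apply: closure_subset clx => y /(null_domainE DG) /(_ v c Gv) /ltW.
move=> B /nbhs_ballP[e /= e0' eB]; exists (x + (e / 2) *: e0); split.
  apply/(null_domainE DG) => v c Gv; rewrite !mink_lin mink_e0.
  have [_ v0] := normal_null DG Gv.
  have := h v c Gv; have : 0 < e / 2 * v ord0 0 by rewrite mulr_gt0 ?divr_gt0.
  lra.
apply: eB; rewrite mx_norm_ball /ball_ /= opprD addNKr normrN normrZ.
by apply: (le_lt_trans (ler_wpM2l (normr_ge0 _) norm_e0)); rewrite mulr1 gtr0_norm ?divr_gt0//; lra.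
Qed.

Lemma domain_closure x : D x -> closure D x.
Proof. exact: subset_closure. Qed.

Lemma closure_domain_ft x w : closure D x -> future_timelike w -> D (x + w).
Proof.
move=> /closure_domainE h hw; apply/(null_domainE DG) => v c Gv; rewrite minkDr.
have [vv v0] := normal_null DG Gv.
have : mink w v < 0.
  apply: ft_fc_mink_lt0 => //; first by split; rewrite ?vv// ltW.
  by move=> vE; move: v0; rewrite vE mxE ltxx.
by have := h v c Gv; rewrite (minkC w); lra.
Qed.

Lemma closure_domain_convex x y (t : R) : closure D x -> closure D y ->
  0 <= t <= 1 -> closure D (x + t *: (y - x)).
Proof.
move=> /closure_domainE hx /closure_domainE hy t01; apply/closure_domainE => v c Gv.
by rewrite !mink_lin; have := hx v c Gv; have := hy v c Gv; nra.
Qed.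

Lemma boundary_domainE x : boundary D x <-> closure D x /\ ~ D x.
Proof. by rewrite /boundary (proj1 (interior_id _) (null_domain_open DG)). Qed.

(** The sum of two non-parallel null normals is timelike, so its product with the causal vector
    [p - q] dominates the norm, while the two half-spaces bound that product. *)
Lemma past_compact p : compact (closure D `&` [set q | future_causal (p - q)]).
Proof.
have [v1 [c1 [v2 [c2 [G1 G2 v12]]]]] := null_pair DG.
have [vv1 t1] := normal_null DG G1; have [vv2 t2] := normal_null DG G2.
have hz : future_timelike (v1 + v2).
  split; last by rewrite mxE addr_gt0.
  by rewrite !mink_lin vv1 vv2 (minkC v2); lra.
have [k k0 hk] := ft_norm_le hz.
apply: (@col_bounded_closed_compact _ _ _ (`|p| + (c1 + c2 - mink (v1 + v2) p) / k)).
  by apply: closedI; [exact: closed_closure|exact: closed_future_causal].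
move=> q [/closure_domainE clq fq].
rewrite -[q](subKr p); apply: le_trans (ler_normB _ _) _; rewrite lerD2l ler_pdivlMr// mulrC.
apply: le_trans (hk _ fq) _; rewrite !mink_lin.
by have := clq _ _ G1; have := clq _ _ G2; lra.
Qed.
End Domain.
End RegularDomains.

(** * The retraction, the Gauss map and their support inequalities *)

Section Retraction.
Context {R : realType} {n : nat}.
Local Notation V := 'cV[R]_n.+1.
Implicit Types (p q r v w x y z : V).
Variables (D : set V) (G : set (V * R)).
Hypothesis DG : null_domain D G.

Local Notation ret := (retraction D).
Local Notation T := (cosmological_time D).

Lemma mink_subZ v w (t : R) :
  mink (v - t *: w) (v - t *: w) = mink v v - 2 * t * mink w v + t * (t * mink w w).
Proof. by rewrite !mink_lin (minkC v w); ring. Qed.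

Lemma past_shift p : D p -> exists2 s : R, 0 < s & D (p - s *: e0).
Proof.
move=> Dp; have := null_domain_open DG; rewrite openE => /(_ p Dp).
move=> /nbhs_ballP[e /= e0' eD]; exists (e / 2); first by rewrite divr_gt0.
apply: eD; rewrite mx_norm_ball /ball_ /= opprB addrC subrK normrZ.
apply: (le_lt_trans (ler_wpM2l (normr_ge0 _) norm_e0)).
by rewrite mulr1 gtr0_norm ?divr_gt0//; lra.
Qed.

(** The maximum is attained by compactness of the past. It is not in [D]: from a point of [D] a
    small step down along [e0] stays in [D] and increases the distance to [p]. *)
Lemma retraction_exists p : D p -> exists q, is_retraction D p q.
Proof.
move=> Dp.
have cf : continuous (fun q : V => - mink (p - q) (p - q)).
  have c1 : continuous (fun q : V => p - q).
    by move=> q; apply: (@continuousB _ _ _ (cst p) id) => //; exact: cst_continuous.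
  by move=> q; exact: (cvgN (cvg_mink (c1 q) (c1 q))).
have K0 : (closure D `&` [set q | future_causal (p - q)]) !=set0.
  by exists p; split; [exact: domain_closure|rewrite /= subrr; exact: fc0].
have [q /set_mem[clq fq] qmax] :=
  compact_EVT_max K0 (past_compact DG (p := p)) (continuous_subspaceT cf).
exists q; split=> //; last first.
  by move=> q' clq' fq'; apply: ler_wsqrtr; apply: qmax; exact: mem_set.
apply/(boundary_domainE DG); split=> // Dq; have [s s0 Ds] := past_shift Dq.
have wE : p - (q - s *: e0) = (p - q) + s *: e0 by rewrite opprB addrA addrAC.
have fq' : future_causal (p - (q - s *: e0)).
  by rewrite wE; exact: (fcD fq (fcZ (ltW s0) (ft_fc ft_e0))).
have := qmax (q - s *: e0) (mem_set (conj (domain_closure Ds) fq')).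
rewrite wE minkDl (minkDr (p - q)) (minkDr (s *: e0)) !minkZl !minkZr mink_e0e0.
rewrite (minkC e0) mink_e0 => h; have [_ t0] := fq.
by have := mulr_ge0 (ltW s0) t0; have := mulr_gt0 s0 s0; lra.
Qed.

Lemma retractionP p : D p -> is_retraction D p (ret p).
Proof. by move=> /retraction_exists; exact: xgetPex. Qed.

Lemma retraction_boundary p : D p -> boundary D (ret p).
Proof. by move=> /retractionP[]. Qed.

Lemma retraction_closure p : D p -> closure D (ret p).
Proof. by move=> /retraction_boundary/(boundary_domainE DG)[]. Qed.

Lemma retraction_ft p : D p -> future_timelike (p - ret p).
Proof.
move=> Dp; have [_ [ww w0] rmax] := retractionP Dp.
have [s s0 Ds] := past_shift Dp.
have pE : p - (p - s *: e0) = s *: e0 by rewrite opprB addrC subrK.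
have := rmax _ (domain_closure Ds); rewrite /causal_past /= pE.
move=> /(_ (fcZ (ltW s0) (ft_fc ft_e0))).
rewrite /lorentz_dist pE minkZl minkZr mink_e0e0 => h.
have : 0 < Num.sqrt (- mink (p - ret p) (p - ret p)).
  by apply: lt_le_trans h; rewrite sqrtr_gt0 !mulrN1 mulrN opprK mulr_gt0.
rewrite sqrtr_gt0 oppr_gt0 => {}h; split=> //.
rewrite lt_neqAle w0 andbT eq_sym; apply/eqP => /(time_eq0 ww) wE.
by move: h; rewrite wE mink0l ltxx.
Qed.

(** First variation: were the product positive, moving from [ret p] towards [x] inside the closed
    domain would increase the distance to [p]. *)
Lemma retraction_support p x : D p -> closure D x ->
  mink (x - ret p) (p - ret p) <= 0.
Proof.
move=> Dp clx; have [_ _ rmax] := retractionP Dp.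
have [ww w0] := retraction_ft Dp; have clr := retraction_closure Dp.
set w := p - ret p in ww w0 *; set d := x - ret p.
rewrite leNgt; apply/negP => wd.
(* [A] bounds the step so that the displacement stays future directed, [B] so that the linear term
   outweighs the quadratic one. *)
pose A := w ord0 0 / (`|d ord0 0| + 1); pose B := mink d w / (`|mink d d| + 1).
have A0 : 0 < A by rewrite divr_gt0// ltr_wpDl.
have B0 : 0 < B by rewrite divr_gt0// ltr_wpDl.
pose t := Order.min 1 (Order.min A B).
have t0 : 0 < t by rewrite !lt_min ltr01 A0 B0.
have t1 : t <= 1 by rewrite ge_min lexx.
have tA : t * (`|d ord0 0| + 1) <= w ord0 0.
  by rewrite -ler_pdivlMr ?ltr_wpDl// !ge_min lexx orbT.
have tB : t * (`|mink d d| + 1) <= mink d w.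
  by rewrite -ler_pdivlMr ?ltr_wpDl// !ge_min lexx !orbT.
have pE : p - (ret p + t *: d) = w - t *: d by rewrite opprD addrA.
have mE : mink (w - t *: d) (w - t *: d) = mink w w - 2 * t * mink d w + t * (t * mink d d).
  exact: mink_subZ.
have lt : mink (w - t *: d) (w - t *: d) < mink w w.
  rewrite mE; have : t * mink d d < 2 * mink d w.
    by have := ler_wpM2l (ltW t0) (ler_norm (mink d d)); lra.
  by rewrite -(ltr_pM2l t0); lra.
have fc : future_causal (w - t *: d).
  split; first by rewrite ltW// (lt_trans lt).
  rewrite !mxE; have := ler_wpM2l (ltW t0) (ler_norm (d ord0 0)).
  by move: tA; rewrite /w /d !mxE; lra.
have clt : closure D (ret p + t *: d).
  by apply: (closure_domain_convex DG clr clx); rewrite t1 ltW.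
have := rmax _ clt; rewrite /causal_past /= /lorentz_dist pE => /(_ fc).
apply/negP; rewrite -ltNge ltr_sqrt; first by rewrite ltrN2.
by rewrite oppr_gt0 (lt_trans lt).
Qed.

(* With w, w' the two displacements, adding the two support inequalities shows
   that w - w' is causal, and each of them forbids it to be nonzero. *)
Lemma retraction_unique p q : D p -> closure D q -> future_timelike (p - q) ->
  (forall x, D x -> mink (x - q) (p - q) <= 0) -> ret p = q.
Proof.
move=> Dp clq ft sq.
have h1 := retraction_support Dp clq; have ftr := retraction_ft Dp.
have h2 : mink (ret p - q) (p - q) <= 0.
  have : closure D `<=` [set x | mink (p - q) x <= mink (p - q) q].
    move=> x clx; apply: (@closed_mink_le _ _ (p - q) (mink (p - q) q)).
    by apply: closure_subset clx => y /sq; rewrite /= minkDl minkNl !(minkC (p - q)); lra.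
  move=> /(_ _ (retraction_closure Dp)) /=.
  by rewrite (minkDl (ret p)) minkNl (minkC (p - q)) (minkC (p - q) q); lra.
pose d := q - ret p; have dE : ret p - q = - d by rewrite opprB.
have wE : p - ret p = (p - q) + d by rewrite addrA subrK.
rewrite dE minkNl in h2; rewrite -/d in h1.
have dd : mink d d <= 0 by move: h1; rewrite wE minkDr; lra.
have d0 : d = 0.
  apply: contrapT => dn0; case: (fc_or dd) => fd.
    by have := ft_fc_mink_lt0 ft fd dn0; rewrite minkC; lra.
  have := ft_fc_mink_lt0 ftr fd; rewrite minkC minkNl => h.
  suff : - mink d (p - ret p) < 0 by lra.
  by apply: h => /eqP; rewrite oppr_eq0 => /eqP.
by apply/eqP; rewrite eq_sym -subr_eq0 -/d d0.
Qed.

Definition gauss p : V := (T p)^-1 *: (p - ret p).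

Lemma ctime_gt0 p : D p -> 0 < T p.
Proof. by move=> /retraction_ft[h _]; rewrite sqrtr_gt0 oppr_gt0. Qed.

Lemma gauss_hyp p : D p -> hyp (gauss p).
Proof. by move=> /retraction_ft; exact: normalize. Qed.

Lemma gaussE p : D p -> p = ret p + T p *: gauss p.
Proof.
by move=> /ctime_gt0 T0; rewrite scalerA divff ?gt_eqF// scale1r addrC subrK.
Qed.

Lemma gauss_support p x : D p -> closure D x -> mink (x - ret p) (gauss p) <= 0.
Proof.
move=> Dp clx; rewrite minkZr pmulr_rle0 ?invr_gt0 ?ctime_gt0//.
exact: retraction_support.
Qed.

(** Concavity of T, with - <., N(p)> as supergradient at [p]. The differentiability of T and the
    support planes of its level surfaces follow from it. *)
Lemma ctime_support p q : D p -> D q -> T q - T p <= - mink (q - p) (gauss p).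
Proof.
move=> Dp Dq; have h := gauss_support Dp (retraction_closure Dq).
have hN := hyp_mink_le (gauss_hyp Dq) (gauss_hyp Dp).
have NN := (gauss_hyp Dp).1; have Tq := ctime_gt0 Dq.
have -> : q - p = (ret q - ret p) + T q *: gauss q - T p *: gauss p.
  by rewrite {1}(gaussE Dq) {1}(gaussE Dp); apply/matrixP => i j; rewrite !mxE; ring.
move: h hN NN; move: (ret q - ret p) (gauss p) (gauss q) => d P Q h hN NN.
by rewrite !mink_lin NN; nra.
Qed.

(** Monotonicity with a quantitative gain: - <N(p), N(q)> - 1 is half the square of the increment of
    N. This yields the continuity of the Gauss map. *)
Lemma gauss_monotone p q : D p -> D q ->
  (T p + T q) * (- mink (gauss p) (gauss q) - 1) <= mink (q - p) (gauss q - gauss p).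
Proof.
move=> Dp Dq; have h1 := gauss_support Dp (retraction_closure Dq).
have h2 := gauss_support Dq (retraction_closure Dp).
have NN := (gauss_hyp Dp).1; have NN' := (gauss_hyp Dq).1.
have -> : q - p = (ret q - ret p) + T q *: gauss q - T p *: gauss p.
  by rewrite {1}(gaussE Dq) {1}(gaussE Dp); apply/matrixP => i j; rewrite !mxE; ring.
have h3 : 0 <= mink (ret q - ret p) (gauss q).
  by rewrite -opprB minkNl; lra.
move: h1 h3 NN NN'; move: (ret q - ret p) (gauss p) (gauss q) => d P Q h1 h3 NN NN'.
by rewrite !mink_lin (minkC Q P) NN NN'; nra.
Qed.

(** A future timelike vector added to a point of the closure leads into [D], so no boundary point is
    in the chronological future of another. *)
Lemma boundary_spacelike r s : boundary D r -> boundary D s -> 0 <= mink (r - s) (r - s).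
Proof.
have key u v : closure D u -> ~ D v -> ~ future_timelike (v - u).
  by move=> clu nDv ft; apply: nDv; have := closure_domain_ft DG clu ft; rewrite addrC subrK.
move=> /(boundary_domainE DG)[clr nr] /(boundary_domainE DG)[cls ns].
rewrite leNgt; apply/negP => h.
have ftE v : mink v v < 0 -> future_causal v -> future_timelike v.
  move=> vv [_ v0]; split=> //; rewrite lt_neqAle v0 andbT eq_sym.
  by apply/eqP => /(time_eq0 (ltW vv)) vE; move: vv; rewrite vE mink0l ltxx.
case: (fc_or (ltW h)) => fc; first exact: (key s r cls nr (ftE _ h fc)).
by rewrite opprB in fc; apply: (key r s clr ns); apply: ftE fc; rewrite -opprB minkNl minkNr opprK.
Qed.

(** Converse of the decomposition p = r + a N: every future unit support normal at [r] occurs. This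
    is how points with a prescribed Gauss image are produced. *)
Lemma level_make (a : R) r x : 0 < a -> closure D r -> hyp x ->
  (forall y, D y -> mink (y - r) x <= 0) ->
  [/\ level_surface D a (r + a *: x), ret (r + a *: x) = r & gauss (r + a *: x) = x].
Proof.
move=> a0 clr hx sx; have fx := ftZ a0 (hyp_ft hx).
have Dp : D (r + a *: x) := closure_domain_ft DG clr fx.
have pE : r + a *: x - r = a *: x by rewrite addrC addKr.
have rE : ret (r + a *: x) = r.
  apply: retraction_unique => //; rewrite pE// => y /sx h.
  by rewrite minkZr pmulr_rle0.
have TE : T (r + a *: x) = a.
  rewrite /cosmological_time /lorentz_dist rE pE minkZl minkZr hx.1.
  by rewrite !mulrN1 mulrN opprK -expr2 sqrtr_sqr gtr0_norm.
by split=> //; rewrite /gauss rE TE pE scalerA mulVf ?gt_eqF// scale1r.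
Qed.

Section Level.
Variable a : R.
Hypothesis a0 : 0 < a.

Lemma level_gaussE p : level_surface D a p -> p = ret p + a *: gauss p.
Proof. by move=> [Dp Tp]; have := gaussE Dp; rewrite Tp. Qed.

Lemma level_mink p q : level_surface D a p -> level_surface D a q ->
  mink (ret q - ret p) (ret q - ret p) +
    a ^+ 2 * mink (gauss q - gauss p) (gauss q - gauss p) <= mink (q - p) (q - p).
Proof.
move=> Sp Sq; have h1 := gauss_support Sp.1 (retraction_closure Sq.1).
have h2 := gauss_support Sq.1 (retraction_closure Sp.1).
have -> : q - p = (ret q - ret p) + a *: (gauss q - gauss p).
  by rewrite {1}(level_gaussE Sq) {1}(level_gaussE Sp); apply/matrixP => i j; rewrite !mxE; ring.
have h3 : 0 <= mink (ret q - ret p) (gauss q) by rewrite -opprB minkNl; lra.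
have h4 : 0 <= a * mink (ret q - ret p) (gauss q - gauss p).
  by rewrite mulr_ge0 ?(ltW a0)// minkDr minkNr; lra.
move: (ret q - ret p) (gauss q - gauss p) h4 => d e h4.
by rewrite !mink_lin (minkC e d); nra.
Qed.

Lemma level_chord_ret p q : level_surface D a p -> level_surface D a q ->
  chord (ret p) (ret q) <= chord p q.
Proof.
move=> Sp Sq; apply: ler_wsqrtr; apply: le_trans (level_mink Sp Sq).
rewrite lerDl mulr_ge0 ?sqr_ge0//.
exact: (entire_spacelike hyp_entire (gauss_hyp Sp.1) (gauss_hyp Sq.1)).
Qed.

Lemma level_chord_gauss p q : level_surface D a p -> level_surface D a q ->
  a * chord (gauss p) (gauss q) <= chord p q.
Proof.
move=> Sp Sq; rewrite -{1}(gtr0_norm a0) -sqrtr_sqr -sqrtrM ?sqr_ge0//.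
apply: ler_wsqrtr; apply: le_trans (level_mink Sp Sq).
by rewrite lerDr; apply: boundary_spacelike; apply: retraction_boundary; [case: Sq|case: Sp].
Qed.

Lemma level_norm_gauss p q : level_surface D a p -> level_surface D a q ->
  let m := mink (q - p) (q - p) / a ^+ 2 in
  `|gauss q - gauss p| ^+ 2 <= (4 * gauss p ord0 0 ^+ 2 + 2) * (m + m ^+ 2).
Proof.
move=> Sp Sq /=; set m := _ / _; have hp := gauss_hyp Sp.1; have hq := gauss_hyp Sq.1.
have e0' := entire_spacelike hyp_entire hp hq; rewrite /= in e0'.
have em : mink (gauss q - gauss p) (gauss q - gauss p) <= m.
  rewrite ler_pdivlMr ?exprn_gt0// mulrC; apply: le_trans (level_mink Sp Sq).
  by rewrite lerDr; apply: boundary_spacelike; apply: retraction_boundary; [case: Sq|case: Sp].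
apply: le_trans (hyp_norm_le hp hq) _; apply: ler_wpM2l.
  by rewrite addr_ge0// mulr_ge0// sqr_ge0.
by apply: lerD => //; rewrite ler_sqr ?nnegrE// (le_trans e0').
Qed.
End Level.
End Retraction.

Lemma differentiable_eps {R : realType} {V W : normedModType R} (f : V -> W) x
    (df : {linear V -> W}) : continuous df ->
  (forall e, 0 < e -> exists2 d, 0 < d &
    forall h, `|h| < d -> `|f (h + x) - f x - df h| <= e * `|h|) ->
  differentiable f x /\ 'd f x = df :> (V -> W).
Proof.
move=> cdf h; have E : f \o shift x = cst (f x) + df +o_ 0 id.
  apply/eqaddoP => e e0'; have [d d0 hd] := h e e0'.
  apply/nbhs_ballP; exists d => //= y; rewrite -ball_normE /ball_ /= sub0r normrN => /hd.
  by rewrite !fctE /= opprD addrA.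
have dE := diff_unique cdf E; split=> //.
by apply/diff_locallyP; rewrite dE.
Qed.

(** * C^1 regularity of the cosmological time and its level surfaces *)

Section LevelSurfaces.
Context {R : realType} {n : nat}.
Local Notation V := 'cV[R]_n.+1.
Implicit Types (p q r v w x y z N : V).

Lemma cvg_height {S : Type} (F : set_system S) {FF : Filter F} (f g : S -> V) v w (a : R) :
  f @ F --> v -> g @ F --> w ->
  f s ord0 0 + Num.sqrt (a ^+ 2 + sdot (g s) (g s)) @[s --> F] -->
  v ord0 0 + Num.sqrt (a ^+ 2 + sdot w w).
Proof.
move=> fv gw; apply: cvgD; first exact: cvg_coord.
apply: continuous_cvg; first exact: sqrt_continuous.
by apply: cvgD; [exact: cvg_cst|exact: cvg_sdot].
Qed.

Lemma cvg_quad {S : Type} (F : set_system S) {FF : Filter F} (f g : S -> V) v w (b C : R) :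
  f @ F --> v -> g @ F --> w ->
  (let m := mink (f s) (g s) / b in C * (m + m ^+ 2)) @[s --> F] -->
  (let m := mink v w / b in C * (m + m ^+ 2)).
Proof.
move=> fv gw /=; have h : mink (f s) (g s) / b @[s --> F] --> mink v w / b.
  by apply: cvgMl; exact: cvg_mink.
by apply: cvgMr; apply: cvgD => //; rewrite expr2; apply: cvgM.
Qed.

Lemma cvg_at_eps {W : normedModType R} (f : V -> W) x (l : W) :
  (forall e, 0 < e -> exists2 d, 0 < d & forall y, `|y - x| < d -> `|f y - l| <= e) ->
  f y @[y --> x] --> l.
Proof.
move=> h A /nbhs_ballP[e /= e0' eA]; have [d d0 hd] := h (e / 2) (divr_gt0 e0' (ltr0Sn _ _)).
apply/nbhs_ballP; exists d => //= y; rewrite mx_norm_ball /ball_ /= distrC => /hd yl.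
by apply: eA; rewrite -ball_normE /ball_ /= distrC; apply: (le_lt_trans yl); lra.
Qed.

(** The differential of the cosmological time at a point with Gauss image [N]; named so that it can
    carry a linear structure. *)
Definition neg_mink N v : R := - mink v N.

Lemma neg_mink_is_linear N : linear (neg_mink N : V -> R).
Proof. by move=> a v w; rewrite /neg_mink minkDl minkZl opprD -mulrN. Qed.

HB.instance Definition _ N := GRing.isLinear.Build R V R _ (neg_mink N) (neg_mink_is_linear N).

Lemma neg_mink_continuous N : continuous (neg_mink N).
Proof.
by move=> x; exact: (cvgN (@cvg_mink _ _ _ (nbhs x) _ id (cst N) x N cvg_id (cvg_cst _))).
Qed.

Variables (D : set V) (G : set (V * R)).
Hypothesis DG : null_domain D G.

Local Notation ret := (retraction D).
Local Notation T := (cosmological_time D).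
Local Notation N := (gauss D).

(** Monotonicity bounds the Minkowski square [m] of the increment of N by [b y], where [y] is its
    norm; [hyp_norm_le] bounds y^2 by C (m + m^2), and division by y leaves y <= 2 C b. *)
Lemma gauss_continuous p : D p -> forall e, 0 < e -> exists2 d, 0 < d &
  forall q, D q -> `|q - p| < d -> `|N q - N p| <= e.
Proof.
move=> Dp e e0'; have hp := gauss_hyp DG Dp; have Tp := ctime_gt0 DG Dp.
(* [b] is such that C b^2 <= 1/2, which absorbs the quadratic term, and 2 C b <= e. *)
pose C := 4 * N p ord0 0 ^+ 2 + 2; pose b := Order.min 1 e / (2 * C).
have C2 : 2 <= C by rewrite /C lerDr mulr_ge0// sqr_ge0.
have m0 : 0 < Order.min 1 e by rewrite lt_min ltr01.
have b0 : 0 < b by rewrite divr_gt0// mulr_gt0//; lra.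
have bC : b * (2 * C) = Order.min 1 e by rewrite divfK// gt_eqF//; lra.
have b1 : b * (2 * C) <= 1 by rewrite bC ge_min lexx.
have be : b * (2 * C) <= e by rewrite bC ge_min lexx orbT.
have n0 : 0 < n.+1%:R :> R by rewrite ltr0n.
exists (b * T p / (2 * n.+1%:R)); first by apply: divr_gt0; apply: mulr_gt0.
move=> q Dq; rewrite ltr_pdivlMr ?mulr_gt0// => hq.
have hNq := gauss_hyp DG Dq; have Tq := ctime_gt0 DG Dq.
have mono := gauss_monotone DG Dp Dq.
have nrm := hyp_norm_le hp hNq.
have mE : - mink (N p) (N q) - 1 = mink (N q - N p) (N q - N p) / 2.
  move: hp.1 hNq.1; move: (N p) (N q) => P Q PP QQ.
  by rewrite !mink_lin PP QQ (minkC Q P); field.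
have mge : 0 <= mink (N q - N p) (N q - N p).
  by have := hyp_mink_le hp hNq; lra.
rewrite mE in mono; have pair := le_trans (ler_norm _) (mink_le (q - p) (N q - N p)).
move: mono nrm mge pair; rewrite -/C.
set m := mink (N q - N p) _; set y := `|N q - N p|; set d := `|q - p| in hq *.
move=> mono nrm mge pair.
have y0 : 0 <= y by exact: normr_ge0.
have d0 : 0 <= d by exact: normr_ge0.
have mb : m <= b * y.
  have : T p * m <= T p * (b * y); last by rewrite ler_pM2l.
  have h1 : T p * m <= 2 * (n.+1%:R * (d * y)) by nra.
  apply: le_trans h1 _.
  by have := ler_wpM2r y0 (ltW hq); lra.
have [->|yn0] := eqVneq y 0; first exact: ltW.
have yp : 0 < y by rewrite lt_def yn0.
have h2 : y ^+ 2 <= C * (b * y + (b * y) ^+ 2).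
  apply: le_trans nrm _; apply: ler_wpM2l; first by lra.
  by apply: lerD => //; rewrite ler_sqr ?nnegrE// (le_trans mge).
have h3 : y <= C * b + C * b ^+ 2 * y.
  by rewrite -(ler_pM2r yp); move: h2; lra.
have h4 : C * b ^+ 2 <= 1 / 2 by nra.
have : C * b ^+ 2 * y <= 1 / 2 * y by rewrite ler_wpM2r.
lra.
Qed.

(** The supergradient inequalities at both points enclose the increment of T; the bounds differ by
    <h, N(p + h) - N(p)>, which is o(h) by continuity of the Gauss map. *)
Lemma ctime_differentiable (a : R) p : D p ->
  differentiable (fun x => T x - a) p /\
  'd (fun x => T x - a) p = neg_mink (N p) :> (V -> R).
Proof.
move=> Dp; apply: (@differentiable_eps R _ _ (fun x => T x - a) p (neg_mink (N p))); first exact: neg_mink_continuous.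
move=> e e0'; have n0 : 0 < n.+1%:R :> R by rewrite ltr0n.
have [d d0 hd] := gauss_continuous Dp (divr_gt0 e0' n0).
have := null_domain_open DG; rewrite openE => /(_ p Dp) /nbhs_ballP[d' /= d'0 hd'].
exists (Order.min d d'); first by rewrite lt_min d0.
move=> h; rewrite lt_min => /andP[hlt hlt'].
have Dq : D (h + p).
  by apply: hd'; rewrite mx_norm_ball /ball_ /= opprD addrCA subrr addr0 normrN.
have hN : `|N (h + p) - N p| <= e / n.+1%:R by apply: hd => //; rewrite addrK.
have h1 := ctime_support DG Dp Dq; have h2 := ctime_support DG Dq Dp.
have pE : p - (h + p) = - h by rewrite opprD addrCA subrr addr0.
rewrite addrK in h1; rewrite pE minkNl opprK in h2.
have /ler_normlP[b1 b2] := mink_le h (N (h + p) - N p).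
rewrite minkDr minkNr in b1 b2.
have b3 : n.+1%:R * (`|h| * `|N (h + p) - N p|) <= e * `|h|.
  rewrite mulrCA mulrC; apply: ler_wpM2r => //.
  by rewrite mulrC -ler_pdivlMr.
rewrite /neg_mink ler_norml; apply/andP; split; lra.
Qed.

Lemma level_C1 (a : R) : 0 < a -> C1_spacelike_hypersurface (level_surface D a).
Proof.
move=> a0 p [Dp Tp]; exists D, (fun x => T x - a).
have dE := ctime_differentiable a.
split.
- by split=> //; exact: (null_domain_open DG).
- move=> x Dx; split; first exact: (dE x Dx).1.
  move=> v; have E z : D z -> 'd (fun x => T x - a) z v = - mink v (N z).
    by move=> Dz; have /(congr1 (@^~ v)) := (dE z Dz).2.
  rewrite /prop_for /continuous_at; apply: cvg_at_eps => e e0'.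
  have k0 : 0 < n.+1%:R * (`|v| + 1) by rewrite mulr_gt0// ltr_wpDl.
  have [d d0 hd] := gauss_continuous Dx (divr_gt0 e0' k0).
  have := null_domain_open DG; rewrite openE => /(_ x Dx) /nbhs_ballP[d' /= d'0 hd'].
  exists (Order.min d d'); first by rewrite lt_min d0.
  move=> y; rewrite lt_min => /andP[yd yd'].
  have Dy : D y by apply: hd'; rewrite mx_norm_ball /ball_ /= distrC.
  rewrite [X in `|X - _|](E y Dy) [X in `|_ - X|](E x Dx). rewrite opprK addrC -minkNr -minkDr; apply: le_trans (mink_le _ _) _.
  rewrite distrC; have := hd y Dy yd; rewrite ler_pdivlMr//.
  by have := mulr_ge0 (ler0n R n.+1) (normr_ge0 (N y - N x)); lra.
- move=> x Dx; exists (N x); rewrite [X in X <> _](_ : _ = 1).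
    by apply/eqP; rewrite oner_eq0.
  have /(congr1 (@^~ (N x))) /= -> := (dE x Dx).2.
  by rewrite /neg_mink (gauss_hyp DG Dx).1 opprK.
- apply/seteqP; split=> x.
    by move=> [[_ <-] Dx]; split=> //; rewrite subrr.
  by move=> [Dx /eqP]; rewrite subr_eq0 => /eqP.
- move=> x [[Dx _] _] v v0 dv.
  have /eqP : - mink v (N x) = 0 by have /(congr1 (@^~ v)) := (dE x Dx).2; rewrite dv => /esym.
  rewrite oppr_eq0 minkC => /eqP vN.
  have ft := hyp_ft (gauss_hyp DG Dx).
  rewrite lt_def (ft_orth_ge0 ft vN) andbT; apply/eqP => vv.
  by apply: v0; apply: (ft_orth_eq0 ft vN); rewrite vv.
Qed.

Lemma level_entire (a : R) : 0 < a -> entire_surface (level_surface D a) N.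
Proof.
move=> a0; split.
- by move=> p [Dp _]; exact: (gauss_hyp DG Dp).
- move=> p q [Dp Tp] [Dq Tq]; have := ctime_support DG Dp Dq.
  by rewrite Tp Tq subrr oppr_ge0.
- move=> x; have [d Dd] := null_domain_nonempty DG.
  (* The level surface is the lower envelope of the hyperboloids r + a H^n over the closed domain:
     [f r] is the height at which the vertical line through [x] meets one of them, and its minimum
     over [r] gives the point sought. *)
  pose f r := r ord0 0 + Num.sqrt (a ^+ 2 + sdot (x - r) (x - r)).
  have fs r : 0 <= a ^+ 2 + sdot (x - r) (x - r) by rewrite addr_ge0 ?sqr_ge0// sdot_ge0.
  have tE s r : (x + (s - x ord0 0) *: e0 - r) ord0 0 = s - r ord0 0.
    by rewrite !mxE !eqxx mulr1; ring.
  have mE s r : mink (x + (s - x ord0 0) *: e0 - r) (x + (s - x ord0 0) *: e0 - r) =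
      - (s - r ord0 0) ^+ 2 + sdot (x - r) (x - r).
    rewrite minkE tE -expr2; congr (_ + _).
    by rewrite addrAC !(sdotDl, sdotDr, sdotZl, sdotZr) !(sdotC e0) !sdot_e0; ring.
  have fft r s : f r <= s -> future_timelike (x + (s - x ord0 0) *: e0 - r).
    rewrite /f -lerBrDl => h; have q0 := sqrtr_ge0 (a ^+ 2 + sdot (x - r) (x - r)).
    have q1 : 0 < Num.sqrt (a ^+ 2 + sdot (x - r) (x - r)).
      by rewrite sqrtr_gt0 ltr_wpDr ?sdot_ge0// exprn_gt0.
    split; last by rewrite tE; lra.
    rewrite mE; have : a ^+ 2 + sdot (x - r) (x - r) <= (s - r ord0 0) ^+ 2.
      by rewrite -(sqr_sqrtr (fs r)) ler_sqr ?nnegrE//; lra.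
    by have := exprn_gt0 2 a0; lra.
  have cf : continuous f.
    have c1 : continuous (fun r : V => x - r).
      by move=> r; apply: (@continuousB _ _ _ (cst x) id) => //; exact: cst_continuous.
    move=> r; exact: (@cvg_height _ (nbhs (r : V)) (nbhs_filter (r : V)) id _ r _ a cvg_id (c1 r)).
  (* A first point of intersection: only those [r] in its past can lower the height, and they range
     over a compact set. *)
  pose P := x + (f d - x ord0 0) *: e0.
  have K0 : (closure D `&` [set q | future_causal (P - q)]) !=set0.
    by exists d; split; [exact: domain_closure|exact/ft_fc/fft].
  have [r /set_mem[clr fr] rmin] :=
    compact_EVT_min K0 (past_compact DG (p := P)) (continuous_subspaceT cf).
  have {fr} rd : f r <= f d.
    by apply: rmin; apply: mem_set; split; [exact: domain_closure|exact/ft_fc/fft].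
  exists (f r - x ord0 0); set p := x + _.
  have Dp : D p.
    by have := closure_domain_ft DG clr (fft r (f r) (lexx _)); rewrite addrC subrK.
  split=> //; have [_ [ww w0] rmax] := retractionP DG Dp.
  have clret := retraction_closure DG Dp.
  have ldr : lorentz_dist p r = a.
    rewrite /lorentz_dist mE /f addrAC subrr add0r sqr_sqrtr//.
    by rewrite opprD opprK addrK sqrtr_sqr gtr0_norm.
  apply/eqP; rewrite eq_le; apply/andP; split; last first.
    by rewrite -ldr; apply: rmax => //; exact/ft_fc/fft.
  rewrite /cosmological_time /lorentz_dist -(gtr0_norm a0) -sqrtr_sqr; apply: ler_wsqrtr.
  have retK : f r <= f (ret p).
    apply: rmin; apply: mem_set; split=> //=.
    have -> : P - ret p = (p - ret p) + (f d - f r) *: e0.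
      by rewrite /P /p; apply/matrixP => i j; rewrite !mxE; ring.
    by apply: fcD => //; apply: fcZ; [rewrite subr_ge0|exact/ft_fc/ft_e0].
  move: w0; rewrite mE tE => w0.
  have : (f r - ret p ord0 0) ^+ 2 <= a ^+ 2 + sdot (x - ret p) (x - ret p).
    rewrite -(sqr_sqrtr (fs (ret p))) ler_sqr ?nnegrE ?sqrtr_ge0//.
    by rewrite lerBlDl.
  lra.
- move=> p Sp e e0'; pose C := 4 * N p ord0 0 ^+ 2 + 2.
  pose g q := let m := mink (q - p) (q - p) / a ^+ 2 in C * (m + m ^+ 2).
  have gc : g q @[q --> p] --> g p.
    have c1 : continuous (fun q : V => q - p).
      by move=> q; apply: (@continuousB _ _ _ id (cst p)) => //; exact: cst_continuous.
    exact: (@cvg_quad _ (nbhs (p : V)) (nbhs_filter (p : V)) _ _ _ _ (a ^+ 2) C (c1 p) (c1 p)).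
  have gp : g p = 0 by rewrite /g subrr mink0l mul0r expr0n addr0 mulr0.
  rewrite gp in gc; have /cvgrPdist_le /(_ (e ^+ 2)) := gc.
  rewrite exprn_gt0// => /(_ isT) /nbhs_ballP[d /= d0 hd]; exists d => // q Sq qd.
  have := hd q; rewrite mx_norm_ball /ball_ /= distrC => /(_ qd); rewrite sub0r normrN => h.
  apply: le_of_sqr; first exact: ltW.
  by apply: le_trans (level_norm_gauss DG a0 Sp Sq) _; apply: le_trans h; exact: ler_norm.
Qed.
End LevelSurfaces.

(** * The affine action on surfaces and domains *)

Section AffineIsometries.
Context {R : realType} {n : nat}.
Local Notation V := 'cV[R]_n.+1.
Local Notation Mat := 'M[R]_n.+1.
Implicit Types (p q r v w x y z : V) (c : R -> V) (g h : Mat).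

Lemma mulmx_norm_le g : exists2 k, 0 <= k & forall v, `|g *m v| <= k * `|v|.
Proof.
exists (\sum_i \sum_j `|g i j|) => [|v].
  by apply: sumr_ge0 => i _; apply: sumr_ge0.
apply: norm_le_coord => [|i].
  by rewrite mulr_ge0// sumr_ge0// => i _; apply: sumr_ge0.
rewrite mxE; apply: le_trans (ler_norm_sum _ _ _) _.
apply: (@le_trans _ _ ((\sum_j `|g i j|) * `|v|)).
  rewrite big_distrl; apply: ler_sum => j _ /=.
  by rewrite normrM; apply: ler_wpM2l => //; exact: time_le_norm.
apply: ler_wpM2r => //; rewrite [leRHS](bigD1 i)//= lerDl.
by apply: sumr_ge0 => j _; apply: sumr_ge0.
Qed.

Section AffineMap.
Variables (g : Mat) (b : V).
Hypothesis gmink : forall v w, mink (g *m v) (g *m w) = mink v w.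

Local Notation phi := (fun x => g *m x + b).

Lemma affine_chord p q : chord (phi p) (phi q) = chord p q.
Proof. by rewrite /chord opprD addrACA subrr addr0 -mulmxBr gmink. Qed.

Lemma affine_derivable c (t : R) : derivable c t 1 ->
  derivable (phi \o c) t 1 /\ derive1 (phi \o c) t = g *m derive1 c t.
Proof.
move=> dc; have [k k0 hk] := mulmx_norm_le g.
have /derivable_epsP hd := conj dc (erefl (derive1 c t)).
apply/derivable_epsP => e e0'.
have k1 : 0 < k + 1 by lra.
have [d d0 hd'] := hd (e / (k + 1)) (divr_gt0 e0' k1).
exists d => // h /hd' hh.
have -> : (phi \o c) (h + t) - (phi \o c) t - h *: (g *m derive1 c t) =
    g *m (c (h + t) - c t - h *: derive1 c t).
  by rewrite /= !mulmxBr -scalemxAr opprD addrACA subrr addr0.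
apply: le_trans (hk _) _; apply: le_trans (ler_wpM2l k0 hh) _.
rewrite mulrA; apply: ler_wpM2r => //.
by rewrite mulrCA ler_piMr ?(ltW e0')// ler_pdivrMr// mul1r; lra.
Qed.

Lemma affine_C1_on (s t : R) c : C1_on s t c -> C1_on s t (phi \o c).
Proof.
move=> [f [f1 f2 f3]]; exists (phi \o f); split.
- by move=> u; have [] := affine_derivable (f1 u).
- have -> : derive1 (phi \o f) = fun u => g *m derive1 f u.
    by apply/funext => u; have [] := affine_derivable (f1 u).
  move=> u; have [k k0 hk] := mulmx_norm_le g; have k1 : 0 < k + 1 by lra.
  apply/cvgrPdist_le => e e0'.
  have /cvgrPdist_le /(_ (e / (k + 1)) (divr_gt0 e0' k1)) := f2 u.
  apply: filterS => s' h; rewrite -mulmxBr; apply: le_trans (hk _) _.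
  apply: le_trans (ler_wpM2l k0 h) _.
  by rewrite mulrCA ler_piMr ?(ltW e0')// ler_pdivrMr// mul1r; lra.
- by move=> u hu /=; rewrite f3.
Qed.

Lemma affine_piecewise_C1 c : piecewise_C1 c -> piecewise_C1 (phi \o c).
Proof.
by move=> [s hs hc]; exists s => // i si; apply: affine_C1_on; exact: hc.
Qed.

(** Chord sums are preserved exactly, and lengths are their limits. *)
Lemma affine_path_length c : piecewise_C1 c -> path_length (phi \o c) = path_length c.
Proof.
move=> hc; have L1 := chord_sum_cvg (piecewise_C1_lipschitz hc).
have := chord_sum_cvg (piecewise_C1_lipschitz (affine_piecewise_C1 hc)).
have -> : (fun m => (chord_sum (phi \o c) m)%:E) = (fun m => (chord_sum c m)%:E).
  by apply/funext => m; congr (_%:E); apply: eq_bigr => i _; exact: affine_chord.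
move=> L2; apply: (cvg_unique _ L2); first exact: ereal_hausdorff.
exact: L1.
Qed.

Lemma affine_riemannian_dist_le (S : set V) x y : (forall p, S p -> S (phi p)) ->
  (riemannian_dist S (phi x) (phi y) <= riemannian_dist S x y)%E.
Proof.
move=> Sphi; apply: le_ereal_inf_tmp => _ [c [hc cS c0 c1] <-].
rewrite -affine_path_length//; apply: ereal_inf_lbound; exists (phi \o c) => //; split.
- exact: affine_piecewise_C1.
- by move=> t /cS /Sphi.
- by rewrite /= c0.
- by rewrite /= c1.
Qed.
End AffineMap.

Section Group.
Variables (Gamma : set Mat) (tau : Mat -> V).
Hypotheses (hGamma : is_subgroup_of Gamma SO_plus) (htau : cocycle Gamma tau).

Local Notation phi := (affine_action tau).

Lemma Gamma_mink g v w : Gamma g -> mink (g *m v) (g *m w) = mink v w.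
Proof. by case: hGamma => sub _ _ _ /sub[]. Qed.

Lemma Gamma_ft g v : Gamma g -> future_timelike v -> future_timelike (g *m v).
Proof. by case: hGamma => sub _ _ _ /sub[_ _]; apply. Qed.

Lemma GammaV g : Gamma g -> Gamma g^-1.
Proof. by case: hGamma => _ _ _; apply. Qed.

Lemma Gamma_unit g : Gamma g -> g \is a GRing.unit.
Proof. by case: hGamma => sub _ _ _ /sub[dg _ _]; rewrite -[_ \is a _]/(g \in unitmx) unitmxE dg unitr1. Qed.

Lemma GammamulV g x : Gamma g -> g *m (g^-1 *m x) = x.
Proof. by move=> /Gamma_unit gu; rewrite mulmxA -[_ *m g^-1]/(g * g^-1) mulrV// mul1mx. Qed.

Lemma tau1 : tau 1 = 0.
Proof.
case: hGamma => _ G1 _ _; have := htau G1 G1; rewrite mulr1 mul1mx => /eqP.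
by rewrite -subr_eq0 opprD addrA subrr sub0r oppr_eq0 => /eqP.
Qed.

Lemma affine_actionK g x : Gamma g -> phi g (phi g^-1 x) = x.
Proof.
move=> Gg; rewrite /affine_action mulmxDr GammamulV// -addrA (addrC (g *m _)).
by rewrite -htau ?mulrV ?Gamma_unit ?tau1 ?addr0//; exact: GammaV.
Qed.

Lemma affine_actionB g x y : phi g x - phi g y = g *m (x - y).
Proof. by rewrite /affine_action opprD addrACA subrr addr0 mulmxBr. Qed.

Lemma stable_invariant (S : set V) :
  (forall g p, Gamma g -> S p -> S (phi g p)) -> invariant_under Gamma phi S.
Proof.
move=> h g Gg; apply/seteqP; split=> [_ [p Sp <-]|p Sp]; first exact: h.
by exists (phi g^-1 p); [apply: h => //; exact: GammaV|exact: affine_actionK].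
Qed.

Lemma stable_isometries (S : set V) :
  (forall g p, Gamma g -> S p -> S (phi g p)) ->
  acts_by_isometries Gamma phi S (riemannian_dist S).
Proof.
move=> h; split; first exact: stable_invariant.
move=> g Gg x y _ _; apply/eqP; rewrite eq_le; apply/andP; split.
  apply: affine_riemannian_dist_le => [v w|p]; first exact: Gamma_mink.
  exact: h.
have := @affine_riemannian_dist_le g^-1 (tau g^-1) (fun v w => Gamma_mink v w (GammaV Gg))
  S (phi g x) (phi g y) (fun p => h _ p (GammaV Gg)).
have K z : g^-1 *m phi g z + tau g^-1 = z.
  have := affine_actionK z (GammaV Gg).
  by rewrite invrK.
by rewrite !K.
Qed.

Section InvariantDomain.
Variables (D : set V) (F : set (V * R)).
Hypotheses (DF : null_domain D F) (hinv : invariant_under Gamma phi D).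

Lemma domain_stable g x : Gamma g -> D x -> D (phi g x).
Proof. by move=> Gg Dx; rewrite -(hinv Gg); exists x. Qed.

(** Stated for any timelike direction because the action turns the vertical ray from a point of the
    closure into a ray along [g *m e0]. *)
Lemma closure_domain_ray x w : future_timelike w ->
  (forall s, 0 < s -> D (x + s *: w)) -> closure D x.
Proof.
move=> hw h; apply/(closure_domainE DF) => v k Fv.
rewrite leNgt; apply/negP => kv.
have k0 : 0 < `|mink v w| + 1 by rewrite ltr_wpDl.
pose s := (mink v x - k) / (`|mink v w| + 1).
have s0 : 0 < s by rewrite divr_gt0// subr_gt0.
have /(null_domainE DF) /(_ v k Fv) := h s s0; rewrite !mink_lin.
have : s * (`|mink v w| + 1) = mink v x - k by rewrite divfK// gt_eqF.
have := ler_wpM2l (ltW s0) (ler_norm (- mink v w)); rewrite normrN; lra.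
Qed.

Lemma closure_domain_stable g x : Gamma g -> closure D x -> closure D (phi g x).
Proof.
move=> Gg clx; apply: (closure_domain_ray (Gamma_ft Gg ft_e0)) => s s0.
have -> : phi g x + s *: (g *m e0) = phi g (x + s *: e0).
  by rewrite /affine_action mulmxDr -scalemxAr addrAC.
by apply: domain_stable => //; apply: (closure_domain_ft DF clx); exact: (ftZ s0 ft_e0).
Qed.

(** The translate of [retraction D p] satisfies the characterization in [retraction_unique], which
    isometries preserve. *)
Lemma retraction_equivariant g p : Gamma g -> D p ->
  retraction D (phi g p) = phi g (retraction D p).
Proof.
move=> Gg Dp; apply: (retraction_unique DF).
- exact: domain_stable.
- by apply: (closure_domain_stable Gg); exact: (retraction_closure DF Dp).
- by rewrite affine_actionB; apply: (Gamma_ft Gg); exact: (retraction_ft DF Dp).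
- move=> x Dx; have := domain_stable (GammaV Gg) Dx => Dx'.
  rewrite -(affine_actionK x Gg) !affine_actionB Gamma_mink//.
  by apply: (retraction_support DF Dp); exact: domain_closure.
Qed.

Lemma ctime_invariant g p : Gamma g -> D p ->
  cosmological_time D (phi g p) = cosmological_time D p.
Proof.
move=> Gg Dp; rewrite /cosmological_time /lorentz_dist retraction_equivariant//.
by rewrite affine_actionB Gamma_mink.
Qed.

Lemma gauss_equivariant g p : Gamma g -> D p -> gauss D (phi g p) = g *m gauss D p.
Proof.
move=> Gg Dp; rewrite /gauss ctime_invariant// retraction_equivariant// affine_actionB.
by rewrite scalemxAr.
Qed.

Lemma level_stable (a : R) g p : Gamma g -> level_surface D a p -> level_surface D a (phi g p).
Proof.
by move=> Gg [Dp Tp]; split; [exact: domain_stable|rewrite ctime_invariant].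
Qed.
End InvariantDomain.
End Group.
End AffineIsometries.

(** * Orbits of timelike vectors under a cocompact group *)

Section Cocompact.
Local Open Scope quotient_scope.
Context {R : realType} {n : nat}.
Local Notation V := 'cV[R]_n.+1.
Local Notation Mat := 'M[R]_n.+1.
Implicit Types (p q r v w x y z : V) (g h : Mat).

Section Group.
Variables (Gamma : set Mat).
Hypotheses (hGamma : is_subgroup_of Gamma SO_plus) (hco : cocompact Gamma).

Lemma same_orbitP (x y : @hyp R n) : same_orbit Gamma x y ->
  exists2 h, Gamma h & \val x = h *m \val y.
Proof.
move=> /asboolP xy; have [_ G1 _ _] := hGamma.
have : orbit_of Gamma (\val x) (\val x) by exists 1 => //; rewrite mul1mx.
by rewrite xy => -[h Gh <-]; exists h.
Qed.

Lemma Gamma_minkV g v w : Gamma g -> mink (g *m v) w = mink v (g^-1 *m w).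
Proof. by move=> Gg; rewrite -{1}(GammamulV hGamma w Gg) (Gamma_mink hGamma). Qed.

(** The sets [U k] are open, increase with [k] and cover the compact quotient, so a single [k]
    serves all points; [UE] shows that the chosen representative does not matter. *)
Lemma orbit_cobounded z : future_timelike z ->
  exists B, forall x, hyp x -> exists2 g, Gamma g & - mink x (g *m z) <= B.
Proof.
move=> hz.
pose U (k : nat) : set (hyp_quotient Gamma) :=
  [set q | exists2 g, Gamma g & - mink (\val (repr q)) (g *m z) < k%:R].
have UE k (x : @hyp R n) : U k (\pi_(hyp_quotient Gamma) x) <->
    exists2 g, Gamma g & - mink (\val x) (g *m z) < k%:R.
  have : same_orbit Gamma (repr (\pi_(hyp_quotient Gamma) x)) x.
    by apply/eqmodP; rewrite reprK.
  move=> /same_orbitP[h Gh hE]; rewrite /U /= hE; have [_ _ Gm _] := hGamma.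
  have Gh' := GammaV hGamma Gh.
  split=> [[g Gg]|[g Gg xg]].
    rewrite Gamma_minkV// mulmxA => lt; exists (h^-1 * g) => //; exact: Gm.
  exists (h * g); first exact: Gm.
  by rewrite -mulmxA (Gamma_mink hGamma).
have oU k : [set: nat] k -> open (U k).
  move=> _.
  change (open (\pi_(hyp_quotient Gamma) @^-1` U k)).
  have -> : \pi_(hyp_quotient Gamma) @^-1` U k = \bigcup_(g in Gamma)
      ((fun x : @hyp R n => \val x) @^-1` [set x | - mink x (g *m z) < k%:R]).
    by apply/seteqP; split=> x /=; rewrite UE => -[g Gg ?]; exists g.
  apply: bigcup_open => g Gg.
  exists [set x | - mink x (g *m z) < k%:R] => //.
  have -> : [set x | - mink x (g *m z) < k%:R] = ~` [set x | mink (g *m z) x <= - k%:R].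
    apply/seteqP; split=> x /=; rewrite minkC.
      by move=> h; apply/negP; rewrite -ltNge; lra.
    by move/negP; rewrite -ltNge; lra.
  by rewrite openC; exact: closed_mink_le.
have /compact_near_coveringP nc : compact [set: hyp_quotient Gamma] := hco.
have [] := nc nat \oo U _ _.
  move=> q _; have [_ G1 _ _] := hGamma.
  pose k := Num.bound (- mink (\val (repr q)) z).
  have qk : U k q.
    exists 1 => //; rewrite mul1mx; apply: le_lt_trans (ler_norm _) _.
    by have := @archi_boundP R _ (normr_ge0 (- mink (\val (repr q)) z)); rewrite /Num.bound normr_id.
  exists (U k, [set j | (k <= j)%N]) => /=.
    split; last by exists k.
    by apply: open_nbhs_nbhs; split=> //; exact: oU.
  move=> [q' j] /= [[g Gg lt] kj]; exists g => //; apply: lt_le_trans lt _.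
  by rewrite ler_nat.
move=> k _ hk; exists k%:R => x hx.
pose X : @hyp R n := exist _ x (mem_set hx).
have /UE[g Gg lt] := hk k (leqnn k) (\pi_(hyp_quotient Gamma) X) I.
by exists g => //; exact: ltW.
Qed.

(** For spacelike [v], follow a geodesic of H^n that leaves the hyperplane orthogonal to [v] in the
    direction of [v]: an orbit point within the uniform bound of a point [y] far along it must be on
    the positive side. *)
Lemma orbit_positive z v : future_timelike z -> v <> 0 -> ~ future_causal v ->
  exists2 g, Gamma g & 0 < mink v (g *m z).
Proof.
move=> hz v0 nfc; have [vv|vv] := leP (mink v v) 0.
  have [_ G1 _ _] := hGamma; exists 1 => //; rewrite mul1mx.
  case: (fc_or vv) => // fv; have := ft_fc_mink_lt0 hz fv.
  rewrite minkNr oppr_lt0 minkC; apply=> /eqP; rewrite oppr_eq0 => /eqP; exact: v0.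
have [B hB] := orbit_cobounded hz.
(* A positive multiple of the projection of [e0] to the complement of [v], hence timelike. *)
pose u := v ord0 0 *: v + mink v v *: e0.
have uv : mink u v = 0 by rewrite !mink_lin (minkC e0) mink_e0; ring.
have hu : future_timelike u.
  have tu : u ord0 0 = v ord0 0 ^+ 2 + mink v v by rewrite !mxE !eqxx mulr1.
  split; last by rewrite tu ltr_wpDl ?sqr_ge0.
  have -> : mink u u = - (v ord0 0 ^+ 2 * mink v v + mink v v ^+ 2).
    by rewrite !mink_lin (minkC e0 v) mink_e0e0 mink_e0; ring.
  by rewrite oppr_lt0 ltr_wpDl ?exprn_gt0// mulr_ge0 ?sqr_ge0// ltW.
have [x hx xv] : exists2 x, hyp x & mink x v = 0.
  by exists ((Num.sqrt (- mink u u))^-1 *: u); [exact: normalize|rewrite minkZl uv mulr0].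
pose l := Num.sqrt (- mink z z); pose s := Num.sqrt (mink v v).
have l0 : 0 < l by rewrite sqrtr_gt0 oppr_gt0; case: hz.
have s0 : 0 < s by rewrite sqrtr_gt0.
have l2 : l ^+ 2 = - mink z z by rewrite sqr_sqrtr// oppr_ge0 ltW//; case: hz.
have s2 : s ^+ 2 = mink v v by rewrite sqr_sqrtr// ltW.
(* [c] and [S] are the hyperbolic cosine and sine of the distance from [x] to [y]. By the choice of
   [S], c l >= |B| + 1 > B, against the bound at [y] if the product with [v] were not positive. *)
pose S := (`|B| + 1) / l; have S0 : 0 < S by rewrite divr_gt0// ltr_wpDl.
pose c := Num.sqrt (1 + S ^+ 2).
have c2 : c ^+ 2 = 1 + S ^+ 2 by rewrite sqr_sqrtr// addr_ge0// sqr_ge0.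
have c0 : 0 <= c by exact: sqrtr_ge0.
have cS : S <= c by apply: le_of_sqr => //; rewrite c2; lra.
pose y := c *: x + (S / s) *: v.
have yy : mink y y = -1.
  have sS : (S / s) ^+ 2 * mink v v = S ^+ 2 by rewrite -s2 -exprMn divfK// gt_eqF.
  rewrite !mink_lin (minkC v x) xv hx.1; move: c2 sS; rewrite !expr2; lra.
have xy : mink x y = - c by rewrite !mink_lin xv hx.1; ring.
have hy : hyp y.
  have cp : 0 < c by apply: lt_le_trans cS.
  have fy : future_causal y.
    case: (@fc_or _ _ y); first by rewrite yy.
      by [].
    move=> fy; have := fc_mink_le0 (ft_fc (hyp_ft hx)) fy.
    by rewrite minkNr xy opprK; lra.
  split=> //; have [_ y0] := fy; rewrite lt_neqAle y0 andbT eq_sym; apply/eqP.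
  move=> /time_eq0 yE; have : mink y y <= 0 by rewrite yy; lra.
  by move=> /yE h; move: yy; rewrite h mink0l; lra.
have [g Gg le] := hB _ hy; exists g => //.
rewrite ltNge; apply/negP => neg; have fg := Gamma_ft hGamma Gg hz.
have xg0 := fc_mink_le0 (ft_fc (hyp_ft hx)) (ft_fc fg).
have lxg : l <= - mink x (g *m z).
  apply: le_of_sqr; first by rewrite oppr_ge0.
  rewrite sqrrN l2; have := ft_revCS (g *m z) (hyp_ft hx).
  by rewrite hx.1 (Gamma_mink hGamma)// mulN1r.
have : c * l <= B.
  apply: le_trans le; rewrite minkDl !minkZl.
  have := ler_wpM2l c0 lxg; have := mulr_ge0_le0 (ltW (divr_gt0 S0 s0)) neg; lra.
have : S * l <= c * l by rewrite ler_pM2r.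
by rewrite divfK ?gt_eqF//; have := ler_norm B; lra.
Qed.
End Group.
End Cocompact.

(** * Boundedness of the retraction and surjectivity of the Gauss map *)

Section Boundedness.
Import finmap.
Context {R : realType} {n : nat}.
Local Notation V := 'cV[R]_n.+1.
Local Notation Mat := 'M[R]_n.+1.
Implicit Types (p q r v w x y z : V) (g h : Mat).

Lemma hyp_fc_norm_le x w : hyp x -> future_causal w ->
  `|w| <= 2 * x ord0 0 * - mink x w.
Proof.
move=> hx hw; have [xx x0] := hx; have [ww w0] := hw.
move: ww xx; rewrite !minkE => ww xx.
have nw := fc_norm_le hw.
set k := x ord0 0 in x0 xx *; set t := w ord0 0 in ww w0 nw *.
have sx : sdot x x = k ^+ 2 - 1 by rewrite expr2; lra.
(* i = 1/(2k) satisfies (k - i)^2 = k^2 - 1 + i^2, so k - i bounds the spatial norm of [x]. *)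
have [i ik] : exists i, 2 * k * i = 1 by exists (2 * k)^-1; rewrite divff// gt_eqF// mulr_gt0.
have sw : sdot x w <= (k - i) * t.
  have kk : (k - i) ^+ 2 = k ^+ 2 - 1 + i ^+ 2 by move: ik; rewrite !expr2; lra.
  have k1 : 1 <= k.
    by apply: le_of_sqr; [exact: ltW|rewrite expr1n; have := sdot_ge0 x; lra].
  have i1 : i <= 1 by rewrite leNgt; apply/negP => i1; nra.
  apply: le_of_sqr; first by rewrite mulr_ge0// subr_ge0; lra.
  apply: le_trans (sdot_CauchySchwarz x w) _; rewrite sx exprMn kk.
  apply: ler_pM => //; first by have := sdot_ge0 x; lra.
  - exact: sdot_ge0.
  - by rewrite lerDl sqr_ge0.
  - by rewrite expr2; lra.
have ikt : 2 * k * i * t = t by rewrite ik mul1r.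
have k2 : 0 <= 2 * k by lra.
by have := ler_wpM2l k2 sw; lra.
Qed.

Lemma closed_sphere : closed [set v : V | `|v| = 1].
Proof.
have -> : [set v : V | `|v| = 1] = (fun v : V => `|v|) @^-1` [set 1] by [].
by apply: closed_comp => [v _|]; [exact: norm_continuous|exact: closed_eq].
Qed.

Lemma closed_not_ft (u : V) : closed [set v : V | ~ future_timelike (v + u)].
Proof.
have c1 : continuous (fun v : V => v + u).
  by move=> v; apply: (@continuousD _ _ _ id (cst u)) => //; exact: cst_continuous.
have -> : [set v : V | ~ future_timelike (v + u)] =
    (fun v => mink (v + u) (v + u)) @^-1` [set t | 0 <= t] `|`
    (fun v => (v + u) ord0 0) @^-1` [set t | t <= 0].
  apply/seteqP; split=> v /=.
    move=> nf; have [h|h] := leP 0 (mink (v + u) (v + u)); [by left|right].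
    by rewrite leNgt; apply/negP => h'; apply: nf.
  by move=> [h [h1 _]|h [_ h1]]; [move: h1; rewrite ltNge h|move: h1; rewrite ltNge h].
apply: closedU; apply: closed_comp; try exact: closed_le; try exact: closed_ge.
  by move=> q _; exact: (cvg_mink (c1 q) (c1 q)).
by move=> q _; exact: (cvg_coord (c1 q)).
Qed.

Section Group.
Variables (Gamma : set Mat) (tau : Mat -> V) (D : set V) (F : set (V * R)).
Hypotheses (hGamma : is_subgroup_of Gamma SO_plus) (hco : cocompact Gamma).
Hypotheses (htau : cocycle Gamma tau) (DF : null_domain D F).
Hypothesis hinv : invariant_under Gamma (affine_action tau) D.

(** The sum of two null normals is a timelike normal bounded above on the domain; invariance carries
    this to its whole orbit, with a constant that depends on the group element. *)
Lemma support_finite : exists2 z, future_timelike z &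
  forall g, Gamma g -> exists c, forall x, closure D x -> mink x (g *m z) <= c.
Proof.
have [v1 [c1 [v2 [c2 [G1 G2 v12]]]]] := null_pair DF.
have [vv1 t1] := normal_null DF G1; have [vv2 t2] := normal_null DF G2.
exists (v1 + v2).
  split; last by rewrite mxE addr_gt0.
  by rewrite !mink_lin vv1 vv2 (minkC v2); lra.
move=> g Gg; exists (c1 + c2 + mink (tau g) (g *m (v1 + v2))) => x clx.
have := closure_domain_stable hGamma DF hinv (GammaV hGamma Gg) clx.
move=> /(closure_domainE DF) h; have h1 := h _ _ G1; have h2 := h _ _ G2.
rewrite -(affine_actionK hGamma htau x Gg); move: (affine_action tau g^-1 x) h1 h2 => y h1 h2.
rewrite /affine_action minkDl (Gamma_mink hGamma)// minkDr !(minkC y); lra.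
Qed.

(** The unit directions [v] of [r] are of two kinds. Those away from the future cone form a compact
    set, covered by finitely many conditions <v, gz> > 1/(j+1), each bounding |r| through
    [support_finite]. Near the future cone <x, v> is below a negative constant, so the lower bound
    on <r, x> limits |r|. *)
Lemma closure_bounded (k C : R) : exists M, forall r x, closure D r -> hyp x ->
  `|x| <= k -> - C <= mink r x -> `|r| <= M.
Proof.
have [z hz hc] := support_finite.
wlog k0 : k / 0 < k => [H|].
  have [M hM] := H (`|k| + 1) ltac:(by rewrite ltr_wpDl).
  exists M => r x clr hx xk; apply: hM => //; apply: le_trans xk _.
  by have := ler_norm k; lra.
(* Small enough that <x, v> <= - 1/(4k) whenever |v| = 1 and [v + e *: e0] is future timelike. *)
pose e := (4 * k * (k + 1) + 2)^-1.
have e0' : 0 < e by rewrite invr_gt0 addr_gt0// !mulr_gt0// addr_gt0.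
have eE : e * (4 * k * (k + 1) + 2) = 1.
  by rewrite mulVf// gt_eqF// -invr_gt0.
pose Be := [set v : V | `|v| = 1] `&` [set v : V | ~ future_timelike (v + e *: e0)].
have cBe : compact Be.
  apply: (@col_bounded_closed_compact _ _ _ 1); last by move=> v [/= -> _].
  by apply: closedI; [exact: closed_sphere|exact: closed_not_ft].
pose O (gj : Mat * nat) := [set v : V | gj.2.+1%:R^-1 < mink v (gj.1 *m z)].
have cov : Be `<=` cover [set gj | Gamma gj.1] O.
  move=> v [/= v1 nf].
  have vn0 : v <> 0 by move=> vE; move: v1; rewrite vE normr0 => /eqP; rewrite eq_sym oner_eq0.
  have nfc : ~ future_causal v.
    by move=> fv; apply: nf; rewrite addrC; apply: ftD => //; exact: ftZ ft_e0.
  have [g Gg gt] := orbit_positive hGamma hco hz vn0 nfc.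
  exists (g, Num.bound (mink v (g *m z))^-1) => //=.
  rewrite /O /= invf_plt ?posrE//; apply: (@lt_trans _ _ (Num.bound (mink v (g *m z))^-1)%:R).
    by apply: archi_boundP; rewrite invr_ge0 ltW.
  by rewrite ltr_nat.
have oO gj : [set gj | Gamma gj.1] gj -> open (O gj).
  move=> _; have -> : O gj = ~` [set v | mink (gj.1 *m z) v <= gj.2.+1%:R^-1].
    apply/seteqP; split=> v; rewrite /O /= minkC.
      by move=> h; apply/negP; rewrite -ltNge.
    by move/negP; rewrite -ltNge.
  by rewrite openC; exact: closed_mink_le.
move: cBe; rewrite compact_cover => /(_ _ _ O oO cov)[K KG hK].
have hcg (gj : Mat * nat) : exists c, Gamma gj.1 -> forall x, closure D x -> mink x (gj.1 *m z) <= c.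
  have [Gg|nG] := pselect (Gamma gj.1); last by exists 0.
  by have [c hc'] := hc _ Gg; exists c.
pose cc (gj : Mat * nat) : R := projT1 (cid (hcg gj)).
have ccP (gj : Mat * nat) x : Gamma gj.1 -> closure D x -> mink x (gj.1 *m z) <= cc gj.
  by move=> Gg clx; exact: (projT2 (cid (hcg gj)) Gg).
exists (\sum_(gj <- K) `|gj.2.+1%:R * cc gj| + 4 * k * `|C|) => r x clr hx xk Cr.
have S0 : 0 <= \sum_(gj <- K) `|gj.2.+1%:R * cc gj| by apply: sumr_ge0.
have kC0 : 0 <= 4 * k * `|C| by rewrite !mulr_ge0// ltW.
have [->|rn0] := eqVneq r 0; first by rewrite normr0 addr_ge0.
have r0 : 0 < `|r| by rewrite normr_gt0.
pose v := `|r|^-1 *: r; have rE : r = `|r| *: v by rewrite scalerA divff ?scale1r ?gt_eqF.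
have v1 : `|v| = 1 by rewrite normrZ normfV normr_id mulVf ?gt_eqF.
have [ft|nf] := pselect (future_timelike (v + e *: e0)); last first.
  have [gj /= gjK lt] := hK v (conj v1 nf).
  have Gg : Gamma gj.1 by have /set_mem := KG gj gjK.
  have := ccP gj r Gg clr; rewrite {1}rE minkZl => le.
  have j0 : 0 < gj.2.+1%:R :> R by rewrite ltr0n.
  have : `|r| * gj.2.+1%:R^-1 <= cc gj by apply: le_trans le; rewrite ler_pM2l// ltW.
  rewrite ler_pdivrMr// mulrC => {}le.
  apply: (@le_trans _ _ `|gj.2.+1%:R * cc gj|); first exact: le_trans (ler_norm _).
  rewrite (big_fsetD1 gj) //= -addrA lerDl addr_ge0//; apply: sumr_ge0 => //.
have [xx x0] := hx; have x0k : x ord0 0 <= k.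
  by apply: le_trans xk; apply: le_trans (time_le_norm _ _); exact: ler_norm.
have h1 := hyp_fc_norm_le hx (ft_fc ft).
have h2 : 1 - e <= `|v + e *: e0|.
  have := ler_normB (v + e *: e0) (e *: e0); rewrite addrK v1 normrZ.
  have := ler_wpM2l (normr_ge0 e) (@norm_e0 R n); rewrite mulr1 (gtr0_norm e0'); lra.
rewrite minkDr (minkZr e) mink_e0 in h1.
have h3 : - C <= `|r| * mink x v by rewrite -minkZr -rE minkC.
have vx : mink x v <= - (4 * k)^-1.
  have kp : 0 < 4 * k by rewrite mulr_gt0.
  have ki : 4 * k * (4 * k)^-1 = 1 by rewrite divff// gt_eqF.
  have : 1 - e <= 2 * k * (- mink x v + e * k).
    apply: (le_trans h2); apply: (le_trans h1).
    have nn : 0 <= - (mink x v + e * - x ord0 0).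
      by rewrite -(pmulr_rge0 _ (_ : 0 < 2 * x ord0 0)) ?mulr_gt0//; apply: le_trans h1.
    apply: ler_pM => //; first by rewrite mulr_ge0// ltW.
      by rewrite ler_pM2l.
    by rewrite opprD mulrN opprK lerD2l ler_pM2l.
  move=> h4; rewrite -(ler_pM2l kp) mulrN ki.
  have ek : e * k * k * 4 + 4 * (e * k) + 2 * e = 1 by rewrite -[RHS]eE; ring.
  have : 0 <= e * k by rewrite mulr_ge0 ?ltW.
  nra.
have : `|r| * (4 * k)^-1 <= C by have := ler_wpM2l (ltW r0) vx; lra.
rewrite ler_pdivrMr ?mulr_gt0// => h5; apply: (le_trans h5).
by have := ler_wpM2l (ltW k0) (ler_norm C); lra.
Qed.

Lemma support_attained x : hyp x ->
  exists2 r, closure D r & forall y, closure D y -> mink (y - r) x <= 0.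
Proof.
move=> hx; have [d Dd] := null_domain_nonempty DF.
have [M hM] := closure_bounded `|x| (- mink d x).
pose K := closure D `&` [set r | mink x d <= mink x r].
have cK : compact K.
  apply: (@col_bounded_closed_compact _ _ _ M).
    by apply: closedI; [exact: closed_closure|exact: closed_mink_ge].
  by move=> r [clr /= dr]; apply: (hM r x) => //; rewrite opprK minkC (minkC r).
have K0 : K !=set0 by exists d; split => //=; exact: domain_closure.
have [r /set_mem[clr dr] rmax] :=
  compact_EVT_max K0 cK (continuous_subspaceT (@mink_continuous R n x)).
exists r => // y cly; rewrite minkDl minkNl !(minkC _ x) subr_le0.
have [h|h] := leP (mink x d) (mink x y); first by apply: rmax; apply: mem_set.
exact: (le_trans (ltW h)).
Qed.

Lemma gauss_onto (a : R) x : 0 < a -> hyp x ->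
  exists2 p, level_surface D a p & gauss D p = x.
Proof.
move=> a0 hx; have [r clr hr] := support_attained hx.
have [] := level_make DF a0 clr hx (fun y Dy => hr y (domain_closure Dy)).
by move=> ? _ ?; exists (r + a *: x).
Qed.

(** A fixed point of the domain, tested in the support inequality at [p], bounds <r(p), N(p)> from
    below independently of [a]. *)
Lemma level_retraction_bounded (k : R) : exists M, forall a p, 0 < a ->
  level_surface D a p -> `|gauss D p| <= k -> `|retraction D p| <= M.
Proof.
have [d Dd] := null_domain_nonempty DF.
have [M hM] := closure_bounded k (n.+1%:R * (`|d| * k)).
exists M => a p a0 [Dp _] gk; have hx := gauss_hyp DF Dp.
apply: (hM _ (gauss D p)) => //; first exact: (retraction_closure DF Dp).
have := gauss_support DF Dp (domain_closure Dd); rewrite minkDl minkNl.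
have := mink_le d (gauss D p); rewrite ler_norml => /andP[+ _].
have : n.+1%:R * (`|d| * `|gauss D p|) <= n.+1%:R * (`|d| * k).
  by do 2 apply: ler_wpM2l => //.
lra.
Qed.

(** The set is the image under (r, x) |-> r + a x of the pairs with [x] in [K] a support normal at
    [r]; the support condition is closed and [r] is bounded. *)
Lemma level_preimage_compact (a : R) (K : set V) : 0 < a -> K `<=` hyp -> compact K ->
  compact (level_surface D a `&` [set p | K (gauss D p)]).
Proof.
move=> a0 Khyp cK.
have [k hk] : exists k, forall x, K x -> `|x| <= k.
  have [M [_ hM]] := compact_bounded cK; exists (M + 1) => x Kx.
  by apply: (hM (M + 1)) => //; rewrite ltrDl.
have [M hM] := level_retraction_bounded k.
pose A := (closure D `&` [set r | `|r| <= M]) `*` K.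
have cA : compact A.
  apply: compact_setX => //; apply: (@col_bounded_closed_compact _ _ _ M).
    apply: closedI; first exact: closed_closure.
    have -> : [set r : V | `|r| <= M] = (fun r : V => `|r|) @^-1` [set t | t <= M] by [].
    by apply: closed_comp => [v _|]; [exact: norm_continuous|exact: closed_le].
  by move=> v [].
pose B := \bigcap_(y in D) [set rx : V * V | mink (y - rx.1) rx.2 <= 0].
have cB : closed B.
  apply: closed_bigI => y _.
  have -> : [set rx : V * V | mink (y - rx.1) rx.2 <= 0] =
    (fun rx => mink (y - rx.1) rx.2) @^-1` [set t | t <= 0] by [].
  apply: closed_comp => [rx _|]; last exact: closed_le.
  apply: cvg_mink; last exact: cvg_snd.
  by apply: cvgB; [exact: cvg_cst|exact: cvg_fst].
have -> : level_surface D a `&` [set p | K (gauss D p)] =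
    (fun rx : V * V => rx.1 + a *: rx.2) @` (A `&` B).
  apply/seteqP; split=> [p [Sp Kp]|_ [[r x] [[[/= clr rM] Kx] hB] <-]].
    have Dp := Sp.1; exists (retraction D p, gauss D p) => /=; last first.
      by rewrite -(level_gaussE DF Sp).
    split; last by move=> y Dy /=; exact: (gauss_support DF Dp (domain_closure Dy)).
    split=> //=; split; first exact: (retraction_closure DF Dp).
    by apply: (hM a) => //; exact: hk.
  have [] := level_make DF a0 clr (Khyp _ Kx) hB.
  by move=> ? _ gE; split=> //=; rewrite gE.
apply: continuous_compact; last exact: compact_closedI.
apply: continuous_subspaceT => rx; apply: cvgD; first exact: cvg_fst.
by apply: cvgZr; exact: cvg_snd.
Qed.
End Group.
End Boundedness.

(** * Distances, the ambient topology and compactness *)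

Section HyperbolicDistance.
Context {R : realType} {n : nat}.
Local Notation V := 'cV[R]_n.+1.
Implicit Types (p q r v w x y z : V) (S : set V).

Lemma chord_sqr_hyp x y : hyp x -> hyp y -> chord x y ^+ 2 = - 2 * mink x y - 2.
Proof.
move=> hx hy; rewrite /chord sqr_sqrtr; last exact: (entire_spacelike hyp_entire hx hy).
by rewrite !mink_lin hx.1 hy.1 (minkC y); ring.
Qed.

(* With u the component of x orthogonal to y and k = -<y, y'>, one has
   <x, y'> = k <x, y> + <u, y' - k y>; Cauchy-Schwarz in the spacelike
   complement of y bounds the last term. *)
Lemma hyp_mink_step x y y' : hyp x -> hyp y -> hyp y' ->
  - mink x y' <= - mink x y * (1 + chord y y' + chord y y' ^+ 2).
Proof.
move=> hx hy hy'; have c2 := chord_sqr_hyp hy hy'.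
have := chord_ge0 y y'; move: (chord y y') c2 => c c2 c0.
have Fge := hyp_mink_le hx hy; have kge := hyp_mink_le hy hy'.
have [[xx _] [yy _] [y'y' _]] := And3 hx hy hy'.
have cs := @hyp_orth_CS _ _ y (x + mink x y *: y) (y' + mink y y' *: y) hy.
have o1 : mink y (x + mink x y *: y) = 0.
  by rewrite minkDr minkZr yy (minkC y x); ring.
have o2 : mink y (y' + mink y y' *: y) = 0 by rewrite minkDr minkZr yy; ring.
have {cs} := cs o1 o2.
have e1 : mink (x + mink x y *: y) (x + mink x y *: y) = mink x y ^+ 2 - 1.
  by rewrite !mink_lin xx yy (minkC y x); ring.
have e2 : mink (y' + mink y y' *: y) (y' + mink y y' *: y) = mink y y' ^+ 2 - 1.
  by rewrite !mink_lin y'y' yy (minkC y' y); ring.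
have e3 : mink (x + mink x y *: y) (y' + mink y y' *: y) = mink x y' + mink x y * mink y y'.
  by rewrite !mink_lin yy; ring.
rewrite e1 e2 e3; move: (mink x y) (mink y y') (mink x y') Fge kge c2 => F k X Fge kge c2 cs.
have kE : k = - (1 + c ^+ 2 / 2) by lra.
have h : - X - F * k <= - F * (c + c ^+ 2 / 2).
  apply: le_of_sqr; first by rewrite mulr_ge0//; [lra|have := sqr_ge0 c; lra].
  have -> : (- X - F * k) ^+ 2 = (X + F * k) ^+ 2 by ring.
  apply: (le_trans cs); rewrite kE exprMn sqrrN sqrrN.
  have -> : (1 + c ^+ 2 / 2) ^+ 2 - 1 = c ^+ 2 + (c ^+ 2) ^+ 2 / 4 by field.
  apply: ler_pM.
  - by rewrite subr_ge0; nra.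
  - by have := sqr_ge0 c; have := sqr_ge0 (c ^+ 2); lra.
  - by lra.
  - have -> : (c + c ^+ 2 / 2) ^+ 2 = c ^+ 2 + (c ^+ 2) ^+ 2 / 4 + c * c ^+ 2 by field.
    by rewrite lerDl mulr_ge0 ?sqr_ge0.
rewrite kE in h; lra.
Qed.

(** - <x, .> is the hyperbolic cosine of the distance from [x]; an edge with chord c multiplies it
    by at most 1 + c + c^2 <= exp(2c). The rate 2 is not sharp, but only the topology of the
    distance is at stake. *)
Lemma hyp_mink_chain x m (r : nat -> V) : hyp x -> (forall i, (i <= m)%N -> hyp (r i)) ->
  - mink x (r m) <= - mink x (r 0%N) * expR (2 * \sum_(i < m) chord (r i) (r i.+1)).
Proof.
move=> hx; elim: m => [|m IHm] hr; first by rewrite big_ord0 mulr0 expR0 mulr1.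
have {}IHm := IHm (fun i im => hr i (leqW im)).
rewrite big_ord_recr /= mulrDr expRD mulrA.
apply: (le_trans (hyp_mink_step hx (hr m (leqnSn m)) (hr m.+1 (leqnn _)))).
have c0 := chord_ge0 (r m) (r m.+1); move: (chord (r m) (r m.+1)) c0 => c c0.
apply: ler_pM => //.
- by have := hyp_mink_le hx (hr m (leqnSn m)); lra.
- by have := sqr_ge0 c; lra.
have -> : expR (2 * c) = expR c * expR c by rewrite -expRD; congr expR; ring.
have e1 := expR_ge1Dx c.
apply: (@le_trans _ _ ((1 + c) * (1 + c))); first by nra.
by apply: ler_pM => //; lra.
Qed.

Lemma hyp_dist_mink x y (l : R) : hyp x -> hyp y ->
  (riemannian_dist hyp x y < l%:E)%E -> - mink x y <= expR (2 * l).
Proof.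
move=> hx hy /riemannian_dist_chain[m [r [r0 rm hr lt]]].
have := hyp_mink_chain hx hr; rewrite r0 rm hx.1 opprK mul1r => /le_trans; apply.
by rewrite ler_expR ler_pM2l// ltW.
Qed.

Lemma hyp_dist_near x (e : R) : hyp x -> 0 < e -> exists2 d, 0 < d &
  forall y, hyp y -> (riemannian_dist hyp x y < d%:E)%E -> `|y - x| < e.
Proof.
move=> hx e0'; pose C := 4 * x ord0 0 ^+ 2 + 2.
have C0 : 0 < C by rewrite /C; have := sqr_ge0 (x ord0 0); lra.
pose h := Order.min 1 (e ^+ 2 / (12 * C)).
have h0 : 0 < h by rewrite lt_min ltr01 divr_gt0 ?exprn_gt0// mulr_gt0.
have h1 : h <= 1 by rewrite ge_min lexx.
have he : h * (12 * C) <= e ^+ 2 by rewrite -ler_pdivlMr ?mulr_gt0// ge_min lexx orbT.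
have h10 : 0 < 1 + h by lra.
(* With t = h/(1+h), exp(-t) >= 1 - t = 1/(1+h) gives exp(t) <= 1 + h. The Minkowski square is then
   at most 2h, and the squared norm at most C (2h + 4h^2) <= 6 C h <= e^2 / 2. *)
exists (h / (1 + h) / 2); first by rewrite !divr_gt0.
move=> y hy /(hyp_dist_mink hx hy); rewrite mulrC divfK// => le.
have ex : expR (h / (1 + h)) <= 1 + h.
  have t : 1 - h / (1 + h) = (1 + h)^-1 by field; rewrite gt_eqF.
  have := expR_ge1Dx (- (h / (1 + h))); rewrite t expRN.
  by rewrite lef_pV2 ?posrE ?expR_gt0.
have m2 : mink (y - x) (y - x) <= 2 * h.
  by rewrite !mink_lin hx.1 hy.1 (minkC y); lra.
have m0 : 0 <= mink (y - x) (y - x) := entire_spacelike hyp_entire hx hy.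
have := hyp_norm_le hx hy; rewrite -/C; move: (mink (y - x) (y - x)) m0 m2 => m m0 m2 nle.
have e2 : 0 < e ^+ 2 by rewrite exprn_gt0.
apply: lt_of_sqr; first exact: ltW.
apply: (le_lt_trans nle); apply: (@le_lt_trans _ _ (C * (6 * h))); last by lra.
rewrite ler_pM2l//; nra.
Qed.

Lemma dist_compact_hyp (K : set V) :
  dist_compact hyp (riemannian_dist hyp) K -> compact K.
Proof.
move=> [Khyp cK]; rewrite compact_cover => I D f fo cov.
have [i Di|x Kx|D' D'D cov'] := cK I D (fun i => f i `&` hyp).
- split; first by move=> x [].
  move=> x [fx hx]; have := fo i Di; rewrite openE => /(_ x fx) /nbhs_ballP[e /= e0' ef].
  have [d d0 hd] := hyp_dist_near hx e0'; exists d => // y hy xy; split=> //.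
  by apply: ef; rewrite mx_norm_ball /ball_ /= distrC; exact: hd.
- by have [i Di fi] := cov x Kx; exists i => //; split=> //; exact: Khyp.
- by exists D' => // x /cov'[i iD' [fi _]]; exists i.
Qed.

Lemma chord_le_norm p q : chord p q <= n.+1%:R * `|q - p|.
Proof.
have n1 : 1 <= n.+1%:R :> R by rewrite ler1n.
apply: le_of_sqr; first by rewrite mulr_ge0.
have [h|h] := leP 0 (mink (q - p) (q - p)).
  rewrite /chord sqr_sqrtr//; apply: le_trans (ler_norm _) _; apply: le_trans (mink_le _ _) _.
  have y0 := normr_ge0 (q - p); move: (n.+1%:R) `|q - p| n1 y0 => N1 y n1 y0.
  have : 0 <= (N1 - 1) * (N1 * (y * y)) by rewrite !mulr_ge0//; lra.
  by lra.
by rewrite /chord ler0_sqrtr ?(ltW h)// expr0n sqr_ge0.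
Qed.

Lemma compact_dist_compact S N (a : R) (K : set V) : entire_surface S N -> 0 < a ->
  K `<=` S -> compact K ->
  dist_compact S (fun x y => (a^-1)%:E * riemannian_dist S x y)%E K.
Proof.
move=> SN a0 KS cK; split=> // I D f fo cov.
have n0 : 0 < n.+1%:R :> R by rewrite ltr0n.
(* A part of [S] open for the distance becomes an ambient neighbourhood of its points once the
   complement of [S] is added, because chords bound distances from above. *)
have sub i x : D i -> f i x -> (f i `|` ~` S)° x.
  move=> Di fx; have [fS /(_ x fx)[e e0' he]] := fo i Di.
  apply/nbhs_ballP; exists (e * a / n.+1%:R); first by rewrite /= divr_gt0// mulr_gt0.
  move=> y; rewrite mx_norm_ball /ball_ /= distrC => lt.
  have [Sy|nSy] := pselect (S y); last by right.
  left; apply: he => //.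
  apply: (@le_lt_trans _ _ (a^-1%:E * (chord x y)%:E)%E).
    by rewrite lee_pmul2l// ?lte_fin ?invr_gt0//; exact: (riemannian_dist_le_chord SN (fS _ fx)).
  rewrite -EFinM lte_fin mulrC ltr_pdivrMr//; apply: (le_lt_trans (chord_le_norm _ _)).
  by rewrite mulrC -ltr_pdivlMr.
move: cK; rewrite compact_cover => cK.
have [i _|x Kx|D' D'D cov'] := cK I D (fun i => (f i `|` ~` S)°).
- exact: open_interior.
- by have [i Di fi] := cov x Kx; exists i => //; exact: sub.
- exists D' => // x Kx; have [i iD' /interior_subset[fi|nS]] := cov' x Kx.
    by exists i.
  by exfalso; apply: nS; exact: KS.
Qed.
End HyperbolicDistance.

(** * Gromov convergence at infinity *)

Section GromovConvergence.
Context {R : realType} {n : nat}.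
Local Notation V := 'cV[R]_n.+1.
Local Notation Mat := 'M[R]_n.+1.
Implicit Types (p q r v w x y z : V) (g h : Mat).
Variables (Gamma : set Mat) (tau : Mat -> V) (D : set V) (F : set (V * R)).
Hypotheses (hGamma : is_subgroup_of Gamma SO_plus) (hco : cocompact Gamma).
Hypotheses (htau : cocycle Gamma tau) (DF : null_domain D F).
Hypothesis hinv : invariant_under Gamma (affine_action tau) D.

Local Notation S := (level_surface D).
Local Notation N := (gauss D).

Lemma gauss_contracts (a : R) p q : 0 < a -> S a p -> S a q ->
  (riemannian_dist hyp (N p) (N q) <= a^-1%:E * riemannian_dist (S a) p q)%E.
Proof.
move=> a0 Sp Sq; have SN := level_entire DF a0.
rewrite lee_pdivlMl//; apply/lee_addgt0Pr => e e0'.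
have fin : (riemannian_dist (S a) p q < +oo)%E.
  exact: le_lt_trans (riemannian_dist_le_chord SN Sp Sq) (ltry _).
have d0 : (0 <= riemannian_dist (S a) p q)%E.
  by apply: le_ereal_inf_tmp => _ [c _ <-]; exact: path_length_ge0.
move: fin d0; case dE : (riemannian_dist (S a) p q) => [d| |]// _ _.
have /riemannian_dist_chain[m [r [r0 rm hr lt]]] : (riemannian_dist (S a) p q < (d + e)%:E)%E.
  by rewrite dE lte_fin ltrDl.
apply: (@le_trans _ _ (a%:E * (\sum_(i < m) chord (N (r i)) (N (r i.+1)))%:E)%E).
  rewrite lee_pmul2l// -r0 -rm.
  apply: (riemannian_dist_le_chain hyp_entire (r := N \o r)) => i im /=.
  exact: (normal_hyp SN (hr i im)).
rewrite -EFinM lee_fin; apply: le_trans (ltW lt); rewrite big_distrr.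
apply: ler_sum => i _ /=; apply: (level_chord_gauss DF a0); apply: hr => //.
exact: ltnW.
Qed.

(** Dividing q - p = d + a e by [a] leaves <e, e> up to a cross term in 1/a and a square in 1/a^2,
    estimated from |d| <= 2M and |e| <= 2k; the square root is subadditive. *)
Lemma level_chord_le (a M k : R) p q : 0 < a -> S a p -> S a q ->
  `|N p| <= k -> `|N q| <= k -> `|retraction D p| <= M -> `|retraction D q| <= M ->
  a^-1 * chord p q <= chord (N p) (N q) +
    Num.sqrt (n.+1%:R * (8 * k * M * a^-1 + 4 * M ^+ 2 * a^-1 ^+ 2)).
Proof.
move=> a0 Sp Sq kp kq Mp Mq.
have i0 : 0 < a^-1 by rewrite invr_gt0.
have M0 : 0 <= M by apply: le_trans Mp.
have k0 : 0 <= k by apply: le_trans kp.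
set d := retraction D q - retraction D p; set e := N q - N p.
have dM : `|d| <= 2 * M.
  by apply: le_trans (ler_normB _ _) _; apply: le_trans (lerD Mq Mp) _; lra.
have ek : `|e| <= 2 * k.
  by apply: le_trans (ler_normB _ _) _; apply: le_trans (lerD kq kp) _; lra.
have pqE : q - p = d + a *: e.
  by rewrite {1}(level_gaussE DF Sq) {1}(level_gaussE DF Sp); apply/matrixP => i j; rewrite !mxE; ring.
have c0 : 0 <= mink e e := entire_spacelike hyp_entire (gauss_hyp DF Sp.1) (gauss_hyp DF Sq.1).
have n0 : 0 <= n.+1%:R :> R by [].
set w := n.+1%:R * _.
have w0 : 0 <= w.
  by rewrite /w mulr_ge0// addr_ge0// !mulr_ge0// ?sqr_ge0// ltW.
have mle : mink (a^-1 *: (q - p)) (a^-1 *: (q - p)) <= mink e e + w.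
  have -> : a^-1 *: (q - p) = a^-1 *: d + e.
    by rewrite pqE scalerDr scalerA mulVf ?scale1r// gt_eqF.
  have -> : mink (a^-1 *: d + e) (a^-1 *: d + e) =
      mink e e + (2 * a^-1 * mink d e + a^-1 ^+ 2 * mink d d).
    by move: d e {dM ek pqE c0} => d e; rewrite !mink_lin (minkC e d); ring.
  rewrite lerD2l /w.
  have de : mink d e <= n.+1%:R * (2 * M * (2 * k)).
    apply: le_trans (ler_norm _) _; apply: le_trans (mink_le _ _) _.
    by apply: ler_wpM2l => //; apply: ler_pM.
  have dd : mink d d <= n.+1%:R * (2 * M * (2 * M)).
    apply: le_trans (ler_norm _) _; apply: le_trans (mink_le _ _) _.
    by apply: ler_wpM2l => //; apply: ler_pM.
  have i2 : 0 <= 2 * a^-1 by lra.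
  have h1 := ler_wpM2l i2 de; have h2 := ler_wpM2l (sqr_ge0 a^-1) dd.
  by apply: le_trans (lerD h1 h2) _; rewrite le_eqVlt; apply/orP; left; apply/eqP; ring.
have -> : a^-1 * chord p q = Num.sqrt (mink (a^-1 *: (q - p)) (a^-1 *: (q - p))).
  by rewrite minkZl minkZr mulrA -expr2 sqrtrM ?sqr_ge0// sqrtr_sqr gtr0_norm.
apply: le_trans (ler_wsqrtr mle) _.
apply: le_of_sqr; first by rewrite addr_ge0 ?sqrtr_ge0.
have mw0 : 0 <= mink e e + w by apply: addr_ge0.
rewrite (sqr_sqrtr mw0) sqrrD !sqr_sqrtr// -/w.
have : 0 <= chord (N p) (N q) * Num.sqrt w by rewrite mulr_ge0 ?sqrtr_ge0.
rewrite -mulr_natr; lra.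
Qed.

(** The hyperbolic polygon from [x0] to [y0] is fixed before [a] and then lifted; only the two edges
    added at its ends depend on [p] and [q], which gives the uniformity near the pair. *)
Lemma level_dist_le_near x0 y0 (e : R) : hyp x0 -> hyp y0 -> 0 < e ->
  exists2 d, 0 < d & \forall a \near +oo, forall p q, S a p -> S a q ->
    `|N p - x0| < d -> `|N q - y0| < d ->
    (a^-1%:E * riemannian_dist (S a) p q <=
      riemannian_dist hyp (N p) (N q) + e%:E)%E.
Proof.
(* The six parts: one for the choice of the polygon, two for the end edges, one for the errors [w a]
   of all m + 2 edges together, two for passing from [x0] and [y0] to N(p) and N(q). *)
move=> hx hy e0'; pose e6 := e / 6; have e60 : 0 < e6 by rewrite divr_gt0.
have n0 : 0 < n.+1%:R :> R by rewrite ltr0n.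
have fin : (riemannian_dist hyp x0 y0 < +oo)%E.
  exact: le_lt_trans (riemannian_dist_le_chord hyp_entire hx hy) (ltry _).
have d0 : (0 <= riemannian_dist hyp x0 y0)%E.
  by apply: le_ereal_inf_tmp => _ [c _ <-]; exact: path_length_ge0.
move: fin d0; case dE : (riemannian_dist hyp x0 y0) => [l| |]// _ _.
have /riemannian_dist_chain[m [r [r0 rm hr lt]]] :
    (riemannian_dist hyp x0 y0 < (l + e6)%:E)%E by rewrite dE lte_fin ltrDl.
pose d := Order.min 1 (e6 / n.+1%:R).
have dp : 0 < d by rewrite lt_min ltr01 divr_gt0.
have d1 : d <= 1 by rewrite ge_min lexx.
have dn : n.+1%:R * d <= e6 by rewrite mulrC -ler_pdivlMr// ge_min lexx orbT.
(* The additional 1 leaves room for N(p) and N(q), which are within d <= 1 of the end vertices. *)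
pose k := \sum_(i < m.+1) `|r i| + 1.
have rk i : (i <= m)%N -> `|r i| + 1 <= k.
  move=> im; rewrite lerD2r (bigD1 (Ordinal (im : (i < m.+1)%N)))//= lerDl.
  by apply: sumr_ge0.
have [M hM] := level_retraction_bounded hGamma hco htau DF hinv k.
exists d => //.
pose w a := Num.sqrt (n.+1%:R * (8 * k * M * a^-1 + 4 * M ^+ 2 * a^-1 ^+ 2)).
have wc : w a @[a --> +oo] --> (0 : R).
  have ic : (a : R)^-1 @[a --> +oo] --> (0 : R).
    by apply/gtr0_cvgV0; [exact: nbhs_pinfty_gt|exact: cvg_id].
  have := sqrtr0 R; rewrite -[X in Num.sqrt X](mulr0 n.+1%:R) => <-.
  apply: continuous_cvg; first exact: sqrt_continuous.
  apply: cvgMr; rewrite -[X in _ --> X](addr0 0); apply: cvgD.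
    by rewrite -[X in _ --> X](mulr0 (8 * k * M)); apply: cvgMr.
  rewrite -[X in _ --> X](mulr0 (4 * M ^+ 2)); apply: cvgMr.
  by rewrite -[X in _ --> X](mulr0 0); apply: cvgM.
have : \forall a \near +oo, w a * (m.+2)%:R <= e6.
  have m0 : 0 < m.+2%:R :> R by rewrite ltr0n.
  have /cvgrPdist_le /(_ (e6 / m.+2%:R) (divr_gt0 e60 m0)) := wc.
  apply: filterS => a; rewrite sub0r normrN => h.
  by rewrite -ler_pdivlMr//; apply: le_trans h; exact: ler_norm.
move=> wn; near=> a => p q Sp Sq px qy.
have a0 : 0 < a by near: a; exact: nbhs_pinfty_gt.
have we : w a * m.+2%:R <= e6 by near: a.
have i0 : 0 < a^-1 by rewrite invr_gt0.
have SN := level_entire DF a0.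
have near_k x i : `|x - r i| < d -> (i <= m)%N -> `|x| <= k.
  move=> xr im; apply: le_trans (rk i im).
  rewrite -[x](subrK (r i)); apply: le_trans (ler_normD _ _) _.
  by rewrite addrC lerD2l (le_trans (ltW xr)).
have pk : `|N p| <= k by apply: (near_k _ 0%N) => //; rewrite r0.
have qk : `|N q| <= k by apply: (near_k _ m) => //; rewrite rm.
have lift i : exists p, (i <= m)%N -> S a p /\ N p = r i.
  have [im|] := leqP i m; last by exists 0.
  have [p' Sp' Np'] := gauss_onto hGamma hco htau DF hinv a0 (hr i im).
  by exists p'.
pose s i := projT1 (cid (lift i)).
have sP i : (i <= m)%N -> S a (s i) /\ N (s i) = r i := projT2 (cid (lift i)).
have sk i : (i <= m)%N -> `|N (s i)| <= k.
  by move=> im; rewrite (sP i im).2; apply: le_trans (rk i im); rewrite lerDl.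
have step u v : S a u -> S a v -> `|N u| <= k -> `|N v| <= k ->
    a^-1 * chord u v <= chord (N u) (N v) + w a.
  by move=> Su Sv ku kv; apply: level_chord_le => //; apply: (hM a).
have Sm i : (i <= m)%N -> S a (s i) by move=> /sP[].
have dist_le : (riemannian_dist (S a) p q <=
    (chord p (s 0%N) + \sum_(i < m) chord (s i) (s i.+1) + chord (s m) q)%:E)%E.
  rewrite !EFinD; apply: le_trans (riemannian_dist_triangle _ _ (s m) _) _.
  apply: leeD; last exact: (riemannian_dist_le_chord SN (Sm m (leqnn m)) Sq).
  apply: le_trans (riemannian_dist_triangle _ _ (s 0%N) _) _.
  apply: leeD; first exact: (riemannian_dist_le_chord SN Sp (Sm 0%N (leq0n m))).
  exact: (riemannian_dist_le_chain SN Sm).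
have real_le : a^-1 * (chord p (s 0%N) + \sum_(i < m) chord (s i) (s i.+1) + chord (s m) q)
    <= l + 4 * e6.
  have h1 := step p (s 0%N) Sp (Sm _ (leq0n m)) pk (sk _ (leq0n m)).
  have h3 := step (s m) q (Sm _ (leqnn m)) Sq (sk _ (leqnn m)) qk.
  have h2 : a^-1 * (\sum_(i < m) chord (s i) (s i.+1)) <=
      \sum_(i < m) chord (r i) (r i.+1) + w a * m%:R.
    rewrite big_distrr /= mulr_natr -[X in _ *+ X]card_ord -sumr_const -big_split /=.
    apply: ler_sum => i _; have im := ltn_ord i.
    have := step (s i) (s i.+1) (Sm _ (ltnW im)) (Sm _ im) (sk _ (ltnW im)) (sk _ im).
    by rewrite (sP i (ltnW im)).2 (sP i.+1 im).2.
  have c1 : chord (N p) (N (s 0%N)) <= e6.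
    rewrite (sP _ (leq0n m)).2 r0; apply: le_trans (chord_le_norm _ _) _.
    by apply: le_trans dn; rewrite ler_pM2l// distrC ltW.
  have c3 : chord (N (s m)) (N q) <= e6.
    rewrite (sP _ (leqnn m)).2 rm; apply: le_trans (chord_le_norm _ _) _.
    by apply: le_trans dn; rewrite ler_pM2l// ltW.
  move: we; rewrite -natr1 -(natr1 m); lra.
have hyp_le : (l%:E <= riemannian_dist hyp (N p) (N q) + (2 * e6)%:E)%E.
  have hp := gauss_hyp DF Sp.1; have hq := gauss_hyp DF Sq.1.
  have small x y : hyp x -> hyp y -> `|y - x| < d -> (riemannian_dist hyp x y <= e6%:E)%E.
    move=> hx' hy' xy; apply: le_trans (riemannian_dist_le_chord hyp_entire hx' hy') _.
    rewrite lee_fin; apply: le_trans (chord_le_norm _ _) _; apply: le_trans dn.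
    by rewrite ler_pM2l// ltW.
  rewrite -dE; apply: le_trans (riemannian_dist_triangle _ _ (N p) _) _.
  rewrite (_ : 2 * e6 = e6 + e6); last by ring.
  rewrite EFinD addeCA; apply: leeD; first exact: small.
  apply: le_trans (riemannian_dist_triangle _ _ (N q) _) _.
  by apply: leeD => //; apply: small => //; rewrite distrC.
apply: (@le_trans _ _ (l%:E + (4 * e6)%:E)%E).
  rewrite -EFinD; apply: le_trans (lee_wpmul2l _ dist_le) _; first by rewrite lee_fin ltW.
  by rewrite -EFinM lee_fin.
apply: le_trans (leeD hyp_le (lexx _)) _.
rewrite -addeA; apply: leeD => //; rewrite -EFinD lee_fin /e6; lra.
Unshelve. all: by end_near. Qed.

(** The relation is the graph of the Gauss map over [K]. Its equivariance gives the clause on the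
    group, its contraction one distance inequality; the other is local by [level_dist_le_near] and
    made uniform by covering K x K. *)
Theorem level_gromov_converges :
  gromov_converges Gamma (pinfty_nbhs R) (affine_action tau) S
    (fun a x y => (a^-1)%:E * riemannian_dist (S a) x y)%E
    linear_action hyp (riemannian_dist hyp).
Proof.
move=> K e P cK e0' _ PG; have Khyp := cK.1; have {}cK := dist_compact_hyp cK.
have e2 : 0 < e / 2 by rewrite divr_gt0.
have cKK := compact_setX cK cK.
move/compact_near_coveringP: cKK => /(_ R (pinfty_nbhs R) (fun a xy => forall p q,
  S a p -> S a q -> N p = xy.1 -> N q = xy.2 ->
  (a^-1%:E * riemannian_dist (S a) p q <=
    riemannian_dist hyp (N p) (N q) + (e / 2)%:E)%E) _) nc.
have {}nc : \forall a \near +oo, forall p q, S a p -> S a q -> K (N p) -> K (N q) ->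
  (a^-1%:E * riemannian_dist (S a) p q <=
    riemannian_dist hyp (N p) (N q) + (e / 2)%:E)%E.
  apply: (filterS _ (nc _)) => [a h p q Sp Sq Kp Kq|].
    by apply: (h (N p, N q)).
  move=> [x y] [/= Kx Ky].
  have [d d0 hd] := level_dist_le_near (Khyp _ Kx) (Khyp _ Ky) e2.
  exists (ball (x, y) d, [set a | forall p q, S a p -> S a q ->
    `|N p - x| < d -> `|N q - y| < d ->
    (a^-1%:E * riemannian_dist (S a) p q <=
      riemannian_dist hyp (N p) (N q) + (e / 2)%:E)%E]) => /=.
    by split; [exact: nbhsx_ballx|exact: hd].
  move=> [[x' y'] a] /= [[bx by_] h] p q Sp Sq Np Nq; apply: h => //.
    by rewrite Np distrC; move: bx; rewrite /= mx_norm_ball.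
  by rewrite Nq distrC; move: by_; rewrite /= mx_norm_ball.
near=> a; have a0 : 0 < a by near: a; exact: nbhs_pinfty_gt.
have upper : forall p q, S a p -> S a q -> K (N p) -> K (N q) ->
  (a^-1%:E * riemannian_dist (S a) p q <=
    riemannian_dist hyp (N p) (N q) + (e / 2)%:E)%E by near: a.
exists (S a `&` [set p | K (N p)]), (fun x p => [/\ K x, S a p & N p = x]).
split.
- apply: (compact_dist_compact (level_entire DF a0) a0); first by move=> p [].
  exact: (level_preimage_compact hGamma hco htau DF hinv a0 Khyp cK).
- by move=> x p [Kx Sp Np]; split=> //; split=> //=; rewrite Np.
- split=> [x Kx|p [Sp Kp]]; last by exists (N p).
  have [p Sp Np] := gauss_onto hGamma hco htau DF hinv a0 (Khyp x Kx).
  by exists p.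
- move=> x y p q [Kx Sp Np] [Ky Sq Nq].
  have := gauss_contracts a0 Sp Sq; have := upper p q Sp Sq.
  rewrite Np Nq => /(_ Kx Ky).
  have : (riemannian_dist hyp x y < +oo)%E.
    exact: le_lt_trans (riemannian_dist_le_chord hyp_entire (Khyp _ Kx) (Khyp _ Ky)) (ltry _).
  have : (0 <= riemannian_dist hyp x y)%E.
    by apply: le_ereal_inf_tmp => _ [c _ <-]; exact: path_length_ge0.
  case: (riemannian_dist hyp x y) => [l| |]// _ _.
  case: (_ * riemannian_dist _ _ _)%E => [u| |]//.
  rewrite -EFinD !lee_fin => h1 h2; rewrite -EFinB abse_EFin lte_fin.
  by rewrite ltr_norml; lra.
- move=> g x p Pg Kx Kgx [_ Sp Np].
  have Gg := PG g Pg; have Sgp := level_stable hGamma htau DF hinv Gg Sp.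
  have Ngp : N (affine_action tau g p) = linear_action g x.
    by rewrite (gauss_equivariant hGamma htau DF hinv Gg Sp.1) Np.
  by split; split=> //; rewrite /= Ngp.
Unshelve. all: by end_near. Qed.
End GromovConvergence.

(** The lower bound by [L] itself lets [L] be infinite: then [f] is eventually infinite. *)
Lemma ereal_cvg_from_above {R : realType} {T : Type} (F : set_system T) (f : T -> \bar R)
    (L : \bar R) : Filter F -> (0 <= L)%E -> (\forall a \near F, (L <= f a)%E) ->
  (forall l : R, (L < l%:E)%E -> \forall a \near F, (f a <= l%:E)%E) ->
  f a @[a --> F] --> L.
Proof.
move=> FF; case: L => [r| |]// _ lo up.
  move=> A Ar; have [e e0' he] : exists2 e, 0 < e & forall u : R, `|r - u| < e -> A u%:E.
    have /nbhs_ballP[e e0' he] : nbhs r (fun u => A u%:E) by [].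
    by exists e => // u ru; apply: he.
  have re : (r%:E < (r + e / 2)%:E)%E by rewrite lte_fin ltrDl divr_gt0.
  suff : \forall a \near F, A (f a) by [].
  near=> a.
  have : (r%:E <= f a)%E by near: a.
  have : (f a <= (r + e / 2)%:E)%E by near: a; exact: up.
  case: (f a) => [u| |]//; rewrite !lee_fin => u1 u2.
  apply: he; rewrite ltr_norml; lra.
move=> A /= [M [_ hM]]; apply: filterS lo => a; rewrite leye_eq => /eqP fa.
by rewrite /= fa; apply: hM; rewrite ltry.
Unshelve. all: by end_near. Qed.

(** * The length spectrum near the singularity *)

Section SingularSpectrum.
Context {R : realType} {n : nat}.
Local Notation V := 'cV[R]_n.+1.
Local Notation Mat := 'M[R]_n.+1.
Implicit Types (p q r v w x y z : V) (g h : Mat).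
Variables (Gamma : set Mat) (tau : Mat -> V) (D : set V) (F : set (V * R)).
Hypotheses (hGamma : is_subgroup_of Gamma SO_plus).
Hypotheses (htau : cocycle Gamma tau) (DF : null_domain D F).
Hypothesis hinv : invariant_under Gamma (affine_action tau) D.

Local Notation S := (level_surface D).
Local Notation N := (gauss D).

(** Makes the retracted path admissible in [singularity_dist]. As r = p - a N on the surface, it
    suffices that N is Lipschitz along the path, which [level_norm_gauss] gives once the time
    coordinate of N is bounded there. *)
Lemma retraction_lipschitz_path (a : R) (c : R -> V) : 0 < a -> lipschitz_path c ->
  {in `[0, 1], forall t, S a (c t)} -> lipschitz_path (retraction D \o c).
Proof.
move=> a0 /lipschitz_pathP[k k0 hk] Sc.
have {}Sc t : 0 <= t <= 1 -> S a (c t) by move=> t01; apply: Sc; rewrite in_itv.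
have SN := level_entire DF a0.
pose mu : R := n.+1%:R * k ^+ 2 / a ^+ 2.
have mu0 : 0 <= mu by rewrite /mu !mulr_ge0// ?sqr_ge0// invr_ge0 sqr_ge0.
have small s t : 0 <= s <= 1 -> 0 <= t <= 1 ->
    mink (c t - c s) (c t - c s) / a ^+ 2 + (mink (c t - c s) (c t - c s) / a ^+ 2) ^+ 2 <= (mu + mu ^+ 2) * `|t - s| ^+ 2.
  move=> s01 t01; set m := _ / a ^+ 2; have Ss := Sc s s01; have St := Sc t t01.
  have m0 : 0 <= m by rewrite divr_ge0 ?sqr_ge0// (entire_spacelike SN).
  have mm : m <= mu * `|t - s| ^+ 2.
    rewrite /m /mu ler_pdivrMr ?exprn_gt0//.
    have -> : n.+1%:R * k ^+ 2 / a ^+ 2 * `|t - s| ^+ 2 * a ^+ 2 =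
        n.+1%:R * ((k * `|t - s|) * (k * `|t - s|)).
      by rewrite mulrAC divfK ?expf_neq0 ?gt_eqF//; ring.
    apply: le_trans (ler_norm _) _; apply: le_trans (mink_le _ _) _.
    by rewrite ler_wpM2l//; apply: ler_pM => //; exact: hk.
  have d1 : `|t - s| <= 1 by rewrite ler_norml; lra.
  have d2 : `|t - s| ^+ 2 <= 1 by rewrite expr_le1.
  move: (`|t - s| ^+ 2) (sqr_ge0 `|t - s|) d2 mm => d d0 d2.
  move: m m0 => m m0 mm.
  have m2 : m ^+ 2 <= (mu * d) ^+ 2.
    by rewrite ler_sqr ?nnegrE// mulr_ge0.
  have : mu ^+ 2 * (d * d) <= mu ^+ 2 * d.
    by apply: ler_wpM2l; [exact: sqr_ge0|rewrite -[leRHS]mulr1; apply: ler_wpM2l].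
  move: m2; rewrite exprMn (expr2 d); lra.
have h0 : (0 : R) <= (0 : R) <= (1 : R) by rewrite lexx ler01.
(* From u^2 <= 2 w^2 + 2 (u - w)^2, with [w] the time coordinate of N at the start of the path. *)
pose B : R := 2 * N (c 0) ord0 0 ^+ 2 + 2 * ((4 * N (c 0) ord0 0 ^+ 2 + 2) * (mu + mu ^+ 2)).
have mu20 : 0 <= mu + mu ^+ 2 by rewrite addr_ge0// sqr_ge0.
have NB t : 0 <= t <= 1 -> N (c t) ord0 0 ^+ 2 <= B.
  move=> t01; have := level_norm_gauss DF a0 (Sc 0 h0) (Sc t t01).
  cbv zeta => nn.
  have f0 : 0 <= 4 * N (c 0) ord0 0 ^+ 2 + 2 by rewrite addr_ge0// mulr_ge0// sqr_ge0.
  have := le_trans nn (ler_wpM2l f0 (small 0 t h0 t01)).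
  have tt : (mu + mu ^+ 2) * `|t - 0| ^+ 2 <= mu + mu ^+ 2.
    rewrite -[leRHS]mulr1; apply: ler_wpM2l => //; rewrite expr_le1// subr0 ger0_norm; lra.
  move=> /le_trans /(_ (ler_wpM2l f0 tt)).
  have : forall u v : V, `|u ord0 0 - v ord0 0| <= `|u - v|.
    by move=> u v; have := time_le_norm (u - v) ord0; rewrite !mxE.
  move=> /(_ (N (c t)) (N (c 0))); rewrite /B.
  move: (`|N (c t) - _|) (normr_ge0 (N (c t) - N (c 0))) => x x0 ux.
  move: (_ * (mu + _)) => z xz.
  have : (N (c t) ord0 0 - N (c 0) ord0 0) ^+ 2 <= x ^+ 2.
    by rewrite -[X in X <= _](real_normK (num_real _)) ler_sqr ?nnegrE.
  have := sqr_ge0 (N (c t) ord0 0 - 2 * N (c 0) ord0 0).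
  move: (N (c t) ord0 0) (N (c 0) ord0 0) => u w; nra.
have B0 : 0 <= B by apply: le_trans (NB 0 h0); exact: sqr_ge0.
pose C : R := (4 * B + 2) * (mu + mu ^+ 2).
have C0 : 0 <= C by rewrite mulr_ge0// addr_ge0// mulr_ge0.
have NL s t : 0 <= s <= 1 -> 0 <= t <= 1 -> `|N (c t) - N (c s)| <= Num.sqrt C * `|t - s|.
  move=> s01 t01; apply: le_of_sqr; first by rewrite mulr_ge0 ?sqrtr_ge0.
  rewrite exprMn sqr_sqrtr// /C -mulrA.
  have := level_norm_gauss DF a0 (Sc s s01) (Sc t t01); cbv zeta => nn.
  apply: le_trans nn _; apply: ler_pM.
  - by rewrite addr_ge0// mulr_ge0// sqr_ge0.
  - rewrite addr_ge0 ?sqr_ge0// divr_ge0 ?sqr_ge0//.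
    exact: (entire_spacelike SN (Sc s s01) (Sc t t01)).
  - by rewrite lerD2r ler_pM2l// NB.
  - exact: small.
exists (k + a * Num.sqrt C) => -[s t] /= [].
rewrite !in_itv /= => s01 t01.
have rE u : 0 <= u <= 1 -> retraction D (c u) = c u - a *: N (c u).
  by move=> u01; apply/eqP; rewrite eq_sym subr_eq -(level_gaussE DF (Sc u u01)).
have -> : retraction D (c s) - retraction D (c t) =
    (c s - c t) - a *: (N (c s) - N (c t)).
  by rewrite !rE// scalerBr !opprD !opprK addrACA.
apply: le_trans (ler_normB _ _) _; rewrite mulrDl; apply: lerD; first exact: hk.
by rewrite normrZ gtr0_norm// -mulrA ler_wpM2l// ?NL// ltW.
Qed.

Lemma retraction_path_length (a : R) (c : R -> V) : 0 < a -> lipschitz_path c ->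
  {in `[0, 1], forall t, S a (c t)} ->
  (path_length (retraction D \o c) <= path_length c)%E.
Proof.
move=> a0 lc Sc; have lr := retraction_lipschitz_path a0 lc Sc.
apply: (lee_cvg_to (chord_sum_cvg lr) (chord_sum_cvg lc)).
apply: nearW => m; rewrite lee_fin; apply: ler_sum => i _ /=.
have in01 j : (j <= m)%N -> S a (c (j%:R / m%:R)).
  move=> jm; apply: Sc; rewrite in_itv /=.
  have m0 : 0 < m%:R :> R by rewrite ltr0n (leq_ltn_trans _ (ltn_ord i)).
  by rewrite divr_ge0//= ler_pdivrMr// mul1r ler_nat.
by apply: (level_chord_ret DF a0); apply: in01 => //; exact: ltnW.
Qed.

(** By equivariance, retracting a path from [x] to its translate gives a path in the boundary from
    r(x) to the translate of r(x). *)
Lemma singularity_spectrum_le (a : R) g : 0 < a -> Gamma g ->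
  (length_spectrum (affine_action tau) (past_singularity D) (singularity_dist D) g <=
   length_spectrum (affine_action tau) (S a) (riemannian_dist (S a)) g)%E.
Proof.
move=> a0 Gg; apply: le_ereal_inf_tmp => _ [x Sx <-].
apply: le_ereal_inf_tmp => _ [c [pc Sc c0 c1] <-].
have lc := piecewise_C1_lipschitz pc.
apply: le_trans (retraction_path_length a0 lc Sc).
apply: (@le_trans _ _ (singularity_dist D (retraction D x)
    (affine_action tau g (retraction D x)))).
  apply: ereal_inf_lbound; exists (retraction D x) => //.
  by exists x => //; exact: Sx.1.
apply: ereal_inf_lbound; exists (retraction D \o c) => //; split => /=.
- exact: (retraction_lipschitz_path a0 lc Sc).
- by move=> t t01; apply: (retraction_boundary DF); exact: (Sc t t01).1.
- by rewrite c0.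
- by rewrite c1 (retraction_equivariant hGamma htau DF hinv Gg Sx.1).
Qed.

(** A negative shift would put [p] in the domain; a positive one is at most the cosmological time
    [a], because [p] competes in the maximum defining that time, at distance [s]. *)
Lemma level_above_boundary (a : R) p : 0 < a -> boundary D p ->
  exists2 s, 0 <= s <= a & S a (p + s *: e0).
Proof.
move=> a0 /(boundary_domainE DF)[cp nDp].
have [s Ss] := vertical_meet (level_entire DF a0) p.
exists s => //; apply/andP; split.
  rewrite leNgt; apply/negP => s0; apply: nDp.
  have -> : p = (p + s *: e0) + (- s) *: e0 by rewrite scaleNr addrK.
  apply: (closure_domain_ft DF); first exact: subset_closure Ss.1.
  by apply: ftZ; [rewrite oppr_gt0|exact: ft_e0].
have [s0|/ltW s0] := leP s 0; first exact: le_trans s0 (ltW a0).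
have [_ _ /(_ p cp)] := retractionP DF Ss.1.
rewrite -/(cosmological_time D _) Ss.2 /causal_past /lorentz_dist /= addrAC subrr add0r.
rewrite minkZl minkZr mink_e0e0 mulrN1 mulrN opprK -expr2 sqrtr_sqr ger0_norm//; apply.
by apply: fcZ => //; apply: ft_fc; exact: ft_e0.
Qed.

(** A polygon nearly realizing the infimum is fixed before [a] and moved up into the surface. The
    lifted polygon need not end at the translate of its first vertex, so one more short edge closes
    it. *)
Lemma level_spectrum_near (g : Mat) (l : R) : Gamma g ->
  (length_spectrum (affine_action tau) (past_singularity D) (singularity_dist D) g < l%:E)%E ->
  \forall a \near 0^'+,
    (length_spectrum (affine_action tau) (S a) (riemannian_dist (S a)) g <= l%:E)%E.
Proof.
move=> Gg /ereal_inf_lt[_ [x [x' Dx' <-] <-]] /ereal_inf_lt[_ [c [lc bc c0 c1] <-]] lt.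
have [m [p [p0 pm bp {}lt]]] := path_chain lc bc c0 c1 lt.
(* [B] bounds each time increment of the polygon, so shifts between 0 and [a] add at most 2 B a to
   the square of an edge; [k] bounds the square of the closing edge by 2 k a^2. *)
pose B := \sum_(i < m) `|p i.+1 - p i|.
pose k : R := `|mink (g *m e0) (e0 : V)|.
pose w a := Num.sqrt (2 * B * a) * m%:R + Num.sqrt (2 * k * a ^+ 2).
have wc : w a @[a --> 0^'+] --> (0 : R).
  have w0 : w 0 = 0 by rewrite /w expr0n /= !mulr0 sqrtr0 mul0r addr0.
  suff : w a @[a --> 0] --> w 0 by move=> /cvg_at_right_filter; rewrite w0.
  apply: cvgD.
    apply: cvgMl; apply: continuous_cvg; first exact: sqrt_continuous.
    by apply: cvgMr; exact: cvg_id.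
  apply: continuous_cvg; first exact: sqrt_continuous.
  by apply: cvgMr; apply: cvgM; exact: cvg_id.
have gap : 0 < l - \sum_(i < m) chord (p i) (p i.+1) by rewrite subr_gt0.
have {wc} wl : \forall a \near 0^'+, w a <= l - \sum_(i < m) chord (p i) (p i.+1).
  have /cvgrPdist_le /(_ _ gap) := wc.
  by apply: filterS => a; rewrite sub0r normrN; apply: le_trans; exact: ler_norm.
near=> a; have a0 : 0 < a by near: a; exact: nbhs_right_gt.
have SN := level_entire DF a0.
have lift i : exists s, (i <= m)%N -> 0 <= s <= a /\ S a (p i + s *: e0).
  have [im|] := leqP i m; last by exists 0.
  by have [s s0a Ss] := level_above_boundary a0 (bp i im); exists s.
pose s i := projT1 (cid (lift i)).
have sP i : (i <= m)%N -> 0 <= s i <= a /\ S a (p i + s i *: e0) := projT2 (cid (lift i)).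
pose q i := p i + s i *: e0.
have Sq i : (i <= m)%N -> S a (q i) by move=> /sP[].
have sub_sqrt (u v : R) : 0 <= u -> 0 <= v -> Num.sqrt (u + v) <= Num.sqrt u + Num.sqrt v.
  move=> u0 v0; apply: le_of_sqr; first by rewrite addr_ge0 ?sqrtr_ge0.
  rewrite sqr_sqrtr ?addr_ge0// sqrrD !sqr_sqrtr//.
  have : 0 <= Num.sqrt u * Num.sqrt v by rewrite mulr_ge0 ?sqrtr_ge0.
  rewrite -mulr_natr; lra.
have step i : (i < m)%N -> chord (q i) (q i.+1) <= chord (p i) (p i.+1) + Num.sqrt (2 * B * a).
  move=> im; have [/andP[s0 sa] _] := sP i (ltnW im); have [/andP[s0' sa'] _] := sP i.+1 im.
  have dB : `|(p i.+1 - p i) ord0 0| <= B.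
    apply: le_trans (time_le_norm _ _) _; rewrite /B (bigD1 (Ordinal im))//= lerDl.
    by apply: sumr_ge0.
  have sl : 0 <= mink (p i.+1 - p i) (p i.+1 - p i) by exact: (boundary_spacelike DF (bp _ im) (bp _ (ltnW im))).
  have B0 : 0 <= B by apply: le_trans dB.
  rewrite /chord; apply: le_trans (sub_sqrt _ _ sl _); last by rewrite !mulr_ge0// ltW.
  apply: ler_wsqrtr.
  have -> : q i.+1 - q i = (p i.+1 - p i) + (s i.+1 - s i) *: e0.
    by rewrite /q; apply/matrixP => i' j'; rewrite !mxE; ring.
  move: (p i.+1 - p i) (s i.+1) (s i) s0 sa s0' sa' dB {sl} => d u v v0 va u0 ua dB.
  have -> : mink (d + (u - v) *: e0) (d + (u - v) *: e0) =
      mink d d + 2 * ((u - v) * mink d e0) + (u - v) ^+ 2 * mink e0 (e0 : V).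
    by rewrite minkDl !minkDr !minkZl !minkZr (minkC e0 d); ring.
  rewrite mink_e0e0 mink_e0 mulrN1.
  have : `|(u - v) * - d ord0 0| <= a * B.
    rewrite normrM normrN; apply: ler_pM => //; rewrite ler_norml; lra.
  move=> /(le_trans (ler_norm _)); have := sqr_ge0 (u - v); lra.
have closing : chord (q m) (affine_action tau g (q 0%N)) <= Num.sqrt (2 * k * a ^+ 2).
  have [/andP[s0 sa] _] := sP m (leqnn m); have [/andP[s0' sa'] _] := sP 0%N (leq0n m).
  apply: ler_wsqrtr.
  (* [g] maps the first boundary vertex to the last one, so only the two vertical shifts remain. *)
  have -> : affine_action tau g (q 0%N) - q m = s 0%N *: (g *m e0) - s m *: e0.
    rewrite /q p0 pm /affine_action mulmxDr -scalemxAr.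
    by apply/matrixP => i' j'; rewrite !mxE; ring.
  have -> (u v : R) : mink (u *: (g *m e0) - v *: e0) (u *: (g *m e0) - v *: e0) =
      u ^+ 2 * mink (e0 : V) e0 + v ^+ 2 * mink (e0 : V) e0 - 2 * (u * v * mink (g *m e0) e0).
    rewrite -scaleNr minkDl !minkDr !minkZl !minkZr (minkC e0 (g *m e0)) (Gamma_mink hGamma _ _ Gg).
    ring.
  rewrite mink_e0e0; move: (s 0%N) (s m) s0 sa s0' sa' => u v v0 va u0 ua.
  have : `|u * v * mink (g *m e0) (e0 : V)| <= a * a * k.
    by rewrite normrM ler_wpM2r// normrM; apply: ler_pM => //; rewrite ger0_norm.
  rewrite ler_norml => /andP[+ _]; have := sqr_ge0 u; have := sqr_ge0 v; lra.
apply: (@le_trans _ _ (riemannian_dist (S a) (q 0%N) (affine_action tau g (q 0%N)))).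
  by apply: ereal_inf_lbound; exists (q 0%N) => //; exact: Sq.
apply: le_trans (riemannian_dist_triangle _ _ (q m) _) _.
apply: (@le_trans _ _ ((\sum_(i < m) chord (q i) (q i.+1))%:E +
    (chord (q m) (affine_action tau g (q 0%N)))%:E)%E).
  apply: leeD; first exact: (riemannian_dist_le_chain SN Sq).
  apply: (riemannian_dist_le_chord SN); first exact: Sq.
  by apply: (level_stable hGamma htau DF hinv Gg); exact: Sq.
rewrite -EFinD lee_fin.
have sum_le : \sum_(i < m) chord (q i) (q i.+1) <=
    \sum_(i < m) chord (p i) (p i.+1) + Num.sqrt (2 * B * a) * m%:R.
  rewrite mulr_natr -[X in _ *+ X]card_ord -sumr_const -big_split /=.
  by apply: ler_sum => i _; exact: step.
have wa : w a <= l - \sum_(i < m) chord (p i) (p i.+1) by near: a.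
apply: le_trans (lerD sum_le closing) _; rewrite -addrA -lerBrDl; exact: wa.
Unshelve. all: by end_near. Qed.

Theorem level_spectrum_cvg g : Gamma g ->
  length_spectrum (affine_action tau) (S a) (riemannian_dist (S a)) g @[a --> 0^'+] -->
  length_spectrum (affine_action tau) (past_singularity D) (singularity_dist D) g.
Proof.
move=> Gg; apply: ereal_cvg_from_above.
- apply: le_ereal_inf_tmp => _ [x _ <-]; apply: le_ereal_inf_tmp => _ [c _ <-].
  exact: path_length_ge0.
- near=> a; apply: singularity_spectrum_le => //; near: a; exact: nbhs_right_gt.
- by move=> l; exact: level_spectrum_near.
Unshelve. all: by end_near. Qed.
End SingularSpectrum.

Theorem theorem2p5 (R : realType) (n : nat) (hn : (2 <= n)%N)
    (Gamma : set 'M[R]_n.+1)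
    (hGamma : is_subgroup_of Gamma SO_plus)
    (htf : torsion_free Gamma)
    (hdiscrete : discrete Gamma)
    (hcocompact : cocompact Gamma)
    (tau : 'M[R]_n.+1 -> 'cV[R]_n.+1)
    (htau : cocycle Gamma tau)
    (D : set 'cV[R]_n.+1)
    (hD : future_complete_regular_domain D)
    (hinv : invariant_under Gamma (affine_action tau) D) :
  (forall a : R, 0 < a ->
    [/\ invariant_under Gamma (affine_action tau) (level_surface D a),
        C1_spacelike_hypersurface (level_surface D a) &
        acts_by_isometries Gamma (affine_action tau)
          (level_surface D a) (riemannian_dist (level_surface D a))])
  /\
  gromov_converges Gamma (pinfty_nbhs R)
    (affine_action tau) (level_surface D)
    (fun a x y => (a^-1)%:E * riemannian_dist (level_surface D a) x y)%E
    linear_action hyp (riemannian_dist hyp)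
  /\
  (forall g, Gamma g -> g <> 1 ->
    length_spectrum (affine_action tau)
      (level_surface D a) (riemannian_dist (level_surface D a)) g
      @[a --> 0^'+] -->
    length_spectrum (affine_action tau)
      (past_singularity D) (singularity_dist D) g).
Proof.
have [F DF] := regular_null_domain hD; split=> [a a0|]; last split.
- have stable g p : Gamma g -> level_surface D a p -> level_surface D a (affine_action tau g p).
    exact: (level_stable hGamma htau DF hinv).
  split; first exact: (stable_invariant hGamma htau stable).
    exact: (level_C1 DF a0).
  exact: (stable_isometries hGamma htau stable).
- exact: (level_gromov_converges hGamma hcocompact htau DF hinv).
- by move=> g Gg _; exact: (level_spectrum_cvg hGamma htau DF hinv).
Qed.
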